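(* Let $p$ be a prime with $p\equiv 7\pmod{12}$, or $p\in\{37,61,73,109,157,181,229,277\}$. Then for every $u\equiv 2,4\pmod 6$ there exists a perfect 2-D $(u\times p,4,2)$-OOC, and for every $u\equiv 0\pmod 6$ there exists a 2-D $(u\times p,4,2)$-OOC with exactly $J^*(u\times p)=\left\lfloor\frac{u}{4}\left(\left\lfloor\frac{up-1}{3}\left\lfloor\frac{up-2}{2}\right\rfloor\right\rfloor-1\right)\right\rfloor$ codewords.
   Context: A 2-D $(u\times v,4,2)$-OOC is a family $\mathcal C$ of $u\times v$ $(0,1)$-matrices of Hamming weight $4$ such that for all $A=(a_{ij}),B=(b_{ij})\in\mathcal C$ and integers $r$ with $A\ne B$ or $r\not\equiv0\pmod v$, $\sum_{i,j}a_{ij}b_{i,j+r}\le 2$ (column indices mod $v$). It is perfect if it has exactly $u(uv-1)(uv-2)/24$ codewords. *)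

(* Defs.v *)
From mathcomp Require Import all_boot all_order all_algebra.
Set Implicit Arguments. Unset Strict Implicit. Unset Printing Implicit Defensive.

(* Column index j + r taken mod v (v > 0 follows from the existence of j). *)
Definition colshift (v : nat) (j : 'I_v) (r : nat) : 'I_v :=
  Ordinal (ltn_pmod (j + r) (leq_ltn_trans (leq0n j) (ltn_ord j))).

Definition mx_weight (u v : nat) (A : 'M[bool]_(u, v)) : nat :=
  \sum_(i < u) \sum_(j < v) (A i j : nat).

Definition corr (u v : nat) (A B : 'M[bool]_(u, v)) (r : nat) : nat :=
  \sum_(i < u) \sum_(j < v) ((A i j && B i (colshift j r)) : nat).

(* A 2-D (u x v, 4, 2)-OOC.  Shifts r range over nat, which covers all
   residues of integer shifts mod v. *)
Definition is_OOC_4_2 (u v : nat) (C : {set 'M[bool]_(u, v)}) : Prop :=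
  (forall A, A \in C -> mx_weight A = 4) /\
  (forall A B (r : nat), A \in C -> B \in C -> (A != B) || (r %% v != 0) ->
     corr A B r <= 2).

(* Perfect: exactly u(uv-1)(uv-2)/24 codewords (stated without division). *)
Definition is_perfect_OOC_4_2 (u v : nat) (C : {set 'M[bool]_(u, v)}) : Prop :=
  is_OOC_4_2 C /\ 24 * #|C| = u * (u * v - 1) * (u * v - 2).

Definition Jstar (u p : nat) : nat :=
  (u * (((u * p - 1) * ((u * p - 2) %/ 2)) %/ 3 - 1)) %/ 4.

(* Main.v *)
(** A design on F_p x U that is invariant under the translations of F_p yields
    the code: 4 is invertible mod p, so every translation orbit of blocks has
    exactly one member whose F_p-coordinates sum to 0, and these members are the
    codewords.  Two codewords meeting in three points after a shift would be
    translates of one another, by uniqueness of the block through three points.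

    The invariant design has three kinds of blocks.  Inside a fibre one places an
    SQS(u) when u = 2, 4 mod 6 (Hanani's theorem, proved by doubling, candelabra
    systems and fans), and when u = 0 mod 6 the packing that completes a
    G-design with groups of size 6 by three blocks in every group.  Triples with
    two points in one fibre are covered through a one-factorization of K_u.
    Triples in three fibres are covered by an H-design on F_p x {0, 1}, inflated
    by weights that sum to zero.

    The H-design starts from a translation-invariant system on F_p that covers
    every triple once, except the cubic triangles t + c{1, w, w^2} with w^3 = 1
    and c in a set C containing exactly one of c, -c.  For p = 7 mod 12 its
    blocks are the equianharmonic quadruples of one orientation; for the listed
    primes they are orbits of base blocks under an affine group of index 4 or 8.
    A missing triangle in one layer is closed by an apex in the other layer, and
    for a pair x, y of a layer the remaining points of the other layer are
    matched as consecutive terms of the progression x + k(x - y); a parity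
    condition on the apices makes this matching possible. *)

(* The parity condition has its origin in the matching. For a pair x, y of a layer, the points x +
   n(x - y) with 0 < n < p - 1 of the other layer are paired as n, n + 1 once the position n = [kap]
   of the apex of the missing triangle on x, y is removed. This is possible exactly when [kap] is
   odd, and the reversal of n to p - 1 - n, caused by exchanging x and y, keeps it odd. There is one
   apex for each pair because C contains exactly one of c, -c. If the apex is x + k(x - y) for one
   vertex x of the triangle, its positions along the three sides are k, wk - 1 and w^2(k + 1); so a
   single k with three odd residues serves all triangles. The second layer is the negative of the
   first: negation carries matched pairs to matched pairs, which halves the verification. For p = 7
   mod 12 the element -1 is a nonsquare, and the quadratic character distinguishes orientations. The
   listed primes are 1 mod 12, so -1 is a square; a multiplicative subgroup of odd order that
   contains w takes over, and its index is 4 or 8. *)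
From Stdlib Require Import NArith ClassicalEpsilon.
Require Import Defs.
From mathcomp Require Import all_boot all_order all_algebra.
From mathcomp Require Import finfield zify ring.
Set Implicit Arguments. Unset Strict Implicit. Unset Printing Implicit Defensive.
Import GRing.Theory.

(** * Designs *)

(** Blocks are a symmetric relation on ordered quadruples, [D] is the set of triples that lie in
    exactly one block, and no block contains a triple outside [D]. Keeping [D] free makes quadruple
    systems, candelabra systems, H-designs, G-designs and packings instances of one notion. *)
Record design (T : Type) (D : T -> T -> T -> Prop) (R : T -> T -> T -> T -> Prop) : Prop := Design {
  design12 : forall x y z w, R x y z w -> R y x z w;
  design23 : forall x y z w, R x y z w -> R x z y w;
  design34 : forall x y z w, R x y z w -> R x y w z;
  design_dom : forall x y z w, R x y z w -> D x y z;
  design_ex : forall x y z, D x y z -> exists w, R x y z w;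
  design_uniq : forall x y z w w', R x y z w -> R x y z w' -> w = w' }.

Definition has_design (T : Type) (D : T -> T -> T -> Prop) := exists R, design D R.

Definition distinct3 (T : eqType) (x y z : T) := [&& x != y, x != z & y != z].

Definition sqs (T : eqType) := has_design (fun x y z : T => distinct3 x y z).

Lemma perm4_12 (T : eqType) (x y z w : T) : perm_eq [:: x; y; z; w] [:: y; x; z; w].
Proof. by apply/permP => a /=; lia. Qed.
Lemma perm4_23 (T : eqType) (x y z w : T) : perm_eq [:: x; y; z; w] [:: x; z; y; w].
Proof. by apply/permP => a /=; lia. Qed.
Lemma perm4_34 (T : eqType) (x y z w : T) : perm_eq [:: x; y; z; w] [:: x; y; w; z].
Proof. by apply/permP => a /=; lia. Qed.

Section Toolkit.
Variable T : Type.
Implicit Types (D : T -> T -> T -> Prop) (R : T -> T -> T -> T -> Prop).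

Lemma design_eq D D' R : (forall x y z, D x y z <-> D' x y z) -> design D R -> design D' R.
Proof.
move=> e [s1 s2 s3 d x u]; split => //; first by move=> *; apply/e; apply: d; eauto.
by move=> a b c /e; apply: x.
Qed.

Lemma has_design_eq D D' :
  (forall x y z, D x y z <-> D' x y z) -> has_design D -> has_design D'.
Proof. by move=> e [R dR]; exists R; apply: design_eq dR. Qed.

Lemma design_union D1 D2 R1 R2 : (forall x y z, D1 x y z -> D2 x y z -> False) ->
  design D1 R1 -> design D2 R2 ->
  design (fun x y z => D1 x y z \/ D2 x y z) (fun x y z w => R1 x y z w \/ R2 x y z w).
Proof.
move=> dis [a1 a2 a3 ad ax au] [b1 b2 b3 bd bx bu]; split.
- by move=> x y z w [/a1|/b1]; [left|right].
- by move=> x y z w [/a2|/b2]; [left|right].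
- by move=> x y z w [/a3|/b3]; [left|right].
- by move=> x y z w [/ad|/bd]; [left|right].
- by move=> x y z [/ax|/bx] [w]; exists w; [left|right].
move=> x y z w w' [h|h] [h'|h'].
- exact: au h h'.
- by case: (dis x y z (ad _ _ _ _ h) (bd _ _ _ _ h')).
- by case: (dis x y z (ad _ _ _ _ h') (bd _ _ _ _ h)).
exact: bu h h'.
Qed.

Lemma has_design_union D1 D2 D : (forall x y z, D1 x y z -> D2 x y z -> False) ->
  (forall x y z, D x y z <-> D1 x y z \/ D2 x y z) ->
  has_design D1 -> has_design D2 -> has_design D.
Proof.
move=> dis e [R1 d1] [R2 d2]; exists (fun x y z w => R1 x y z w \/ R2 x y z w).
by apply: design_eq (design_union dis d1 d2) => x y z; rewrite e.
Qed.

Lemma design_none : design (fun _ _ _ : T => False) (fun _ _ _ _ => False).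
Proof. by split. Qed.

(** The pieces may overlap, provided that a block of one piece through a triple of another is a
    block of both. *)
Lemma design_big (I : Type) (D : I -> T -> T -> T -> Prop) (R : I -> T -> T -> T -> T -> Prop) :
  (forall i, design (D i) (R i)) ->
  (forall i j x y z w, D i x y z -> R j x y z w -> R i x y z w) ->
  design (fun x y z => exists i, D i x y z) (fun x y z w => exists i, R i x y z w).
Proof.
move=> d agree; split.
- by move=> x y z w [i h]; exists i; apply: design12 (d i) _ _ _ _ h.
- by move=> x y z w [i h]; exists i; apply: design23 (d i) _ _ _ _ h.
- by move=> x y z w [i h]; exists i; apply: design34 (d i) _ _ _ _ h.
- by move=> x y z w [i h]; exists i; apply: design_dom (d i) _ _ _ _ h.
- by move=> x y z [i /(design_ex (d i)) [w h]]; exists w, i.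
move=> x y z w w' [i h] [j h'].
apply: (design_uniq (d i) h); apply: agree h'; exact: design_dom (d i) _ _ _ _ h.
Qed.

Lemma design_map (A : Type) (f : A -> T) (D : A -> A -> A -> Prop)
    (R : A -> A -> A -> A -> Prop) : injective f ->
  design D R ->
  design (fun x y z => exists a b c, [/\ x = f a, y = f b, z = f c & D a b c])
    (fun x y z w => exists a b c d, [/\ x = f a, y = f b, z = f c, w = f d & R a b c d]).
Proof.
move=> fi [s1 s2 s3 sd sx su]; split.
- by move=> x y z w [a [b [c [d [-> -> -> -> /s1 h]]]]]; exists b, a, c, d.
- by move=> x y z w [a [b [c [d [-> -> -> -> /s2 h]]]]]; exists a, c, b, d.
- by move=> x y z w [a [b [c [d [-> -> -> -> /s3 h]]]]]; exists a, b, d, c.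
- by move=> x y z w [a [b [c [d [-> -> -> _ /sd h]]]]]; exists a, b, c.
- by move=> x y z [a [b [c [-> -> -> /sx [d h]]]]]; exists (f d), a, b, c, d.
move=> x y z w w' [a [b [c [d [-> -> -> -> h]]]]] [a' [b' [c' [d' [/fi ea /fi eb /fi ec -> h']]]]].
by subst a' b' c'; rewrite (su _ _ _ _ _ h h').
Qed.

(** Two copies with a common covered triple must be the same embedding; this yields the agreement
    that [design_big] asks for. *)
Lemma has_design_bigmap (I A : Type) (f : I -> A -> T) (D : A -> A -> A -> Prop) :
  (forall i, injective (f i)) ->
  (forall i j a b c a' b' c', D a b c -> D a' b' c' ->
     f i a = f j a' -> f i b = f j b' -> f i c = f j c' -> f i =1 f j) ->
  has_design D ->
  has_design (fun x y z => exists i a b c, [/\ x = f i a, y = f i b, z = f i c & D a b c]).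
Proof.
move=> fi ag [R dR]; eexists.
apply: (@design_big I _ _ (fun i => design_map (fi i) dR)).
move=> i j x y z w [a [b [c [ea eb ec dabc]]]] [a' [b' [c' [d' [ea' eb' ec' -> h']]]]].
have dabc' := design_dom dR h'.
have e : f i =1 f j by apply: (ag i j a b c a' b' c') => //; congruence.
by exists a', b', c', d'; rewrite !e.
Qed.

End Toolkit.

Lemma card_bij (A B : finType) : #|A| = #|B| -> exists f : A -> B, bijective f.
Proof.
move=> e; exists (fun a => enum_val (cast_ord e (enum_rank a))).
exists (fun b => enum_val (cast_ord (esym e) (enum_rank b))).
- by move=> a; rewrite enum_valK cast_ordK enum_rankK.
by move=> b; rewrite enum_valK cast_ordKV enum_rankK.
Qed.

Lemma has_design_bij (A B : Type) (f : A -> B) (D : A -> A -> A -> Prop) (D' : B -> B -> B -> Prop) :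
  bijective f -> (forall x y z, D x y z <-> D' (f x) (f y) (f z)) -> has_design D -> has_design D'.
Proof.
move=> [g fK gK] e [R dR]; eexists.
apply: (design_eq _ (design_map (can_inj fK) dR)) => x y z; split.
  by move=> [a [b [c [-> -> -> /e]]]].
by move=> h; exists (g x), (g y), (g z); split; rewrite ?gK //; apply/e; rewrite !gK.
Qed.

Lemma sqs_card (A B : finType) : #|A| = #|B| -> sqs A -> sqs B.
Proof.
case/card_bij => f bf; apply: (has_design_bij bf) => x y z.
by rewrite /distinct3 !(inj_eq (bij_inj bf)).
Qed.

(** * One-factorizations and fibred designs *)

Definition neqr (U : eqType) : rel U := fun x y => x != y.

(** Each colour that occurs is a perfect matching of the graph [e]: [onefact_ex] finds its edge at
    any vertex [z], [onefact_inj] excludes a second one. A general graph is allowed because tripling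
    factorizes only the pairs with certain differences. *)
Record onefact (U : eqType) (e : rel U) (K : Type) (c : U -> U -> K) : Prop := OneFact {
  onefact_edge : symmetric e;
  onefact_sym : forall x y, c x y = c y x;
  onefact_ex : forall x y z, e x y -> exists2 w, e z w & c z w = c x y;
  onefact_inj : forall z w w', e z w -> e z w' -> c z w = c z w' -> w = w' }.

(** The points are Z/(2n + 1) and infinity. The edge xy has colour x + y, and the edge from x to
    infinity takes the colour x + x that x leaves free; doubling is bijective because the modulus is
    odd. *)
Lemma onefact_option (n : nat) : exists c : option 'I_n.*2.+1 -> option 'I_n.*2.+1 -> 'I_n.*2.+1,
  onefact (@neqr _) c.
Proof.
pose c (a b : option 'I_n.*2.+1) : 'I_n.*2.+1 := match a, b with
  | Some x, Some y => (x + y)%R | Some x, None => (x + x)%R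
  | None, Some y => (y + y)%R | None, None => 0%R end.
have halfK (x : 'I_n.*2.+1) : (x *+ n.+1 + x *+ n.+1 = x)%R.
  rewrite -mulrnDr addSn addnS addnn mulrSr.
  suff -> : (x *+ n.*2.+1 = 0)%R by rewrite add0r.
  by apply: val_inj; rewrite Zp_mulrn /= modnMl.
have dblK (x : 'I_n.*2.+1) : exists y, (y + y = x)%R by exists (x *+ n.+1)%R.
have dblI (x y : 'I_n.*2.+1) : (x + x = y + y)%R -> x = y.
  by move=> e; rewrite -(halfK x) -(halfK y) -!mulrnDl e.
exists c; rewrite /neqr; split.
- by move=> x y; rewrite eq_sym.
- by move=> [x|] [y|] //=; rewrite addrC.
- move=> x y [z|] _; last by have [w hw] := dblK (c x y); exists (Some w).
  case: (eqVneq (c x y) (z + z)%R) => [->|h]; first by exists None.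
  exists (Some (c x y - z)%R); last by rewrite /= addrC subrK.
  by apply/negP => /eqP [e]; case/eqP: h; rewrite {2}e addrC subrK.
move=> [z|] [w|] [w'|] //=.
- by move=> _ _ /addrI ->.
- by move=> h _ /addrI e; rewrite e eqxx in h.
- by move=> _ h /addrI e; rewrite e eqxx in h.
by move=> _ _ /dblI ->.
Qed.

Lemma onefact_even (U : finType) : ~~ odd #|U| -> exists K (c : U -> U -> K), onefact (@neqr _) c.
Proof.
case: (posnP #|U|) => [U0|Upos] ev.
  exists unit, (fun _ _ => tt); have U0' := card0_eq U0.
  by split => [x|//|x|x]; rewrite /neqr; have := U0' x; rewrite !inE.
pose n := #|U|.-1./2.
have [c [_ cs cx ci]] := onefact_option n.
have e : #|U| = #|{: option 'I_n.*2.+1}| by rewrite card_option card_ord /n; lia.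
have [f [g fK gK]] := card_bij e.
exists 'I_n.*2.+1, (fun x y => c (f x) (f y)); rewrite /neqr; split=> [x y|x y|x y z xy|z w w'].
- by rewrite eq_sym.
- exact: cs.
- have [|w hw e'] := cx (f x) (f y) (f z); first by rewrite /neqr (can_eq fK).
  by exists (g w); rewrite ?gK // -(can_eq fK) gK.
by move=> h h' /ci; rewrite /neqr !(can_eq fK) => /(_ h h'); apply: can_inj fK _ _.
Qed.

Section Pairs.
Variables (G U : eqType) (e : rel U) (K : Type) (c : U -> U -> K).
Hypothesis fc : onefact e c.
Local Notation T := (G * U)%type.

Definition pair_rel (x y z w : T) : Prop :=
  [/\ [/\ x.1 = y.1, z.1 = w.1 & x.1 != z.1], e x.2 y.2, e z.2 w.2 & c x.2 y.2 = c z.2 w.2].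
Definition pairs_rel (x y z w : T) := [\/ pair_rel x y z w, pair_rel x z y w | pair_rel x w y z].
Definition pair_dom (x y z : T) : Prop := [/\ x.1 = y.1, x.1 != z.1 & e x.2 y.2].
Definition pairs_dom (x y z : T) := [\/ pair_dom x y z, pair_dom x z y | pair_dom y z x].

Lemma pair_relC x y z w : pair_rel x y z w -> pair_rel z w x y.
Proof. by case=> [[e1 e2 n] n1 n2 ec]; split => //; split => //; rewrite eq_sym. Qed.
Lemma pair_rel12 x y z w : pair_rel x y z w -> pair_rel y x z w.
Proof.
case=> [[e1 e2 n] n1 n2 ec]; split => //; first by split => //; rewrite -e1.
  by rewrite (onefact_edge fc).
by rewrite (onefact_sym fc).
Qed.
Lemma pair_rel34 x y z w : pair_rel x y z w -> pair_rel x y w z.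
Proof. by move=> /pair_relC /pair_rel12 /pair_relC. Qed.

(** An edge in one fibre and a point z of another are completed by the edge at z that has the same
    colour. *)
Lemma pairs_design : design pairs_dom pairs_rel.
Proof.
have s12 x y z w : pairs_rel x y z w -> pairs_rel y x z w.
  case=> h; [apply: Or31|apply: Or33|apply: Or32]; first exact: pair_rel12.
    exact: pair_relC.
  exact: pair_relC.
have s23 x y z w : pairs_rel x y z w -> pairs_rel x z y w.
  case=> h; [apply: Or32|apply: Or31|apply: Or33] => //.
  exact: pair_rel34.
have s34 x y z w : pairs_rel x y z w -> pairs_rel x y w z.
  case=> h; [apply: Or31|apply: Or33|apply: Or32] => //.
  exact: pair_rel34.
have ex1 x y z : pair_dom x y z -> exists w, pair_rel x y z w.
  case=> exy n n2; have [w nw ew] := onefact_ex fc z.2 n2.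
  by exists (z.1, w); split.
have un1 x y z w w' : pair_rel x y z w -> pairs_rel x y z w' -> w = w'.
  case=> [[e1 e2 n] n1 n2 ec] [] [[a1 a2 an] an1 an2 ae].
  - have e2' : w.2 = w'.2 by apply: (onefact_inj fc n2 an2); rewrite -ec.
    by rewrite (surjective_pairing w) (surjective_pairing w') e2' -e2 a2.
  - by rewrite a1 eqxx in n.
  by rewrite -a2 -e1 eqxx in n.
split => //.
- move=> x y z w [] [[e1 e2 n] n1 n2 ec]; [apply: Or31|apply: Or32|apply: Or33]; split => //.
  by rewrite eq_sym.
- move=> x y z [/ex1 [w h]|/ex1 [w h]|/ex1 [w h]]; exists w.
  + exact: Or31.
  + exact: Or32.
  by apply: Or33; apply: pair_relC.
move=> x y z w w' [h|h|h] h'.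
- exact: un1 h h'.
- by apply: un1 h _; apply: s23.
apply: (un1 y z x); first exact: pair_relC.
by apply: s23; apply: s12.
Qed.

End Pairs.

Section Assemble.
Variables (G U : eqType) (K : Type) (c : U -> U -> K).
Hypothesis fc : onefact (@neqr _) c.
Local Notation T := (G * U)%type.
Local Notation prel := (pairs_rel (@neqr U) c).
Local Notation pdom := (@pairs_dom G U (@neqr U)).
Variables (DU : U -> U -> U -> Prop) (RU : U -> U -> U -> U -> Prop).
Hypothesis dU : design DU RU.
Variable RH : T -> T -> T -> T -> Prop.
Hypothesis dH : design (fun x y z : T => distinct3 x.1 y.1 z.1) RH.

Definition fibre_rel (x y z w : T) : Prop :=
  [/\ x.1 = y.1, x.1 = z.1, x.1 = w.1 & RU x.2 y.2 z.2 w.2].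
Definition asm_rel (x y z w : T) : Prop :=
  fibre_rel x y z w \/ (prel x y z w \/ RH x y z w).
Definition asm_dom (x y z : T) : Prop :=
  [/\ x.1 = y.1, x.1 = z.1 & DU x.2 y.2 z.2] \/ (pdom x y z \/ distinct3 x.1 y.1 z.1).

Lemma fibre_design : design (fun x y z : T => [/\ x.1 = y.1, x.1 = z.1 & DU x.2 y.2 z.2]) fibre_rel.
Proof.
case: dU => s1 s2 s3 sd sx su; split.
- by move=> x y z w [e1 e2 e3 /s1 h]; split; congruence.
- by move=> x y z w [e1 e2 e3 /s2 h]; split; congruence.
- by move=> x y z w [e1 e2 e3 /s3 h]; split; congruence.
- by move=> x y z w [e1 e2 e3 /sd h].
- by move=> x y z [e1 e2 /sx [w h]]; exists (x.1, w).
move=> x y z w w' [_ _ e h] [_ _ e' h'].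
by rewrite (surjective_pairing w) (surjective_pairing w') -e -e' (su _ _ _ _ _ h h').
Qed.

Lemma asm_design : design asm_dom asm_rel.
Proof.
apply: design_union fibre_design _ => [x y z [e1 e2 _]|].
  by case=> [[] [_]|]; rewrite /distinct3 -?e1 -?e2 ?eqxx.
apply: design_union (pairs_design G fc) dH => x y z.
by case=> [] [e _ _]; rewrite /distinct3 e eqxx /= ?andbF.
Qed.

Lemma asm_domE x y z : asm_dom x y z <->
  if (x.1 == y.1) && (x.1 == z.1) then DU x.2 y.2 z.2 else distinct3 x y z.
Proof.
case: x y z => [i a] [j b] [k d]; rewrite /asm_dom /pairs_dom /pair_dom /neqr /distinct3 /= !xpair_eqE.
have [<-|nij] := eqVneq i j; have [<-|nik] := eqVneq i k; rewrite /= ?andbT.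
- by split; [case=> [[]|[[] []|]] | left].
- split=> [|h]; last by right; left; apply: Or31.
  by case=> [[_ e]|[[] [e]|]] //; rewrite e eqxx in nik.
- rewrite (eq_sym j) (negPf nij) andbT; split=> [|h]; last by right; left; apply: Or32.
  by case=> [[e]|[[] [e]|]] //; rewrite e eqxx in nij.
have [<-|njk] := eqVneq j k => /=.
  split=> [|h]; last by right; left; apply: Or33.
  by case=> [[e]|[[] [e]|]] //; rewrite e eqxx in nij.
by split=> // _; right; right.
Qed.

End Assemble.

Lemma sqs_double (U : finType) : ~~ odd #|U| -> sqs U -> sqs (bool * U)%type.
Proof.
move=> ev [RU dU]; have [K [c fc]] := onefact_even ev.
(* With only two fibres no triple meets three of them. *)
have dH : design (fun x y z : bool * U => distinct3 x.1 y.1 z.1) (fun _ _ _ _ => False).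
  apply: design_eq (@design_none _) => -[[] a] [[] b] [[] d]; rewrite /distinct3 /=; by split.
eexists; apply: design_eq (asm_design fc dU dH) => -[i a] [j b] [k d].
rewrite asm_domE /=; case: ifP => // /andP [/eqP <- /eqP <-].
by rewrite /distinct3 !xpair_eqE eqxx.
Qed.

(** * Candelabra systems *)

Section Candelabra.
Variables S G W : eqType.
Implicit Types x y z : (S + G * W)%type.

Definition sep x y : bool :=
  if x is inr p then if y is inr q then p.1 != q.1 else false else false.
(** [S] is the stem and the fibres of [G * W] are the groups. A triple is left uncovered when it
    fits into the stem together with a single group. *)
Definition cqs_dom x y z : bool := distinct3 x y z && [|| sep x y, sep x z | sep y z].
Definition cqs := has_design (fun x y z => cqs_dom x y z).

Lemma sepC x y : sep x y = sep y x.
Proof. by case: x y => [s|[g w]] [s'|[g' w']] //=; rewrite eq_sym. Qed.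

Definition nonstem (x y z : (S + W)%type) : bool :=
  distinct3 x y z && ~~ match x, y, z with inl _, inl _, inl _ => true | _, _, _ => false end.

(** A triple missed by the candelabra system lies in the stem and one group. The triples inside the
    stem are common to all groups, so [nonstem] keeps them out of the fillings and the system on the
    stem covers them once. *)
Lemma cqs_fill :
  cqs -> has_design (fun x y z : (S + W)%type => nonstem x y z) ->
  sqs S -> sqs (S + G * W)%type.
Proof.
move=> dC dF dS.
pose f (i : G) (a : S + W) : S + G * W := match a with inl s => inl s | inr w => inr (i, w) end.
have fi i : injective (f i) by move=> [s|w] [s'|w'] //= [->].
have ag i j a b c a' b' c' : nonstem a b c -> nonstem a' b' c' ->
    f i a = f j a' -> f i b = f j b' -> f i c = f j c' -> f i =1 f j.
  move: a b c a' b' c' => [s|a] [t|b] [u|c] [s'|a'] [t'|b'] [u'|c'] //=;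
    rewrite /nonstem /= ?andbF //= => *; try discriminate;
    by match goal with H : inr _ = inr _ |- _ => case: H => -> _ end.
have {}dF := has_design_bigmap fi ag dF.
have {dS} [RS dS] := dS.
have inlI : injective (inl : S -> S + G * W) by move=> s s' [].
have dS' : has_design _ := ex_intro _ _ (design_map inlI dS).
have dis x y z : (exists i a b c, [/\ x = f i a, y = f i b, z = f i c & nonstem a b c]) ->
    (exists a b c, [/\ x = inl a, y = inl b, z = inl c & distinct3 a b c]) -> False.
  case=> i [[s|a] [[t|b] [[u|c] [-> -> -> //= dd]]]] [a' [b' [c' [//]]]].
  by move: dd; rewrite /nonstem andbF.
have dFS := has_design_union dis (fun x y z => iff_refl _) dF dS'.
apply: (has_design_union _ _ dC dFS).
- move=> x y z /andP [_ nf] [].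
    by case=> i [[s|a] [[t|b] [[u|c] [ex ey ez _]]]]; move: nf; rewrite ex ey ez /= ?eqxx.
  by case=> a [b [c [ex ey ez _]]]; move: nf; rewrite ex ey ez.
move=> x y z; split; last first.
  case=> [/andP [] //|[[i [a [b [c [-> -> -> /andP [h _]]]]]]|[a [b [c [-> -> -> h]]]]]].
    by move: h; rewrite /distinct3 !(inj_eq (fi i)).
  by move: h; rewrite /distinct3 !(inj_eq inlI).
move=> h; rewrite /cqs_dom h /=.
case: (boolP [|| sep x y, sep x z | sep y z]) => [_|nf]; first by left.
right.
have core (i : G) (a b c : S + W) : [/\ x = f i a, y = f i b & z = f i c] ->
    ~~ match a, b, c with inl _, inl _, inl _ => true | _, _, _ => false end ->
    exists i a b c, [/\ x = f i a, y = f i b, z = f i c & nonstem a b c].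
  move=> [ea eb ec] n; exists i, a, b, c; split => //.
  by move: h; rewrite ea eb ec /nonstem /distinct3 !(inj_eq (fi i)) n andbT.
case: x y z h nf core => [s|[i a]] [t|[j b]] [u|[k c]] h /= nf core.
- by right; exists s, t, u; split => //; move: h; rewrite /distinct3 !(inj_eq inlI).
- by left; apply: (core k (inl s) (inl t) (inr c)).
- by left; apply: (core j (inl s) (inr b) (inl u)).
- move: nf; rewrite negbK => /eqP ejk.
  by left; apply: (core j (inl s) (inr b) (inr c)) => //=; rewrite ejk.
- by left; apply: (core i (inr a) (inl t) (inl u)).
- move: nf; rewrite orbF negbK => /eqP e.
  by left; apply: (core i (inr a) (inl t) (inr c)) => //=; rewrite e.
- move: nf; rewrite !orbF negbK => /eqP e.
  by left; apply: (core i (inr a) (inr b) (inl u)) => //=; rewrite e.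
move: nf; rewrite !negb_or !negbK => /and3P [/eqP e /eqP e' _].
by left; apply: (core i (inr a) (inr b) (inr c)) => //=; rewrite -e -e'.
Qed.

End Candelabra.

Lemma cqs_card (S G W S' G' W' : finType) : #|S| = #|S'| -> #|G| = #|G'| -> #|W| = #|W'| ->
  cqs S G W -> cqs S' G' W'.
Proof.
case/card_bij=> f bf; case/card_bij=> g bg; case/card_bij=> h bh.
have [f' fK f'K] := bf; have [g' gK g'K] := bg; have [h' hK h'K] := bh.
pose F (x : S + G * W) : S' + G' * W' :=
  match x with inl s => inl (f s) | inr p => inr (g p.1, h p.2) end.
pose F' (x : S' + G' * W') : S + G * W :=
  match x with inl s => inl (f' s) | inr p => inr (g' p.1, h' p.2) end.
have bF : bijective F.
  exists F'; first by move=> [s|[a b]] /=; rewrite ?fK ?gK ?hK.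
  by move=> [s|[a b]] /=; rewrite ?f'K ?g'K ?h'K.
apply: (has_design_bij bF) => x y z.
rewrite /cqs_dom /distinct3 !(inj_eq (bij_inj bF)).
suff e u v : sep (F u) (F v) = sep u v by rewrite !e.
by case: u v => [s|[a b]] [t|[c d]] //=; rewrite (can_eq gK).
Qed.

Lemma sqs_bool : sqs bool.
Proof. by exists (fun _ _ _ _ => False); split => // -[] [] []. Qed.

(** A stem of two points contains no triple, so every quadruple system on the stem and a group is a
    filling. *)
Lemma sqs_cqs2 (G W : finType) : cqs bool G W -> sqs (bool + W)%type -> sqs (bool + G * W)%type.
Proof.
move=> dC dF; apply: cqs_fill dC _ sqs_bool; apply: has_design_eq dF.
by move=> [[]|a] [[]|b] [[]|c]; rewrite /nonstem ?andbT.
Qed.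

(** * Candelabra systems from a weighted fan *)

Section Fan.
Variables (m : nat) (K : eqType) (cl : option 'I_m -> K).
(** The point [None] is removed from a G-design with classes given by [cl]. Its blocks become
    triples and carry candelabra systems with three groups ([h3]); the other blocks are inflated by
    weights that sum to zero. The class of [None] has lost a point and is filled together with the
    stem ([h5]); the remaining classes carry H-designs ([h6]). *)
Definition class_dom (x y z : option 'I_m) : bool :=
  distinct3 x y z && ~~ ((cl x == cl y) && (cl x == cl z)).
Variable R0 : option 'I_m -> option 'I_m -> option 'I_m -> option 'I_m -> Prop.
Hypothesis d0 : design (fun x y z => class_dom x y z) R0.
Variables (S : finType) (w : nat).
Local Notation W := 'I_w.+1.
Local Notation T := (S + 'I_m * W)%type.
Implicit Types x y z : T.

Definition at_inf x : bool := if x is inr p then cl (Some p.1) == cl None else true.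
Definition fan_dom5 x y z : bool := [&& cqs_dom x y z, at_inf x, at_inf y & at_inf z].
Definition same_class x y : bool := match x, y with
  | inr p, inr q => [&& p.1 != q.1, cl (Some p.1) == cl (Some q.1) & cl (Some p.1) != cl None]
  | _, _ => false end.
Definition fan_dom6 x y z : bool := [&& same_class x y, same_class x z & same_class y z].

Hypothesis h3 : cqs S 'I_3 W.
Hypothesis h5 : has_design (fun x y z => fan_dom5 x y z).
Hypothesis h6 : has_design (fun x y z => fan_dom6 x y z).

Let blk (i j k : 'I_m) := R0 None (Some i) (Some j) (Some k).
Let in3 (i j k : 'I_m) x : bool := if x is inr p then p.1 \in [:: i; j; k] else true.

Lemma fan_blk12 i j k : blk i j k -> blk j i k. Proof. exact: (design23 d0). Qed.
Lemma fan_blk23 i j k : blk i j k -> blk i k j. Proof. exact: (design34 d0). Qed.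
Lemma fan_blk_uniq i j k k' : blk i j k -> blk i j k' -> k = k'.
Proof. by move=> h /(design_uniq d0 h) []. Qed.
Lemma fan_blk_neq i j k : blk i j k -> [/\ i != j, i != k & j != k].
Proof.
move=> h; have a := design_dom d0 h; have b := design_dom d0 (fan_blk23 h).
have c := design_dom d0 (fan_blk23 (fan_blk12 h)).
move: a b c; rewrite /class_dom /distinct3 !(inj_eq Some_inj) /=.
by move=> /andP [-> _] /andP [-> _] /andP [-> _].
Qed.

Let pos (t : 'I_m * 'I_m * 'I_m) (p : 'I_3) : 'I_m :=
  if val p == 0 then t.1.1 else if val p == 1 then t.1.2 else t.2.
(** With increasing entries a block through [None] has only one name, so that a shared triple forces
    equal entries. *)
Let idx := {t : 'I_m * 'I_m * 'I_m | t.1.1 < t.1.2 < t.2 & blk t.1.1 t.1.2 t.2}.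
Let emb (t : 'I_m * 'I_m * 'I_m) (a : S + 'I_3 * W) : T :=
  match a with inl s => inl s | inr p => inr (pos t p.1, p.2) end.

Lemma fan_pos_inj (t : 'I_m * 'I_m * 'I_m) : t.1.1 < t.1.2 < t.2 -> injective (pos t).
Proof.
case: t => [[i j] k] /= lt [[|[|[|//]]] hp] [[|[|[|//]]] hq] e; apply: val_inj => //=;
  move/(congr1 val): e; rewrite /pos /=; lia.
Qed.

Lemma fan_emb_inj (t : 'I_m * 'I_m * 'I_m) : t.1.1 < t.1.2 < t.2 -> injective (emb t).
Proof.
move=> lt [s|[p a]] [s'|[q b]] //=; first by case=> ->.
by case=> /(fan_pos_inj lt) -> ->.
Qed.

Lemma fan_sorted i j k : blk i j k ->
  exists t : 'I_m * 'I_m * 'I_m, [/\ t.1.1 < t.1.2 < t.2, blk t.1.1 t.1.2 t.2 & [:: t.1.1; t.1.2; t.2] =i [:: i; j; k]].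
Proof.
move=> h; have [n1 n2 n3] := fan_blk_neq h.
have ikj := fan_blk23 h; have jik := fan_blk12 h.
have kij := fan_blk12 ikj; have jki := fan_blk23 jik; have kji := fan_blk12 jki.
move: n1 n2 n3; rewrite -!(inj_eq val_inj) /= => n1 n2 n3.
have [lij|lji] := ltnP i j; have [ljk|lkj] := ltnP j k; have [lik|lki] := ltnP i k;
  try (by exfalso; lia).
- by exists (i, j, k); split => //=; lia.
- by exists (i, k, j); split => //=; [lia|move=> a; rewrite !inE; case: (a == i); case: (a == j); case: (a == k)].
- by exists (k, i, j); split => //=; [lia|move=> a; rewrite !inE; case: (a == i); case: (a == j); case: (a == k)].
- by exists (j, i, k); split => //=; [lia|move=> a; rewrite !inE; case: (a == i); case: (a == j); case: (a == k)].
- by exists (j, k, i); split => //=; [lia|move=> a; rewrite !inE; case: (a == i); case: (a == j); case: (a == k)].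
by exists (k, j, i); split => //=; [lia|move=> a; rewrite !inE; case: (a == i); case: (a == j); case: (a == k)].
Qed.

Let pos_blk (t : 'I_m * 'I_m * 'I_m) (p q : 'I_3) : blk t.1.1 t.1.2 t.2 -> p != q -> exists r, [/\ blk (pos t p) (pos t q) (pos t r),
  r != p & r != q].
Proof.
case: t => [[i j] k] /= h.
have ikj := fan_blk23 h; have jik := fan_blk12 h.
have kij := fan_blk12 ikj; have jki := fan_blk23 jik; have kji := fan_blk12 jki.
case: p q => [[|[|[|//]]] hp] [[|[|[|//]]] hq] //= _; rewrite /pos /=.
- by exists (inord 2); rewrite -!(inj_eq val_inj) /= !inordK.
- by exists (inord 1); rewrite -!(inj_eq val_inj) /= !inordK.
- by exists (inord 2); rewrite -!(inj_eq val_inj) /= !inordK.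
- by exists (inord 0); rewrite -!(inj_eq val_inj) /= !inordK.
- by exists (inord 1); rewrite -!(inj_eq val_inj) /= !inordK.
by exists (inord 0); rewrite -!(inj_eq val_inj) /= !inordK.
Qed.

Let pos_mem (t : 'I_m * 'I_m * 'I_m) a :
  (a \in [:: t.1.1; t.1.2; t.2]) = (a \in [seq pos t p | p : 'I_3]).
Proof.
apply/idP/mapP => [|[[[|[|[|//]]] hp] _ ->]]; rewrite /pos /= !inE ?eqxx ?orbT //.
case/or3P => /eqP ->.
- by exists (inord 0); rewrite ?mem_enum ?inordK.
- by exists (inord 1); rewrite ?mem_enum ?inordK.
by exists (inord 2); rewrite ?mem_enum ?inordK.
Qed.

Let three (p q r s : 'I_3) : p != q -> r != p -> r != q -> s \in [:: p; q; r].
Proof. rewrite !inE -!(inj_eq val_inj) /=; case: p q r s => p hp [q hq] [r hr] [s hs] /=; lia. Qed.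

Let sorted3 (t t' : 'I_m * 'I_m * 'I_m) (p q r p' q' r' : 'I_3) :
  t.1.1 < t.1.2 < t.2 -> t'.1.1 < t'.1.2 < t'.2 ->
  p != q -> r != p -> r != q -> p' != q' -> r' != p' -> r' != q' ->
  pos t p = pos t' p' -> pos t q = pos t' q' -> pos t r = pos t' r' -> t = t'.
Proof.
move=> lt lt' n1 n2 n3 n1' n2' n3' e1 e2 e3.
suff : map val [:: t.1.1; t.1.2; t.2] = map val [:: t'.1.1; t'.1.2; t'.2].
  by case: (t) (t') => [[i j] k] [[i' j'] k'] /= [/val_inj -> /val_inj -> /val_inj ->].
apply: (irr_sorted_eq ltn_trans ltnn); [by rewrite /= andbT|by rewrite /= andbT|].
apply: eq_mem_map => a; rewrite !pos_mem; apply/mapP/mapP => -[s _ ->].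
  have := three s n1 n2 n3; rewrite !inE => /or3P [] /eqP ->; rewrite ?e1 ?e2 ?e3.
  - by exists p'; rewrite ?mem_enum.
  - by exists q'; rewrite ?mem_enum.
  by exists r'; rewrite ?mem_enum.
have := three s n1' n2' n3'; rewrite !inE => /or3P [] /eqP ->; rewrite -?e1 -?e2 -?e3.
- by exists p; rewrite ?mem_enum.
- by exists q; rewrite ?mem_enum.
by exists r; rewrite ?mem_enum.
Qed.

Let D3 x y z := cqs_dom x y z /\ exists i j k, blk i j k /\ [&& in3 i j k x, in3 i j k y & in3 i j k z].

Let sep_emb (t : 'I_m * 'I_m * 'I_m) a b : t.1.1 < t.1.2 < t.2 -> sep (emb t a) (emb t b) = sep a b.
Proof. by move=> lt; case: a b => [s|[p u]] [s'|[q v]] //=; rewrite (inj_eq (fan_pos_inj lt)). Qed.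

Lemma fan3 : has_design D3.
Proof.
pose f (t : idx) := emb (s2val t).
have fi t : injective (f t) by apply: fan_emb_inj; exact: (s2valP t).
have ag t t' a b c a' b' c' : cqs_dom a b c -> cqs_dom a' b' c' ->
    f t a = f t' a' -> f t b = f t' b' -> f t c = f t' c' -> f t =1 f t'.
  have sepag u v u' v' : sep u v -> f t u = f t' u' -> f t v = f t' v' -> s2val t = s2val t'.
    case: u v u' v' => [s|[p u]] [s'|[q v]] [s''|[p' u']] [s'''|[q' v']] //= npq [e1 _] [e2 _].
    have lt := s2valP t; have lt' := s2valP t'.
    have npq' : p' != q' by apply: contraNneq npq => e; rewrite -(inj_eq (fan_pos_inj lt)) e1 e2 e.
    have [r [br n1 n2]] := pos_blk (s2valP' t) npq.
    have [r' [br' n1' n2']] := pos_blk (s2valP' t') npq'.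
    have e3 : pos (s2val t) r = pos (s2val t') r'.
      by apply: (fan_blk_uniq br); rewrite e1 e2.
    exact: (sorted3 lt lt' npq n1 n2 npq' n1' n2' e1 e2 e3).
  move=> /andP [_ h] _ ea eb ec u; rewrite /f.
  have -> // : s2val t = s2val t'.
  by case/or3P: h => h; [apply: sepag h ea eb|apply: sepag h ea ec|apply: sepag h eb ec].
apply: has_design_eq (has_design_bigmap fi ag h3) => x y z; split.
  case=> t [a [b [c [-> -> -> h]]]]; have lt := s2valP t; split.
    by move: h; rewrite /cqs_dom /distinct3 !(inj_eq (fi t)) !sep_emb.
  exists (s2val t).1.1, (s2val t).1.2, (s2val t).2; split; first exact: (s2valP' t).
  have in3e u : in3 (s2val t).1.1 (s2val t).1.2 (s2val t).2 (f t u).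
    by case: u => [//|[[[|[|[|//]]] hp] u]]; rewrite /in3 /= /pos /= !inE eqxx ?orbT.
  by rewrite !in3e.
case=> h [i [j [k [/fan_sorted [t [lt bt et]] hin]]]].
have pre u : in3 i j k u -> exists a, u = f (exist2 _ _ t lt bt) a.
  case: u => [s|[g u]]; first by exists (inl s).
  rewrite /in3 /= -et !inE => /or3P [] /eqP ->.
  - by exists (inr (inord 0, u)); rewrite /f /emb /pos /= inordK.
  - by exists (inr (inord 1, u)); rewrite /f /emb /pos /= inordK.
  by exists (inr (inord 2, u)); rewrite /f /emb /pos /= inordK.
case/and3P: hin => /pre [a ea] /pre [b eb] /pre [c ec].
exists (exist2 _ _ t lt bt), a, b, c; split => //.
by move: h; rewrite ea eb ec /cqs_dom /distinct3 !(inj_eq (fi _)) !sep_emb.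
Qed.

Let D4' (p q r : 'I_m * W) := exists l, R0 (Some p.1) (Some q.1) (Some r.1) (Some l).
Let D4 x y z := exists p q r, [/\ x = inr p, y = inr q, z = inr r & D4' p q r].

Lemma fan4 : has_design D4.
Proof.
pose R4 (p q r t : 'I_m * W) :=
  R0 (Some p.1) (Some q.1) (Some r.1) (Some t.1) /\ (p.2 + q.2 + (r.2 + t.2) = 0)%R.
have d4 : design D4' R4.
  split.
  - by move=> p q r t [h e]; split; [apply: (design12 d0)|rewrite (addrC q.2)].
  - by move=> p q r t [h e]; split; [apply: (design23 d0)|rewrite addrACA].
  - by move=> p q r t [h e]; split; [apply: (design34 d0)|rewrite (addrC t.2)].
  - by move=> p q r t [h e]; exists t.1.
  - move=> p q r [l h]; exists (l, - (p.2 + q.2) - r.2)%R; split => //=.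
    by rewrite (addrC r.2) subrK subrr.
  move=> p q r [t a] [t' a'] [h /= e] [h' /= e'].
  have [->] := design_uniq d0 h h'.
  by have /addrI/addrI -> : (p.2 + q.2 + (r.2 + a) = p.2 + q.2 + (r.2 + a'))%R by rewrite e e'.
have inrI : injective (inr : _ -> T) by move=> a b [].
exact: ex_intro _ _ (design_map inrI d4).
Qed.


Let case2 (g h : 'I_m) : g != h ->
  (cl (Some g) == cl None) && (cl (Some h) == cl None) \/ exists t, blk g h t.
Proof.
move=> n; case: (boolP (_ && _)) => [|nc]; [by left|right].
have : class_dom None (Some g) (Some h).
  by rewrite /class_dom /distinct3 (inj_eq Some_inj) n /= !(eq_sym (cl None)).
case/(design_ex d0) => -[t ht|h0]; first by exists t.
by have := design_dom d0 (design34 d0 h0); rewrite /class_dom /distinct3 eqxx andbF.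
Qed.

Let dom4 p q r : D4' p q r -> [/\ p.1 != q.1, p.1 != r.1, q.1 != r.1 &
  ~~ ((cl (Some p.1) == cl (Some q.1)) && (cl (Some p.1) == cl (Some r.1)))].
Proof.
case=> l /(design_dom d0); rewrite /class_dom /distinct3 !(inj_eq Some_inj).
by case/andP => /and3P [-> -> ->] ->.
Qed.

(** Two groups and [None] decide: either they all lie in one class, or a block through [None]
    contains both groups. *)
Let two (x y z : T) (g h : 'I_m) : cqs_dom x y z -> g != h ->
  (forall u, u \in [:: x; y; z] -> if u is inr p then p.1 \in [:: g; h] else true) ->
  D3 x y z \/ fan_dom5 x y z.
Proof.
move=> d n hin; have [/andP [/eqP cg /eqP ch]|[t ht]] := case2 n.
  right; rewrite /fan_dom5 d /=.
  have inf u : u \in [:: x; y; z] -> at_inf u.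
    by move=> /hin; case: u => [//|[k u]]; rewrite /= !inE => /orP [] /eqP ->; rewrite ?cg ?ch.
  by rewrite !inf // !inE eqxx ?orbT.
left; split => //; exists g, h, t; split => //.
have inb u : u \in [:: x; y; z] -> in3 g h t u.
  by move=> /hin; case: u => [//|[k u]]; rewrite /in3 /= !inE => /orP [] ->; rewrite ?orbT.
by rewrite !inb // !inE eqxx ?orbT.
Qed.

Let three_in x y z i j k p q r : D3 x y z -> x = inr p -> y = inr q -> z = inr r ->
  p.1 != q.1 -> p.1 != r.1 -> q.1 != r.1 -> i = p.1 -> j = q.1 -> k = r.1 -> blk i j k.
Proof.
move=> [_ [a [b [c [h hin]]]]] ex ey ez npq npr nqr -> -> ->.
move: hin; rewrite ex ey ez /in3 !inE.
have h1 := fan_blk23 h; have h2 := fan_blk12 h; have h3' := fan_blk12 h1.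
have h4 := fan_blk23 h2; have h5' := fan_blk12 h4.
case/and3P => /or3P [] /eqP ep /or3P [] /eqP eq /or3P [] /eqP er; move: npq npr nqr;
  by rewrite ep eq er ?eqxx.
Qed.

(** For a triple in three groups the fourth point of their block in the G-design decides: if it is
    [None] the candelabra systems on three groups apply, otherwise the inflated blocks. If the three
    groups lie in one class, [h5] or [h6] applies. *)
Lemma fan_cqs : cqs S 'I_m W.
Proof.
have d56 : has_design (fun x y z => fan_dom5 x y z \/ fan_dom6 x y z).
  apply: has_design_union h5 h6 => // x y z /and4P [_ hx _ _] /and3P [].
  by case: x hx => [//|p] /= /eqP ->; case: y => [//|q]; rewrite eqxx !andbF.
have dis4 x y z : D4 x y z -> fan_dom5 x y z \/ fan_dom6 x y z -> False.
  case=> p [q [r [-> -> -> /dom4 [n1 n2 n3 nc]]]] [].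
    by case/and4P => _ /eqP e1 /eqP e2 /eqP e3; move: nc; rewrite e1 e2 e3 !eqxx.
  by case/and3P => /= /and3P [_ e1 _] /and3P [_ e2 _] _; move: nc; rewrite e1 e2.
have d456 := has_design_union dis4 (fun x y z => iff_refl _) fan4 d56.
have blk_cl i j k : blk i j k -> ~~ ((cl None == cl (Some i)) && (cl None == cl (Some j))).
  by move/(design_dom d0) => /andP [].
have dis3 x y z : D3 x y z -> (D4 x y z \/ (fan_dom5 x y z \/ fan_dom6 x y z)) -> False.
  move=> d3 [|[|]].
  - case=> p [q [r [ep eq er d4]]]; have [n1 n2 n3 _] := dom4 d4.
    have b := three_in d3 ep eq er n1 n2 n3 erefl erefl erefl.
    case: d4 => l hl.
    have b' : R0 (Some p.1) (Some q.1) (Some r.1) None.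
      by apply: (design34 d0); apply: (design23 d0); apply: (design12 d0).
    by have := design_uniq d0 hl b'.
  - case/and4P => /andP [_ s3] ix iy iz; case: d3 => _ [i [j [k [b]]]].
    have cls p q : p.1 != q.1 -> @at_inf (inr p) -> @at_inf (inr q) ->
      in3 i j k (inr p) -> in3 i j k (inr q) -> False.
      have h1 := fan_blk23 b; have h2 := fan_blk12 b; have h3' := fan_blk12 h1.
      have h4 := fan_blk23 h2; have h5' := fan_blk12 h4.
      move=> n /= /eqP ep /eqP eq; rewrite /in3 !inE.
      have abs u v t : blk u v t -> p.1 = u -> q.1 = v -> False.
        by move=> /blk_cl; move=> h e1 e2; move: h; rewrite -e1 -e2 ep eq eqxx.
      case/or3P => /eqP e1 /or3P [] /eqP e2; try (by move: n; rewrite e1 e2 eqxx);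
        by apply: abs e1 e2; eassumption.
    case/and3P => jx jy jz.
    case/or3P: s3.
    + by case: x y ix iy jx jy => [//|p] [//|q] ix iy jx jy n; apply: cls n ix iy jx jy.
    + by case: x z ix iz jx jz => [//|p] [//|q] ix iz jx jz n; apply: cls n ix iz jx jz.
    by case: y z iy iz jy jz => [//|p] [//|q] iy iz jy jz n; apply: cls n iy iz jy jz.
  case/and3P; case: x d3 => [//|p] d3; case: y d3 => [//|q] d3 /and3P [n1 /eqP e1 c1].
  case: z d3 => [//|r] d3 /and3P [n2 /eqP e2 _] /and3P [n3 _ _].
  have b := three_in d3 erefl erefl erefl n1 n2 n3 erefl erefl erefl.
  have b' : R0 (Some p.1) (Some q.1) (Some r.1) None.
    by apply: (design34 d0); apply: (design23 d0); apply: (design12 d0).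
  by have := design_dom d0 b'; rewrite /class_dom e1 -e2 e1 !eqxx andbF.
apply: (has_design_union dis3 _ fan3 d456) => x y z; split; last first.
  case=> [[//]|[[p [q [r [-> -> -> /dom4 [n1 n2 n3 _]]]]]|[/and4P [] //|]]].
    by rewrite /cqs_dom /= n1 /distinct3 !(inj_eq (@inr_inj _ _)); case: p q r n1 n2 n3
      => [i a] [j b] [k c] /=; rewrite !xpair_eqE => /negPf -> /negPf -> /negPf ->.
  case: x y z => [s|[i a]] [t|[j b]] [u|[k c]]; rewrite /fan_dom6 ?andbF //.
  rewrite /= => /and3P [/and3P [n1 _ _] /and3P [n2 _ _] /and3P [n3 _ _]].
  by rewrite /cqs_dom /= n1 /distinct3 !(inj_eq (@inr_inj _ _)) !xpair_eqE (negPf n1)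
    (negPf n2) (negPf n3).
move=> d; have tw g h n hin : _ := @two x y z g h d n hin.
suff : D3 x y z \/ fan_dom5 x y z \/ D4 x y z \/ fan_dom6 x y z by tauto.
have {}tw g h : g != h ->
  (forall u, u \in [:: x; y; z] -> if u is inr p then p.1 \in [:: g; h] else true) ->
  D3 x y z \/ fan_dom5 x y z \/ D4 x y z \/ fan_dom6 x y z by move=> n /(tw g h n); tauto.
have := d; rewrite /cqs_dom => /andP [_].
have mem3 (P : T -> Prop) : P x -> P y -> P z -> forall u, u \in [:: x; y; z] -> P u.
  by move=> px py pz u; rewrite !inE => /or3P [] /eqP ->.
case: x y z d tw mem3 => [s|[i a]] [t|[j b]] [u|[k c]] d tw mem3 //=.
- by move=> n; apply: (tw j k) => //; apply: mem3; rewrite ?inE ?eqxx ?orbT.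
- by rewrite orbF => n; apply: (tw i k) => //; apply: mem3; rewrite ?inE ?eqxx ?orbT.
- by rewrite !orbF => n; apply: (tw i j) => //; apply: mem3; rewrite ?inE ?eqxx ?orbT.
have [eij|nij] := eqVneq i j.
  subst j => /= n; apply: (tw i k); first by case/orP: n.
  by apply: mem3; rewrite ?inE ?eqxx ?orbT.
have [eik|nik] := eqVneq i k => _.
  by apply: (tw i j) => //; apply: mem3; rewrite ?inE ?eik ?eqxx ?orbT.
have [ejk|njk] := eqVneq j k.
  by apply: (tw i j) => //; apply: mem3; rewrite ?inE ?ejk ?eqxx ?orbT.
case: (boolP ((cl (Some i) == cl (Some j)) && (cl (Some i) == cl (Some k)))) => [/andP [e1 e2]|nc].
  have [ei|ni] := eqVneq (cl (Some i)) (cl None).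
    by right; left; rewrite /fan_dom5 d /= -(eqP e1) -(eqP e2) ei eqxx.
  by do 3 right; rewrite /fan_dom6 /= nij nik njk -(eqP e1) -(eqP e2) eqxx ni.
have : class_dom (Some i) (Some j) (Some k).
  by rewrite /class_dom /distinct3 !(inj_eq Some_inj) nij nik njk nc.
case/(design_ex d0) => -[l hl|h0]; last first.
  left; split => //; exists i, j, k; split; last by rewrite /in3 !inE !eqxx ?orbT.
  by apply: (design12 d0); apply: (design23 d0); apply: (design34 d0).
by right; right; left; exists (i, a), (j, b), (k, c); split => //; exists l.
Qed.

End Fan.

(** * Hanani: quadrupling *)

Section ZpEven.
Variable k : nat.
Local Notation W := 'I_k.*2.+2.
(** The two halves of Z/(2k + 2) are exchanged by adding [halfway]. The two roots a of 2a = s differ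
    by [halfway], so [upper] tells them apart. *)
Definition upper (x : W) : bool := k < x.
Definition halfway : W := inord k.+1.
Lemma half_val : val halfway = k.+1. Proof. by rewrite /halfway /= inordK //; lia. Qed.

Lemma Zp_oddD (a b : W) : odd (val (a + b)%R) = odd a (+) odd b.
Proof.
rewrite /= -oddD -[in RHS](odd_mod (a + b) (d := k.*2.+2)) //.
by rewrite /= negbK odd_double.
Qed.

Lemma upperD x : upper (x + halfway)%R = ~~ upper x.
Proof.
rewrite /upper /= half_val; have := ltn_ord x; move: (nat_of_ord x) => n hn.
have [l|l] := leqP n k; first by rewrite modn_small; lia.
have -> : n + k.+1 = (n - k.+1) + k.*2.+2 by lia.
by rewrite modnDr modn_small; lia.
Qed.

Lemma halfD : (halfway + halfway = 0 :> W)%R.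
Proof. by apply: val_inj; rewrite /= half_val addSn addnS addnn modnn. Qed.

Lemma halfN : (- halfway = halfway :> W)%R.
Proof. by apply/eqP; rewrite eq_sym -subr_eq0 opprK halfD. Qed.

Lemma root_ex (s : W) : ~~ odd s -> exists a : W, (a + a)%R = s.
Proof.
move=> ev; exists (inord s./2); apply: val_inj; rewrite /= inordK; last by have := ltn_ord s; lia.
by rewrite modn_small; have := ltn_ord s; lia.
Qed.

Lemma root_uniq (a b : W) : (a + a = b + b)%R -> b = a \/ (b = a + halfway)%R.
Proof.
move=> e; have [->|n] := eqVneq b a; [by left|right]; apply: val_inj.
move/(congr1 val): e n; rewrite -(inj_eq val_inj) /= half_val.
have := ltn_ord a; have := ltn_ord b; move: (nat_of_ord a) (nat_of_ord b) => x y hy hx.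
have md n : n < 2 * k.*2.+2 -> n %% k.*2.+2 = if n < k.*2.+2 then n else n - k.*2.+2.
  move=> ln; case: ifP => l; first by rewrite modn_small.
  by rewrite -{1}(@subnK k.*2.+2 n) ?modnDr ?modn_small; lia.
by rewrite !md; [do 3 case: ifP; lia|lia..].
Qed.

End ZpEven.

Section Quadruple.
Variable k : nat.
Local Notation W := 'I_k.*2.+2.
Local Notation G := (bool * bool)%type.
Local Notation T := (bool + G * W)%type.
Implicit Types (x y z w : T) (s : seq T) (h i j : bool).
Local Open Scope ring_scope.

Let ing (g : G) x : bool := if x is inr p then p.1 == g else false.
Let ins x : bool := if x is inl _ then true else false.
Let crd (g : G) x : W := if x is inr p then (if p.1 == g then p.2 else 0) else 0.
Let lbl x : bool := if x is inl l then l else false.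
Let cn g s := count (ing g) s.
Let sm g s : W := foldr (fun x a => crd g x + a) 0 s.
Let lb s : bool := foldr (fun x a => lbl x (+) a) false s.
(** The parity is [i], so b + c + [kap h i] is even for exactly one [i]. The opposite signs for the
    two values of [h] are what makes the two label rules in [E4] complementary. *)
Let kap h i : W := if i then (if h then -1 else 1) else 0.
Let mu (j i : bool) (b a : W) : bool :=
  match j, i with
  | false, false => upper (a - b) | true, true => upper (a - b - 1)
  | _, _ => upper (b - a) end.
Let lab h i (u v : W) : bool := if h then ~~ mu i false v u else mu false i u v.
(** A block has points b, c in the groups (h, false) and (h, true) and two points a, a' in a group
    of the other [h], with a + a' = b + c + kap. When the equation forces a' = a, [type2] replaces
    a' by a stem point, and the two roots a receive the two labels. *)
Let type1 s h i := [&& cn (h, false) s == 1%N, cn (h, true) s == 1%N, cn (~~ h, i) s == 2%N &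
  sm (~~ h, i) s == sm (h, false) s + sm (h, true) s + kap h i].
Let type2 s h i := [&& count ins s == 1%N, cn (h, false) s == 1%N, cn (h, true) s == 1%N,
  cn (~~ h, i) s == 1%N, sm (~~ h, i) s + sm (~~ h, i) s == sm (h, false) s + sm (h, true) s + kap h i &
  lb s == lab h i (sm (h, false) s) (sm (~~ h, i) s)].
Let allhi (P : bool -> bool -> bool) := [|| P false false, P false true, P true false | P true true].
Let Rs s := uniq s && (allhi (type1 s) || allhi (type2 s)).
Let R x y z w : Prop := Rs [:: x; y; z; w].

Let Rs_perm s s' : perm_eq s s' -> Rs s -> Rs s'.
Proof.
move=> e.
have ec g : cn g s = cn g s' by apply/permP.
have es g : sm g s = sm g s'.
  have e' r : sm g r = \sum_(x <- r) crd g x by elim: r => [|x r IH]; rewrite ?big_nil ?big_cons -?IH.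
  by rewrite !e'; apply: perm_big.
have el : lb s = lb s'.
  have e' r : lb r = \big[addb/false]_(x <- r) lbl x
    by elim: r => [|x r IH]; rewrite ?big_nil ?big_cons -?IH.
  by rewrite !e'; apply: perm_big.
have ei : count ins s = count ins s' by apply/permP.
by rewrite /Rs (perm_uniq e) /allhi /type1 /type2 !ec !es el ei.
Qed.

Let same_h x y z : bool := match x, y, z with
  | inr p, inr q, inr r => (p.1.1 == q.1.1) && (p.1.1 == r.1.1) | _, _, _ => false end.
Let D x y z : bool := cqs_dom x y z && ~~ same_h x y z.

Let E x y z := exists2 w, R x y z w & forall w', R x y z w' -> w = w'.
Let E12 x y z : E x y z -> E y x z.
Proof.
case=> w h u; exists w => [|w' h']; first exact: Rs_perm (perm4_12 _ _ _ _) h.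
exact/u/(Rs_perm (perm4_12 _ _ _ _) h').
Qed.
Let E23 x y z : E x y z -> E x z y.
Proof.
case=> w h u; exists w => [|w' h']; first exact: Rs_perm (perm4_23 _ _ _ _) h.
exact/u/(Rs_perm (perm4_23 _ _ _ _) h').
Qed.

Ltac rsimp := rewrite /Rs /allhi /type1 /type2 /cn /sm /lb /=
  ?inE ?(inj_eq (@inr_inj _ _)) ?xpair_eqE /= ?andbF ?orbF ?andbT ?addr0 ?add0r ?addbF ?andbF ?orbF.

Let R1E h i (b c a : W) w : Rs [:: inr ((h, false), b); inr ((h, true), c); inr ((~~ h, i), a); w] =
  match w with
  | inl l => (a + a == b + c + kap h i) && (l == lab h i b a)
  | inr (g, v) => [&& g == (~~ h, i), a != v & a + v == b + c + kap h i] end.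
Proof. case: w => [l|[[h' i'] v]]; case: h => //; case: i => //; try case: h'; try case: i'; rsimp => //.
Qed.

Let R2E h i j (a a' b : W) w : a != a' ->
  Rs [:: inr ((~~ h, i), a); inr ((~~ h, i), a'); inr ((h, j), b); w] =
  if w is inr (g, v) then (g == (h, ~~ j)) && (a + a' == b + v + kap h i) else false.
Proof.
move=> n; case: w => [l|[[h' i'] v]]; case: h => //; case: i => //; case: j => //;
  try case: h'; try case: i'; rsimp; rewrite ?n ?(addrC v b) //.
Qed.

Let R3E l h (b c : W) w :
  Rs [:: inl l; inr ((h, false), b); inr ((h, true), c); w] =
  if w is inr ((h', i), v) then
    [&& h' == ~~ h, v + v == b + c + kap h i & l == lab h i b v] else false.
Proof.
case: w => [l'|[[h' i'] v]]; case: h => //; try case: h'; try case: i'; rsimp => //.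
Qed.

Let R4E l j i (b a : W) w :
  Rs [:: inl l; inr ((false, j), b); inr ((true, i), a); w] =
  if w is inr ((h', i'), v) then
    if h' then [&& i' == ~~ i, b + b == a + v + kap true j & l == lab true j (if i then v else a) b]
    else [&& i' == ~~ j, a + a == b + v + kap false i & l == lab false i (if j then v else b) a]
  else false.
Proof.
case: w => [l'|[[h' i'] v]]; case: i => //; case: j => //; try case: h'; try case: i'; rsimp;
  rewrite ?(addrC v b) ?(addrC v a) //.
Qed.

Let kap_odd h i : odd (val (kap h i)) = i.
Proof. by case: h i => [] [] //=; rewrite /= ?modn_small //= ?subSS ?subn0 ?odd_double. Qed.

Let labH h i (u v : W) : lab h i u (v + halfway k) = ~~ lab h i u v.
Proof.
have e1 (c : W) : v + halfway k - c = v - c + halfway k by ring.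
have e2 (c : W) : c - (v + halfway k) = c - v + halfway k by rewrite opprD halfN; ring.
by case: h i => [] []; rewrite /lab /mu ?e1 ?e2 ?upperD //= -?addrA (addrC (halfway k)) addrA upperD.
Qed.

Let E1 h i (b c a : W) : E (inr ((h, false), b)) (inr ((h, true), c)) (inr ((~~ h, i), a)).
Proof.
have [e|n] := eqVneq (a + a) (b + c + kap h i).
  exists (inl (lab h i b a)) => [|w']; rewrite /R R1E ?e ?eqxx //.
  case: w' => [l /= /eqP -> //|[g v] /= /and3P [_ nv /eqP ev]].
  by case/eqP: nv; apply: (@addrI _ a); rewrite ev.
exists (inr ((~~ h, i), b + c + kap h i - a)) => [|w']; rewrite /R R1E.
  rewrite eqxx (addrC a) subrK eqxx andbT; apply: contraNneq n => e.
  by rewrite {1}e subrK.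
case: w' => [l|[g v] /and3P [/eqP -> _ /eqP <-]]; first by rewrite (negPf n).
by rewrite (addrC a) addrK.
Qed.

Let E2 h i j (a a' b : W) : a != a' -> E (inr ((~~ h, i), a)) (inr ((~~ h, i), a')) (inr ((h, j), b)).
Proof.
move=> n; exists (inr ((h, ~~ j), a + a' - kap h i - b)) => [|w']; rewrite /R R2E //.
  by rewrite eqxx; apply/eqP; ring.
by case: w' => [//|[g v]] /andP [/eqP -> /eqP ->]; congr (inr (_, _)); ring.
Qed.

Let E3 l h (b c : W) : E (inl l) (inr ((h, false), b)) (inr ((h, true), c)).
Proof.
(* A double 2a is even, so the parity of b + c determines the group of the fourth point. *)
pose i := odd (val (b + c)).
have [a0 ea0] : exists a : W, a + a = b + c + kap h i.
  by apply: root_ex; rewrite Zp_oddD kap_odd addbb.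
have [a [ea la]] : exists a : W, a + a = b + c + kap h i /\ lab h i b a = l.
  have [e|n] := eqVneq (lab h i b a0) l; first by exists a0.
  exists (a0 + halfway k); split; first by rewrite addrACA halfD addr0.
  by rewrite labH; move: n; case: (lab _ _ _ _) (l) => [] [].
exists (inr ((~~ h, i), a)) => [|w']; rewrite /R R3E ?ea ?la ?eqxx //.
case: w' => [//|[[h' i'] v]] /and3P [/eqP -> /eqP ev /eqP lv].
have ei : i' = i.
  move/(congr1 (fun x : W => odd (val x))): ev; rewrite !Zp_oddD kap_odd addbb.
  by rewrite /i Zp_oddD; case: (i') (odd b) (odd c) => [] [] [].
rewrite ei in ev lv *; have [->//|e] := root_uniq (etrans ea (esym ev)).
by move: lv; rewrite e labH la; case: (l).
Qed.

(** The fourth point could lie on either side, in (false, not j) or in (true, not i). By [mu0] and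
    [mu1] these two candidates carry opposite labels, so the stem point [l] admits exactly one of
    them. *)
Let E4 l j i (b a : W) : E (inl l) (inr ((false, j), b)) (inr ((true, i), a)).
Proof.
have mu0 : lab false i (if j then a + a - b - kap false i else b) a = mu j i b a.
  by case: (j) (i) => [] []; rewrite /lab /mu /kap //; congr upper; ring.
have mu1 : lab true j (if i then b + b - a - kap true j else a) b = ~~ mu j i b a.
  by case: (j) (i) => [] []; rewrite /lab /mu /kap //; congr (~~ upper _); ring.
have [e|n] := eqVneq l (mu j i b a).
  exists (inr ((false, ~~ j), a + a - b - kap false i)) => [|w']; rewrite /R R4E.
    by rewrite mu0 e !eqxx andbT; apply/eqP; ring.
  case: w' => [//|[[[] i'] v]] /and3P [/eqP -> /eqP ev /eqP lv].
    have ev' : v = b + b - a - kap true j by rewrite ev; ring.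
    by move: lv; rewrite ev' mu1 e; case: (mu _ _ _ _).
  by congr (inr (_, _)); rewrite ev; ring.
have e : l = ~~ mu j i b a by move: n; case: (l) (mu _ _ _ _) => [] [].
exists (inr ((true, ~~ i), b + b - a - kap true j)) => [|w']; rewrite /R R4E.
  by rewrite mu1 e !eqxx andbT; apply/eqP; ring.
case: w' => [//|[[[] i'] v]] /and3P [/eqP -> /eqP ev /eqP lv].
  by congr (inr (_, _)); rewrite ev; ring.
have ev' : v = a + a - b - kap false i by rewrite ev; ring.
by move: lv; rewrite ev' mu0 e; case: (mu _ _ _ _).
Qed.

Let DE x y z : D x y z -> E x y z.
Proof.
move=> /andP [/andP [/and3P [nxy nxz nyz] sp] sh].
have st l p q : p.1 != q.1 -> E (inl l) (inr p) (inr q).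
  case: p q => [[[] i] a] [[[] j] b]; rewrite xpair_eqE /= => n.
  - by case: i j n => [] [] // _; exact: E23 (E3 l true b a).
  - by apply: E23; apply: E4.
  - exact: E4.
  by case: i j n => [] [] // _; exact: E23 (E3 l false b a).
have ns p q r : p.1.1 == q.1.1 -> r.1.1 != p.1.1 -> p != q -> E (inr p) (inr q) (inr r).
  case: p q r => [[h i] a] [[h' j] b] [[h'' l] c] /= /eqP <-; rewrite !xpair_eqE eqxx /=.
  move=> nh; have {nh} -> : h'' = ~~ h by case: (h) (h'') nh => [] [].
  have [<-|ij] := eqVneq i j => /=.
    by move=> nab; have := E2 (~~ h) i l c nab; rewrite negbK.
  case: i j ij => [] [] // _ _.
  exact: E12 (E1 h l b a c).
move: nxy nxz nyz sp sh; case: x y z => [l|p] [l'|q] [l''|r] //=; rewrite ?orbF /=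
  ?(inj_eq (@inr_inj _ _)) => nxy nxz nyz sp sh.
- exact: st.
- by apply: E12; apply: st.
- by apply: E12; apply: E23; apply: E12; apply: st; rewrite eq_sym.
have [epq|npq] := eqVneq p.1.1 q.1.1.
  apply: ns; rewrite ?epq //; move: sh; rewrite epq eqxx /= eq_sym //.
have [epr|npr] := eqVneq p.1.1 r.1.1; first by apply: E23; apply: ns; rewrite ?epr // -epr eq_sym.
apply: E12; apply: E23; apply: E12; apply: ns; rewrite 1?eq_sym //.
  by case: (p.1.1) (q.1.1) (r.1.1) npq npr => [] [] [].
by rewrite eq_sym.
Qed.

Let RD x y z w : R x y z w -> D x y z.
Proof.
rewrite /R => h; have /andP [/= u _] := h.
rewrite /D /cqs_dom /distinct3; move: u; rewrite !inE !negb_or => /and4P [/and3P [-> -> _] /andP [-> _] _ _] /=.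
have {h} : allhi (fun h i => [&& cn (h, false) [:: x; y; z; w] == 1%N,
    cn (h, true) [:: x; y; z; w] == 1%N & 0 < cn (~~ h, i) [:: x; y; z; w]]%N).
  case/andP: h => _; rewrite /allhi.
  by case/orP => /or4P [] => [/and4P [-> -> /eqP -> _]|/and4P [-> -> /eqP -> _]|
    /and4P [-> -> /eqP -> _]|/and4P [-> -> /eqP -> _]|/and5P [_ -> -> /eqP -> _]|
    /and5P [_ -> -> /eqP -> _]|/and5P [_ -> -> /eqP -> _]|/and5P [_ -> -> /eqP -> _]]; rewrite ?orbT.
case: x y z => [l|[[[] []] a]] [l'|[[[] []] a']] [l''|[[[] []] a'']] //=;
  by case: w => [l3|[[[] []] a3]].
Qed.

Let quad_cross : design (fun x y z => D x y z) R.
Proof.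
split.
- by move=> x y z w; apply: Rs_perm (perm4_12 _ _ _ _).
- by move=> x y z w; apply: Rs_perm (perm4_23 _ _ _ _).
- by move=> x y z w; apply: Rs_perm (perm4_34 _ _ _ _).
- exact: RD.
- by move=> x y z /DE [w]; exists w.
by move=> x y z w w' h; have [v _ u] := DE (RD h); move: (h) => /u <- /u <-.
Qed.

(** What remains are the triples inside two groups with a common [h]; the doubling construction
    covers them. *)
Lemma cqs_quad : cqs bool G W.
Proof.
have [K [c fc]] : exists K (c : W -> W -> K), onefact (@neqr _) c.
  by apply: onefact_even; rewrite card_ord /= negbK odd_double.
pose f (h : bool) (p : bool * W) : T := inr ((h, p.1), p.2).
have fi h : injective (f h) by move=> [i a] [j b] [-> ->].
have ag h h' a b d a' b' d' : pairs_dom (@neqr W) a b d -> pairs_dom (@neqr W) a' b' d' ->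
    f h a = f h' a' -> f h b = f h' b' -> f h d = f h' d' -> f h =1 f h'.
  by move=> _ _ [-> _ _].
have dP := has_design_bigmap fi ag (ex_intro _ _ (pairs_design bool fc)).
apply: (has_design_union _ _ (ex_intro _ _ quad_cross) dP) => x y z.
  move=> /andP [_ /negP sh] [h [a [b [d [ex ey ez _]]]]]; case: sh.
  by rewrite ex ey ez /= eqxx.
split; last first.
  case=> [/andP [] //|[h [[i a] [[j b] [[l d] [-> -> -> pd]]]]]].
  rewrite /cqs_dom /distinct3 /= !(inj_eq (@inr_inj _ _)) !xpair_eqE.
  by case: h i j l pd => [] [] [] [] [] [] //= _ _; rewrite /neqr => ->.
move=> d; case: (boolP (same_h x y z)) => sh; last by left; rewrite /D d sh.
right; move: sh d; case: x => [//|[[h i] a]]; case: y => [//|[[h' j] b]]; case: z => [//|[[h'' l] e]].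
case/andP => /= /eqP <- /eqP <- d; exists h, (i, a), (j, b), (l, e); split => //.
move: d; rewrite /cqs_dom /distinct3 /= !(inj_eq (@inr_inj _ _)) !xpair_eqE !eqxx /=.
case/andP => /and3P [n1 n2 n3] sp.
have [eij|nij] := eqVneq i j; first subst j.
  apply: Or31; split => //=; first by move: sp; rewrite eqxx /= orbb.
  by move: n1; rewrite eqxx.
have [eil|nil] := eqVneq i l; first subst l.
  by apply: Or32; split => //=; move: n2; rewrite eqxx.
have ejl : j = l by case: (i) (j) (l) nij nil => [] [] [].
by subst l; apply: Or33; split => //=; [rewrite eq_sym|move: n3; rewrite eqxx].
Qed.

End Quadruple.

(** Hanani's step from v to 4v - 6, with v = 2k + 4. *)
Lemma sqs_quad (k : nat) : sqs 'I_k.*2.+4 -> sqs 'I_(4 * k.*2.+2 + 2).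
Proof.
move=> h; have := sqs_cqs2 (cqs_quad k) (sqs_card _ h).
rewrite card_sum card_bool !card_ord => /(_ erefl); apply: sqs_card.
by rewrite card_sum card_prod card_prod card_bool !card_ord; lia.
Qed.

(** * Hanani: tripling *)

Section Triple.
Variables (W : finComNzRingType) (st : W -> option bool) (ix : W -> option bool) (pi : W -> W)
  (dd : pred W) (K : Type) (col : W -> W -> K).
Local Notation G := (option bool).
Local Notation T := (bool + G * W)%type.
Implicit Types (x y z w : T) (s : seq T) (g : G) (a b c v : W).
Local Open Scope ring_scope.

Hypothesis stE : forall l, exists2 j, st j = Some l & forall j', st j' = Some l -> j' = j.
Hypothesis piK : forall j, st j = None -> pi (pi j) = j.
Hypothesis pi_st : forall j, st j = None -> st (pi j) = None.
Hypothesis pi_ix : forall j, st j = None -> ix (pi j) = ix j.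
Hypothesis pi_neq : forall j, st j = None -> pi j != j.
Hypothesis pi_dd : forall j, st j = None -> dd (pi j - j).
Hypothesis dd_pi : forall g a, dd a ->
  exists2 j, [/\ st j = None, ix j = g & pi j - j = a] &
    forall j', st j' = None -> ix j' = g -> pi j' - j' = a -> j' = j.
Hypothesis dd0 : ~~ dd 0.
Hypothesis fcol : onefact (fun a b => (a != b) && ~~ dd (b - a)) col.

Let ing g x : bool := if x is inr p then p.1 == g else false.
Let ins x : bool := if x is inl _ then true else false.
Let crd g x : W := if x is inr p then (if p.1 == g then p.2 else 0) else 0.
Let lbl x : bool := if x is inl l then l else false.
Let cn g s := count (ing g) s.
Let sm g s : W := foldr (fun x a => crd g x + a) 0 s.
Let lb s : bool := foldr (fun x (l : bool) => lbl x (+) l) false s.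
Let tot s := sm None s + sm (Some false) s + sm (Some true) s.
Let good g j j' := [&& st j == None, ix j == g & pi j == j'].
(** A transversal triple with sum s is completed by the stem point [st s] or, if there is none, by a
    second point in the group [ix s] that changes the sum of the transversal to [pi s]. Hence two
    points of one group occur in these blocks only with a difference in [dd]; the other pairs are
    left to the factorization [col]. Counts and sums make both types visibly invariant under
    permutations. *)
Let typ1 s := [&& count ins s == 1%N, cn None s == 1%N, cn (Some false) s == 1%N,
  cn (Some true) s == 1%N & st (tot s) == Some (lb s)].
Let typ2 g s := [&& cn None s == (g == None).+1, cn (Some false) s == (g == Some false).+1,
  cn (Some true) s == (g == Some true).+1 &
  has (fun x => ing g x && good g (crd g x + (tot s - sm g s)) (sm g s - crd g x + (tot s - sm g s))) s].
Let Rs s := uniq s && [|| typ1 s, typ2 None s, typ2 (Some false) s | typ2 (Some true) s].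
Let R x y z w : Prop := Rs [:: x; y; z; w].

Let Rs_perm s s' : perm_eq s s' -> Rs s -> Rs s'.
Proof.
move=> e.
have ec g : cn g s = cn g s' by apply/permP.
have es g : sm g s = sm g s'.
  have e' r : sm g r = \sum_(x <- r) crd g x by elim: r => [|x r IH]; rewrite ?big_nil ?big_cons -?IH.
  by rewrite !e'; apply: perm_big.
have el : lb s = lb s'.
  have e' r : lb r = \big[addb/false]_(x <- r) lbl x
    by elim: r => [|x r IH]; rewrite ?big_nil ?big_cons -?IH.
  by rewrite !e'; apply: perm_big.
have ei : count ins s = count ins s' by apply/permP.
have eh P : has P s = has P s' by apply: eq_has_r; apply: perm_mem.
by rewrite /Rs (perm_uniq e) /typ1 /typ2 /tot !ec !es el ei !eh.
Qed.

Let okd x y : bool := match x, y with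
  | inr p, inr q => (p.1 == q.1) ==> dd (q.2 - p.2) | _, _ => true end.
Let D x y z : bool := [&& cqs_dom x y z, okd x y, okd x z & okd y z].

Let E x y z := exists2 w, R x y z w & forall w', R x y z w' -> w = w'.
Let E12 x y z : E x y z -> E y x z.
Proof.
case=> w h u; exists w => [|w' h']; first exact: Rs_perm (perm4_12 _ _ _ _) h.
exact/u/(Rs_perm (perm4_12 _ _ _ _) h').
Qed.
Let E23 x y z : E x y z -> E x z y.
Proof.
case=> w h u; exists w => [|w' h']; first exact: Rs_perm (perm4_23 _ _ _ _) h.
exact/u/(Rs_perm (perm4_23 _ _ _ _) h').
Qed.

Ltac rsimp := rewrite /Rs /typ1 /typ2 /tot /cn /sm /lb /=
  ?inE ?(inj_eq (@inr_inj _ _)) ?xpair_eqE /= ?andbF ?orbF ?andbT ?addr0 ?add0r ?addbF ?andbF ?orbF.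

Let goodC g j j' : good g j j' -> good g j' j.
Proof.
by case/and3P => /eqP s /eqP i /eqP <-; rewrite /good pi_st // pi_ix // piK // i !eqxx.
Qed.

Let goodN g j j' : good g j j' -> j != j'.
Proof. by case/and3P => /eqP s _ /eqP <-; rewrite eq_sym; apply: pi_neq. Qed.

Let co a b c g : W := match g with None => a | Some false => b | Some true => c end.

Let key2 g X1 Y1 X2 Y2 X Y : X1 = X -> Y1 = Y -> X2 = Y -> Y2 = X ->
  good g X1 Y1 || good g X2 Y2 = good g X Y.
Proof. by move=> -> -> -> ->; apply/orP/idP => [[//|/goodC //]|]; left. Qed.

Let key3 g u v X1 Y1 X2 Y2 X Y : X1 = X -> Y1 = Y -> X2 = Y -> Y2 = X -> X - Y = u - v ->
  (u != v) && (good g X1 Y1 || good g X2 Y2) = good g X Y.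
Proof.
move=> e1 e2 e3 e4 e5; rewrite (key2 g e1 e2 e3 e4); apply/andP/idP => [[]//|h]; split => //.
by rewrite -subr_eq0 -e5 subr_eq0; apply: goodN h.
Qed.

Let R1E a b c w : Rs [:: inr (None, a); inr (Some false, b); inr (Some true, c); w] =
  match w with
  | inl l => st (a + b + c) == Some l
  | inr (g, v) => good g (a + b + c) (a + b + c - co a b c g + v) end.
Proof.
case: w => [l|[g v]]; first by rsimp.
by case: g => [[]|]; rsimp; apply: key3; rewrite /co; ring.
Qed.

Let R2E g g' a a' b w : g != g' -> a != a' ->
  Rs [:: inr (g, a); inr (g, a'); inr (g', b); w] =
  if w is inr (g'', v) then [&& g'' != g, g'' != g' & good g (a + b + v) (a' + b + v)] else false.
Proof.
move=> n na; case: w => [l|[g'' v]].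
  by case: g g' n => [[]|] [[]|] // _; rsimp.
case: g g' g'' n => [[]|] [[]|] [[]|] // _; rsimp => //; rewrite ?na /=; apply: key2; ring.
Qed.

Let R3E l g g' a b w : g != g' -> Rs [:: inl l; inr (g, a); inr (g', b); w] =
  if w is inr (g'', v) then [&& g'' != g, g'' != g' & st (a + b + v) == Some l] else false.
Proof.
move=> n; case: w => [l'|[g'' v]].
  by case: g g' n => [[]|] [[]|] // _; rsimp.
case: g g' g'' n => [[]|] [[]|] [[]|] // _; rsimp => //; congr (st _ == _); ring.
Qed.

Let RDD g a a' z w : Rs [:: inr (g, a); inr (g, a'); z; w] -> dd (a' - a).
Proof.
have dg X Y h : Y - X = a' - a -> good h X Y -> dd (a' - a).
  by move=> <- /and3P [/eqP s _ /eqP <-]; apply: pi_dd.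
have dg' X Y h : X - Y = a' - a -> good h X Y -> dd (a' - a).
  by move=> e /goodC; apply: dg.
case: z => [l|[g' b]]; case: w => [l'|[g'' v]]; case: g => [[]|]; try case: g' => [[]|];
  try case: g'' => [[]|]; rsimp => //; case/andP => _ /orP [] h;
  first [apply: dg h; ring | apply: dg' h; ring].
Qed.

Let thr g g' : G := match g, g' with
  | None, Some l => Some (~~ l) | Some l, None => Some (~~ l) | _, _ => None end.
Let thrP g g' g'' : g != g' -> [&& g'' != g & g'' != g'] = (g'' == thr g g').
Proof. by case: g g' g'' => [[]|] [[]|] [[]|]. Qed.

Let E1 a b c : E (inr (None, a)) (inr (Some false, b)) (inr (Some true, c)).
Proof.
case e: (st (a + b + c)) => [l|].
  exists (inl l) => [|[l'|[g v]]]; rewrite /R R1E ?e ?eqxx //; first by move/eqP => [->].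
  by case/and3P; rewrite e.
exists (inr (ix (a + b + c), co a b c (ix (a + b + c)) + pi (a + b + c) - (a + b + c))) => [|[l|[g v]]];
  rewrite /R R1E ?e //.
  by rewrite /good e !eqxx /=; apply/eqP; ring.
by case/and3P => _ /eqP <- /eqP ->; congr (inr (_, _)); ring.
Qed.

Let E2 g g' a a' b : g != g' -> dd (a' - a) -> E (inr (g, a)) (inr (g, a')) (inr (g', b)).
Proof.
move=> n d; have na : a != a' by apply: contraNneq dd0 => e; move: d; rewrite e subrr.
have [j [sj ij pj] uj] := dd_pi g d.
have gj : good g j (a' + (j - a)) by rewrite /good sj ij eqxx /=; apply/eqP; rewrite -[pi j](subrK j) pj; ring.
exists (inr (thr g g', j - a - b)) => [|w]; rewrite /R R2E //.
  change (is_true [&& thr g g' != g, thr g g' != g' & good g (a + b + (j - a - b)) (a' + b + (j - a - b))]).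
  have e1 : a + b + (j - a - b) = j by ring.
  have e2 : a' + b + (j - a - b) = a' + (j - a) by ring.
  by rewrite e1 e2 andbA (thrP _ n) eqxx.
case: w => [//|[g'' v]]; rewrite andbA (thrP _ n) => /andP [/eqP -> /and3P [/eqP s /eqP i /eqP p]].
have -> // : v = j - a - b.
have <- : a + b + v = j by apply: uj => //; rewrite p; ring.
ring.
Qed.

Let E3 l g g' a b : g != g' -> E (inl l) (inr (g, a)) (inr (g', b)).
Proof.
move=> n; have [j sj uj] := stE l.
exists (inr (thr g g', j - a - b)) => [|w]; rewrite /R (R3E _ _ _ _ n).
  change (is_true [&& thr g g' != g, thr g g' != g' & st (a + b + (j - a - b)) == Some l]).
  have e1 : a + b + (j - a - b) = j by ring.
  by rewrite e1 sj andbA (thrP _ n) !eqxx.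
case: w => [//|[g'' v]]; rewrite andbA (thrP _ n) => /andP [/eqP -> /eqP /uj <-].
by congr (inr (_, _)); ring.
Qed.

Let DE x y z : D x y z -> E x y z.
Proof.
case/and4P => /andP [/and3P [nxy nxz nyz] sp] d1 d2 d3.
move: nxy nxz nyz sp d1 d2 d3; case: x y z => [l|[g a]] [l'|[g' b]] [l''|[g'' c]] //=;
  rewrite ?orbF /= => nxy nxz nyz sp d1 d2 d3.
- exact: E3.
- by apply: E12; apply: E3.
- by apply: E12; apply: E23; apply: E12; apply: E3; rewrite eq_sym.
have [e|n1] := eqVneq g g'.
  subst g'; move: d1; rewrite eqxx /= => d1; apply: E2 d1.
  by move: sp; rewrite eqxx /= orbb.
have [e|n2] := eqVneq g g''.
  by subst g''; move: d2; rewrite eqxx /= => d2; apply: E23; apply: E2 d2.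
have [e|n3] := eqVneq g' g''.
  subst g''; move: d3; rewrite eqxx /= => d3; apply: E12; apply: E23.
  by apply: E2 d3; rewrite eq_sym.
have F1 := E1; move: F1; clear -E12 E23 n1 n2 n3 => F1.
case: g g' g'' n1 n2 n3 => [[]|] [[]|] [[]|] // _ _ _.
- by apply: E12; apply: E23; apply: E12; apply: F1.
- by apply: E12; apply: E23; apply: F1.
- by apply: E23; apply: E12; apply: F1.
- by apply: E12; apply: F1.
- by apply: E23; apply: F1.
Qed.

Let RD x y z w : R x y z w -> D x y z.
Proof.
rewrite /R => h; have /andP [/= u _] := h.
have ok (p q t v : T) : Rs [:: p; q; t; v] -> okd p q.
  case: p q => [//|[g a]] [//|[g' b]] hr; rewrite /okd /=; apply/implyP => /eqP e.
  by subst g'; apply: RDD hr.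
rewrite /D (ok _ _ _ _ h) (ok _ _ _ _ (Rs_perm (perm4_23 _ _ _ _) h)).
rewrite (ok _ _ _ _ (Rs_perm (perm4_23 _ _ _ _) (Rs_perm (perm4_12 _ _ _ _) h))) !andbT.
rewrite /cqs_dom /distinct3; move: u; rewrite !inE !negb_or.
move=> /and4P [/and3P [-> -> _] /andP [-> _] _ _] /=.
have {h} : [&& 0 < cn None [:: x; y; z; w], 0 < cn (Some false) [:: x; y; z; w] &
    0 < cn (Some true) [:: x; y; z; w]]%N.
  case/andP: h => _ /or4P [/and5P [_ /eqP -> /eqP -> /eqP -> _]|/and4P [/eqP -> /eqP -> /eqP -> _]|
    /and4P [/eqP -> /eqP -> /eqP -> _]|/and4P [/eqP -> /eqP -> /eqP -> _]] //.
by case: x y z => [l|[[[]|] a]] [l'|[[[]|] a']] [l''|[[[]|] a'']] //=; case: w => [l3|[[[]|] a3]].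
Qed.

Let trip_cross : design (fun x y z => D x y z) R.
Proof.
split.
- by move=> x y z w; apply: Rs_perm (perm4_12 _ _ _ _).
- by move=> x y z w; apply: Rs_perm (perm4_23 _ _ _ _).
- by move=> x y z w; apply: Rs_perm (perm4_34 _ _ _ _).
- exact: RD.
- by move=> x y z /DE [w]; exists w.
by move=> x y z w w' h; have [v _ u] := DE (RD h); move: (h) => /u <- /u <-.
Qed.

Lemma cqs_triple : cqs bool G W.
Proof.
have inrI : injective (inr : G * W -> T) by move=> p q [].
have dP := ex_intro _ _ (design_map inrI (pairs_design G fcol)).
apply: (has_design_union _ _ (ex_intro _ _ trip_cross) dP) => x y z.
  case/and4P => _ d1 d2 d3 [p [q [r [ex ey ez]]]]; subst x y z.
  by case=> [] [e n /andP [_ /negP []]]; move: d1 d2 d3; rewrite /= e eqxx /=.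
split; last first.
  case=> [/and4P [] //|[[g a] [[g' b] [[g'' c] [-> -> -> pd]]]]].
  rewrite /cqs_dom /distinct3 /= !(inj_eq (@inr_inj _ _)) !xpair_eqE.
  case: pd => [] [/= <- n /andP [m _]]; rewrite eqxx (negPf m) ?(negPf n) ?n ?orbT //=.
  - by rewrite eq_sym (negPf n).
  by rewrite !(eq_sym g) (negPf n).
move=> d; case: (boolP (D x y z)) => nd; [by left|right].
move: nd d; rewrite /D => nd d; move: nd; rewrite d /=.
have mk (p q r : G * W) : x = inr p -> y = inr q -> z = inr r ->
  pairs_dom (fun a b => (a != b) && ~~ dd (b - a)) p q r ->
  exists a b c : G * W, [/\ x = inr a, y = inr b, z = inr c & pairs_dom (fun a b => (a != b) && ~~ dd (b - a)) a b c].
  by move=> -> -> -> h; exists p, q, r.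
move: d mk; rewrite /cqs_dom /distinct3; case: x y z => [l|[g a]] [l'|[g' b]] [l''|[g'' c]] //=;
  rewrite ?orbF ?andbT ?andbF //= ?(inj_eq (@inr_inj _ _)) ?xpair_eqE.
- by case/andP => _ /negPf ->.
- by case/andP => _ /negPf ->.
- by case/andP => _ /negPf ->.
case/andP => /and3P [n1 n2 n3] sp mk nd.
apply: (mk (g, a) (g', b) (g'', c)) => //.
have [e|m1] := eqVneq g g'.
  subst g'; rewrite eqxx /= orbb in n1 sp; rewrite eqxx (negPf sp) /= !andbT in nd.
  by apply: Or31; split => //=; rewrite n1.
have [e|m2] := eqVneq g g''.
  subst g''; rewrite eqxx /= in n2; rewrite (negPf m1) eqxx [g' == g]eq_sym (negPf m1) /= andbT in nd.
  by apply: Or32; split => //=; rewrite n2.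
have [e|m3] := eqVneq g' g''; last by rewrite (negPf m1) (negPf m2) (negPf m3) in nd.
subst g''; rewrite eqxx /= in n3; rewrite (negPf m1) eqxx /= in nd.
by apply: Or33; split => //=; rewrite ?n3 // eq_sym.
Qed.

End Triple.

Section TripleInstance.
Variable t : nat.
Let n := 4 * t + 3.
Let w := 6 * n + 2.
Local Notation W := 'I_(24 * t + 18).+2.
Implicit Types a b j : W.

Let subv a b : val (a - b)%R = if b <= a then a - b else a + w - b.
Proof.
have := ltn_ord a; have := ltn_ord b; rewrite /= => hb ha.
case: leqP => l; last by rewrite modnDmr modn_small; rewrite /w /n; lia.
rewrite modnDmr (_ : a + ((24 * t + 18).+2 - b) = a - b + (24 * t + 18).+2); last lia.
by rewrite modnDr modn_small; lia.
Qed.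

(** The residues below 6n form three intervals of length 2n, one for each group, and the last two
    residues belong to the stem. [pin] reflects every interval; the reflection of 2n consecutive
    numbers has each odd difference between -2n and 2n exactly once, and these differences are
    [dd]. *)
Let st j : option bool := if j < 6 * n then None else Some (val j == 6 * n + 1).
Let ix j : option bool := if j < 2 * n then None else Some (4 * n <= j).
Let pin (j : nat) := if j < 2 * n then 2 * n - 1 - j else
  if j < 4 * n then 6 * n - 1 - j else 10 * n - 1 - j.
Let pi j : W := inord (pin j).
Let dd a := odd a && ((a < 2 * n) || (w - 2 * n < a)).

Let st_None j : st j = None -> j < 6 * n. Proof. by rewrite /st; case: ifP. Qed.
Let piv j : j < 6 * n -> val (pi j) = pin j.
Proof. by move=> l; rewrite /pi /= inordK // /pin; do ?case: ifP; rewrite /n; lia. Qed.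

Let pivn j (l : j < 6 * n) : nat_of_ord (pi j) = pin j := piv l.

Let wE : (24 * t + 18).+2 = w. Proof. by rewrite /w /n; lia. Qed.

Let pi_dif j : j < 6 * n -> dd (pi j - j)%R.
Proof.
by move=> l; rewrite /dd subv piv // /pin /w; do ?case: ifP; rewrite /n; lia.
Qed.

Let hf a : 'I_(12 * t + 9).+1 := inord a./2.
Let hfv a : val (hf a) = a./2.
Proof. by rewrite /hf /= inordK //; have := ltn_ord a; lia. Qed.

Let ddN a : dd (- a)%R = dd a.
Proof.
have la : a < w by rewrite -wE ltn_ord.
have ew : ~~ odd w by rewrite /w; lia.
have [b eb hb] : exists2 b, (- a)%R = b :> nat & (a == 0 :> nat) && (b == 0) || (a + b == w).
  exists (nat_of_ord (- a)%R) => //; have := subv 0%R a; rewrite sub0r /= => ->.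
  change (nat_of_ord (0%R : W)) with 0; case: leqP => l; move: la; move: w => w'; lia.
have ln : 2 * n < w by rewrite /w; lia.
rewrite /dd eb; move: hb la ew ln; move: (nat_of_ord a) => c; move: w n => w' n'; lia.
Qed.

Let st_ex (l : bool) : exists2 j, st j = Some l & forall j', st j' = Some l -> j' = j.
Proof.
have v : (inord (6 * n + l) : W) = 6 * n + l :> nat.
  by rewrite inordK // wE /w; case: (l); lia.
exists (inord (6 * n + l)) => [|j']; rewrite /st.
  by rewrite /= v; case: ifP => [|_]; [case: (l); lia|congr Some; case: (l); lia].
case: ifP => // /negbT; rewrite -leqNgt => l1 [e]; apply: val_inj; rewrite /= v.
by have : j' < w by [rewrite -wE ltn_ord]; rewrite /w; move: e => /=; case: (l); lia.
Qed.

Let pin_lt (j : nat) : j < 6 * n -> pin j < 6 * n.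
Proof. by move=> l; rewrite /pin; do ?case: ifP; lia. Qed.

Let dd_ex (g : option bool) a : dd a ->
  exists2 j, [/\ st j = None, ix j = g & (pi j - j)%R = a] &
    forall j', st j' = None -> ix j' = g -> (pi j' - j')%R = a -> j' = j.
Proof.
move=> da; pose b := if g is Some l then (if l then 4 * n else 2 * n) else 0.
pose e := if a < 2 * n then (2 * n - 1 - a)./2 else (2 * n - 1 + w - a)./2.
have la : a < w by rewrite -wE ltn_ord.
have le : e < 2 * n by rewrite /e; move: da; rewrite /dd; case: ifP; lia.
have lb : b + e < 6 * n by rewrite /b; case: (g) => [[]|]; lia.
have v : (inord (b + e) : W) = b + e :> nat by rewrite inordK // wE /w; lia.
have ew : ~~ odd w by rewrite /w; lia.
have w4 : 4 * n < w by rewrite /w; lia.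
have de : (a < 2 * n) && (e.*2 + a == 2 * n - 1) || [&& w - 2 * n < a & e.*2 + a == 2 * n - 1 + w].
  move: da; rewrite /dd /e => /andP [oa]; move: ew w4 oa la; move: (nat_of_ord a) => c; clear; move: w n => w' n'.
  by case: ifP; lia.
have pinE x g' : x < 2 * n -> g' = g -> pin (b + x) = b + (2 * n - 1 - x).
  by move=> lx _; rewrite /pin /b; case: (g) => [[]|]; do ?case: ifP; lia.
exists (inord (b + e)).
  split.
  - by rewrite /st /= v lb.
  - rewrite /ix /= v /b; case: (g) => [[]|].
    + have f1 : (4 * n + e < 2 * n) = false by lia.
      by rewrite f1 leq_addr.
    + have f1 : (2 * n + e < 2 * n) = false by lia.
      have f2 : (4 * n <= 2 * n + e) = false by lia.
      by rewrite f1 f2.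
    by rewrite add0n le.
  apply: val_inj; rewrite subv piv /= v // (pinE e g) //.
  move: de w4 la le; move: (b) (e) (nat_of_ord a) => b' e' a'; clear; move: w n => w' n'.
  by move=> h1 h2 h3 h4; case: leqP; lia.
move=> j' /st_None lj ij pj; apply: val_inj; rewrite /= v.
have [x ex lx] : exists2 x, val j' = b + x & x < 2 * n.
  have bx : b <= j' < b + 2 * n.
    by move: ij; rewrite /ix /b; case: (g) => [[]|]; case: ifP => l //; (try case=> l2); lia.
  by exists (j' - b); move: bx; rewrite /=; move: (b) (nat_of_ord j') => b' x'; clear; lia.
move/(congr1 val): pj; rewrite subv piv // ex (pinE x g) //.
move: de w4 la lx le; rewrite /=; move: (b) (e) (nat_of_ord a) => b' e' a'; clear; move: w n => w' n'.
by move=> h1 h2 h3 h4 h5; case: leqP => h6 h7; lia.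
Qed.

(** Pairs with even difference are coloured inside the two parity classes, whose size 12t + 10 is
    even. An odd difference outside [dd], computed as even end minus odd end, is a colour by
    itself. *)
Lemma cqs_triple_inst : cqs bool (option bool) W.
Proof.
have [K [c fc]] : exists K (c : 'I_(12 * t + 9).+1 -> 'I_(12 * t + 9).+1 -> K), onefact (@neqr _) c.
  by apply: onefact_even; rewrite card_ord; lia.
pose col a b : K + W := if odd a == odd b then inl (c (hf a) (hf b))
  else inr (if odd a then b - a else a - b)%R.
have odd_sub a b : odd (val (a - b)%R) = odd a (+) odd b.
  have lb : b < w by rewrite -wE ltn_ord.
  by rewrite subv; case: leqP => l; rewrite /w in lb *; lia.
apply: (@cqs_triple W st ix pi dd _ col).
- exact: st_ex.
- move=> j /st_None l; apply: val_inj; rewrite /= pivn; last by rewrite pivn // pin_lt.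
  by rewrite pivn // /pin; do ?case: ifP; lia.
- by move=> j /st_None l; rewrite /st pivn // pin_lt.
- move=> j /st_None l; rewrite /ix pivn // /pin.
  case: (ltnP j (2 * n)) => l1; first by case: ifP => //; lia.
  by case: (ltnP j (4 * n)) => l2; case: ifP => l3; [lia|congr Some; lia|lia|congr Some; lia].
- by move=> j /st_None l; rewrite -(inj_eq val_inj) /= pivn // /pin; do ?case: ifP => ?; lia.
- by move=> j /st_None; apply: pi_dif.
- exact: dd_ex.
- by [].
split.
- by move=> a b; rewrite eq_sym -[in RHS]ddN opprB.
- move=> a b; rewrite /col eq_sym; case: ifP => e; first by rewrite (onefact_sym fc).
  by congr inr; move: e; case: (odd a); case: (odd b).
- move=> x y z /andP [nxy ndd]; rewrite /col.
  case: (eqVneq (odd x) (odd y)) => [e|ne].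
    have nh : neqr (hf x) (hf y).
      rewrite /neqr -(inj_eq val_inj) !hfv; apply: contraNneq nxy => e2.
      by apply/eqP; apply: val_inj; rewrite /= -(odd_double_half x) -(odd_double_half y) e e2.
    have [u nu eu] := onefact_ex fc (hf z) nh.
    have lu := ltn_ord u.
    have v : (inord (odd z + u.*2) : W) = odd z + u.*2 :> nat by rewrite inordK //; case: (odd z); lia.
    have od : odd (inord (odd z + u.*2) : W) = odd z by rewrite v; case: (odd z); lia.
    have hu : hf (inord (odd z + u.*2)) = u.
      by apply: val_inj; rewrite hfv /= v; case: (odd z); lia.
    exists (inord (odd z + u.*2)); last by rewrite od eqxx hu eu.
    rewrite /dd odd_sub od addbb andbT; apply: contraNneq nu => ez.
    by rewrite /neqr {1}ez hu.
  have [d [od nd ed]] : exists d : W, [/\ odd d, ~~ dd d &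
      (if odd x then y - x else x - y)%R = d].
    exists (if odd x then y - x else x - y)%R; split => //; last first.
      by case: (odd x); rewrite // -ddN opprB.
    by move: ne; case: ifP => ox; rewrite odd_sub ox; case: (odd y).
  have nz : d != 0%R by apply: contraTneq od => ->.
  exists (if odd z then z + d else z - d)%R.
    case: ifP => oz.
      have -> : (z + d - z = d)%R by rewrite addrC addKr.
      by rewrite nd andbT; apply: contra_neq nz => e; apply: (addrI z); rewrite addr0 -e.
    have -> : (z - d - z = - d)%R by rewrite addrC addKr.
    rewrite ddN nd andbT; apply: contra_neq nz => e; apply: oppr_inj; apply: (addrI z).
    by rewrite oppr0 addr0 -e.
  have oD : odd (nat_of_ord (z + d)%R) = odd z (+) odd d.
    by have := odd_sub z (- d)%R; rewrite opprK => ->; rewrite -[(- d)%R]sub0r odd_sub.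
  have oS : odd (nat_of_ord (z - d)%R) = odd z (+) odd d := odd_sub z d.
  rewrite ed; case oz: (odd z); rewrite oz od /= in oD oS.
    by rewrite oD /=; congr inr; rewrite addrC addKr.
  by rewrite oS /=; congr inr; rewrite opprB addrC subrK.
move=> z x y /andP [nx dx] /andP [ny dy]; rewrite /col.
case: eqP => ex; case: eqP => ey // [].
  move=> /(onefact_inj fc) e.
  have nh a : odd z = odd a -> z != a -> neqr (hf z) (hf a).
    move=> e1 n1; rewrite /neqr -(inj_eq val_inj) !hfv; apply: contraNneq n1 => e2.
    by apply/eqP; apply: val_inj; rewrite /= -(odd_double_half z) -(odd_double_half a) e1 e2.
  have /(congr1 val) := e (nh _ ex nx) (nh _ ey ny); rewrite !hfv => e2.
  by apply: val_inj; rewrite /= -(odd_double_half x) -(odd_double_half y) -ex -ey e2.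
by case: ifP => _; [move/addIr|move/addrI/oppr_inj].
Qed.

(** Hanani's step from v to 3v - 4, with v = 24t + 22. *)
Lemma sqs_triple : sqs 'I_(24 * t + 22) -> sqs 'I_(72 * t + 62).
Proof.
move=> hs; have := sqs_cqs2 cqs_triple_inst (sqs_card _ hs).
rewrite card_sum card_bool !card_ord => h2.
have {}h2 := h2 ltac:(lia); apply: sqs_card h2.
by rewrite card_sum card_prod card_option card_bool !card_ord; lia.
Qed.
End TripleInstance.

(** * Small designs *)

Fixpoint lexle (s t : seq nat) : bool := match s, t with
  | x :: s', y :: t' => if x == y then lexle s' t' else x < y
  | [::], _ => true | _, _ => false end.
Fixpoint squash (s : seq (seq nat)) : seq (seq nat) := match s with
  | x :: s' => if s' is y :: _ then if x == y then squash s' else x :: squash s' else s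
  | [::] => [::] end.
Fixpoint fours (s : seq nat) : seq (seq nat) :=
  if s is a :: b :: c :: d :: s' then [:: a; b; c; d] :: fours s' else [::].
(** Short orbits produce the same block several times; after sorting, [squash] removes the
    repetitions. *)
Definition orbits (fs : seq (nat -> nat)) (base : seq nat) : seq (seq nat) :=
  squash (sort lexle [seq sort leq (map f b) | f <- fs, b <- fours base]).
Definition tri4 (b : seq nat) : seq (seq nat) :=
  if b is [:: p; q; r; s] then [:: [:: p; q; r]; [:: p; q; s]; [:: p; r; s]; [:: q; r; s]] else [::].
Definition triples (N : nat) : seq (seq nat) :=
  flatten [seq flatten [seq [seq [:: x; y; z] | z <- iota y.+1 (N - y.+1)] | y <- iota x.+1 (N - x.+1)]
    | x <- iota 0 N].
(** The list on the right is sorted and free of repetitions, so a single equality of lists gives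
    existence and uniqueness of the block through a triple. *)
Definition check_design (N : nat) (hole : seq nat -> bool) (bs : seq (seq nat)) : bool :=
  all (fun b => [&& sorted ltn b, size b == 4 & all (ltn^~ N) b]) bs &&
  (sort lexle (flatten (map tri4 bs)) == [seq t <- triples N | ~~ hole t]).

Lemma mem_triples N x y z : [:: x; y; z] \in triples N = (x < y < z) && (z < N).
Proof.
apply/flatten_mapP/idP => [[x' hx /flatten_mapP [y' hy /mapP [z' hz [-> -> ->]]]]|h].
  by move: hx hy hz; rewrite !mem_iota; lia.
exists x; first by rewrite mem_iota; lia.
apply/flatten_mapP; exists y; first by rewrite mem_iota; lia.
by apply/mapP; exists z => //; rewrite mem_iota; lia.
Qed.

Lemma uniq_triples N : uniq (triples N).
Proof.
have uf (A : eqType) (f : nat -> seq A) s : uniq s -> (forall x, uniq (f x)) ->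
    (forall x y t, t \in f x -> t \in f y -> x = y) -> uniq (flatten [seq f x | x <- s]).
  move=> us uF inj; elim: s us => //= x s IH /andP [xs us]; rewrite cat_uniq uF IH // andbT /=.
  apply/hasPn => t /flatten_mapP [y ys ty]; apply/negP => tx.
  by rewrite (inj x y t) // ys in xs.
apply: (uf _ _ _ (iota_uniq _ _)) => [x|x x' t].
  apply: (uf _ _ _ (iota_uniq _ _)) => [y|y y' t].
    by rewrite map_inj_uniq ?iota_uniq // => z z' [].
  by case/mapP => z _ -> /mapP [z' _ [->]].
by case/flatten_mapP => y _ /mapP [z _ ->] /flatten_mapP [y' _ /mapP [z' _ [->]]].
Qed.

Lemma check_designP N hole bs : (forall s s', perm_eq s s' -> hole s = hole s') ->
  check_design N hole bs ->
  has_design (fun x y z : 'I_N => distinct3 x y z && ~~ hole [:: val x; val y; val z]).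
Proof.
move=> hp /andP [/allP wf /eqP eqt].
have pe : perm_eq (flatten (map tri4 bs)) [seq t <- triples N | ~~ hole t].
  by rewrite -eqt perm_sym perm_sort.
have ut : uniq (flatten (map tri4 bs)) by rewrite (perm_uniq pe) filter_uniq // uniq_triples.
have one b b' t : b \in bs -> b' \in bs -> t \in tri4 b -> t \in tri4 b' -> b = b'.
  elim: (bs) ut => //= b0 s IH; rewrite cat_uniq => /and3P [_ nh us]; rewrite !inE.
  have no b1 : b1 \in s -> t \in tri4 b1 -> t \in tri4 b0 -> False.
    move=> h1 h2 h3; case/negP: nh; apply/hasP; exists t => //.
    by apply/flatten_mapP; exists b1.
  move=> /orP [/eqP ->|h1] /orP [/eqP ->|h2] // t1 t2; [case: (no _ h2 t2 t1)|case: (no _ h1 t1 t2)|].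
  exact: IH.
pose R (x y z w : 'I_N) : Prop := exists2 b, b \in bs & perm_eq b [:: val x; val y; val z; val w].
have srt3 (x y z : nat) : exists p q r, [/\ sort leq [:: x; y; z] = [:: p; q; r], perm_eq [:: x; y; z] [:: p; q; r] & p <= q <= r].
  have := sort_sorted leq_total [:: x; y; z]; have pp := permEl (perm_sort leq [:: x; y; z]).
  have := size_sort leq [:: x; y; z]; case e : (sort leq [:: x; y; z]) pp => [|p [|q [|r []]]] // pp _.
  by rewrite /= andbT => so; exists p, q, r; split; rewrite // perm_sym.
have intri b (x y z w : nat) : b \in bs -> perm_eq b [:: x; y; z; w] ->
    sort leq [:: x; y; z] \in tri4 b.
  move=> /wf /and3P [so sz _]; case: b so sz => [|p [|q [|r [|s []]]]] //= so _ pb.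
  have fin u v t : p <= s -> u < v < t -> perm_eq [:: u; v; t] [:: x; y; z] ->
    sort leq [:: x; y; z] = [:: u; v; t].
    move=> _ l pt; apply: (sorted_eq leq_trans anti_leq); first exact: sort_sorted leq_total _.
      by rewrite /=; lia.
    by rewrite perm_sort perm_sym.
  have : w \in [:: p; q; r; s] by rewrite (perm_mem pb) !inE eqxx !orbT.
  have cut u v t : perm_eq [:: u; v; t; w] [:: x; y; z; w] -> perm_eq [:: u; v; t] [:: x; y; z].
    by rewrite -[X in perm_eq X _]/([:: u; v; t] ++ [:: w]) -[X in perm_eq _ X]/([:: x; y; z] ++ [:: w]) perm_cat2r.
  have pb' s' : perm_eq s' [:: p; q; r; s] -> perm_eq s' [:: x; y; z; w] by move=> h; apply: perm_trans h pb.
  have mv u v t k : perm_eq [:: u; v; t; k] [:: p; q; r; s] -> w = k -> u < v < t ->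
      sort leq [:: x; y; z] = [:: u; v; t].
    move=> h e l; apply: fin => //; first by lia.
    by apply: cut; rewrite e in pb pb' *; apply: pb'.
  rewrite !inE => /or4P [] /eqP e.
  - by rewrite (mv q r s p) ?eqxx ?orbT //; [apply/permP => f /=; lia|lia].
  - by rewrite (mv p r s q) ?eqxx ?orbT //; [apply/permP => f /=; lia|lia].
  - by rewrite (mv p q s r) ?eqxx ?orbT //; [apply/permP => f /=; lia|lia].
  by rewrite (mv p q r s) ?eqxx ?orbT //; lia.
exists R; split.
- by move=> x y z w [b hb pb]; exists b => //; apply: perm_trans pb (perm4_12 _ _ _ _).
- by move=> x y z w [b hb pb]; exists b => //; apply: perm_trans pb (perm4_23 _ _ _ _).
- by move=> x y z w [b hb pb]; exists b => //; apply: perm_trans pb (perm4_34 _ _ _ _).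
- move=> x y z w [b hb pb].
  have : sort leq [:: val x; val y; val z] \in flatten (map tri4 bs).
    by apply/flatten_mapP; exists b => //; apply: intri pb.
  rewrite (perm_mem pe) mem_filter => /andP [nh _].
  rewrite (hp _ _ (permEl (perm_sort leq _))) in nh; rewrite nh andbT.
  have /and3P [so _ _] := wf _ hb.
  have := perm_uniq pb; rewrite (sorted_uniq ltn_trans ltnn so) => /esym.
  rewrite /distinct3 -!(inj_eq val_inj) /= !inE !negb_or.
  by case/and4P => /and3P [-> -> _] /andP [-> _].
- move=> x y z /andP [/and3P [nxy nxz nyz] nh].
  have [p [q [r [es ps le]]]] := srt3 x y z.
  have up : uniq [:: p; q; r].
    by rewrite -(perm_uniq ps) /= !inE !negb_or -!(inj_eq val_inj) in nxy nxz nyz *; rewrite nxy nxz nyz.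
  have lN : r < N.
    have : r \in [:: val x; val y; val z] by rewrite (perm_mem ps) !inE eqxx !orbT.
    by rewrite !inE => /or3P [] /eqP ->; apply: ltn_ord.
  have : [:: p; q; r] \in flatten (map tri4 bs).
    rewrite (perm_mem pe) mem_filter mem_triples -(hp _ _ ps) nh lN andbT /=.
    by move: up; rewrite /= !inE; lia.
  case/flatten_mapP => b hb hin; have /and3P [so sz al] := wf _ hb.
  suff [s sb] : exists2 s, s \in b & perm_eq b [:: val x; val y; val z; s].
    have ls : s < N by apply: (allP al).
    by exists (Ordinal ls); exists b.
  have pr s : perm_eq b [:: p; q; r; s] -> perm_eq b [:: val x; val y; val z; s].
    move=> h; apply: perm_trans h _; rewrite perm_sym.
    by rewrite -[X in perm_eq X _]/([:: val x; val y; val z] ++ [:: s]) -[X in perm_eq _ X]/([:: p; q; r] ++ [:: s]) perm_cat2r.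
  case: b hb hin so sz al pr => [|a [|b' [|c [|d []]]]] //= _ hin _ _ _ pr.
  move: hin; rewrite !inE => /or4P [] /eqP [e1 e2 e3]; subst p q r.
  - by exists d; [rewrite !inE eqxx !orbT|apply: pr].
  - by exists c; [rewrite !inE eqxx !orbT|apply: pr; apply/permP => f /=; lia].
  - by exists b'; [rewrite !inE eqxx !orbT|apply: pr; apply/permP => f /=; lia].
  by exists a; [rewrite !inE eqxx|apply: pr; apply/permP => f /=; lia].
move=> x y z w w' [b hb pb] [b' hb' pb']; apply: val_inj.
have e : b = b' by apply: one (intri _ _ _ _ _ hb pb) (intri _ _ _ _ _ hb' pb').
subst b'; have := perm_trans (etrans (perm_sym _ _) pb) pb'.
rewrite -[X in perm_eq X _]/([:: val x; val y; val z] ++ [:: val w]).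
rewrite -[X in perm_eq _ X]/([:: val x; val y; val z] ++ [:: val w']) perm_cat2l => /perm_mem /(_ (val w)).
by rewrite !inE eqxx => /esym /eqP.
Qed.

Definition sqs10_base : seq nat :=
  [:: 0; 1; 2; 6; 0; 1; 3; 4; 0; 2; 4; 7].
Definition sqs14_base : seq nat :=
  [:: 0; 1; 4; 5; 0; 4; 9; 13; 0; 2; 7; 9; 0; 2; 11; 13; 0; 3; 7; 10; 0; 1; 2; 3; 0; 2; 4; 10; 0;
  2; 5; 6; 0; 1; 7; 8; 0; 3; 6; 11; 0; 1; 6; 9; 1; 3; 5; 9; 0; 3; 5; 13].
(** The digits in the names of the candelabra tables are the size of a group, the number of groups
    and the size of the stem; [h63] has six groups of size 3. The tables list base blocks for the
    translations used in the checks further down. *)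
Definition c630_base : seq nat :=
  [:: 0; 3; 8; 11; 0; 4; 9; 13; 0; 2; 7; 9; 0; 1; 2; 10; 0; 1; 3; 5; 0; 1; 4; 8; 0; 1; 6; 11; 0;
  1; 13; 15; 0; 1; 7; 14; 0; 1; 12; 16; 0; 2; 8; 12].
Definition c634_base : seq nat :=
  [:: 0; 1; 2; 12; 0; 1; 3; 16; 0; 1; 4; 9; 0; 1; 5; 20; 0; 1; 6; 13; 0; 1; 7; 14; 0; 1; 8; 21; 0;
  1; 10; 15; 0; 1; 11; 19; 0; 1; 17; 18; 0; 2; 3; 5; 0; 2; 4; 20; 0; 2; 6; 14; 0; 2; 7; 18; 0; 2;
  8; 13; 0; 2; 9; 11; 0; 2; 16; 21; 0; 3; 8; 17; 0; 4; 5; 21; 0; 4; 8; 19; 0; 4; 14; 18; 0; 5; 7;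
  19; 0; 5; 8; 9; 0; 7; 9; 16; 0; 7; 17; 20; 1; 2; 4; 11; 1; 2; 5; 16; 1; 2; 7; 8; 1; 2; 10; 17;
  1; 5; 10; 14].
Definition c1232_base : seq nat :=
  [:: 0; 1; 2; 15; 0; 1; 3; 11; 0; 1; 4; 9; 0; 1; 5; 16; 0; 1; 6; 7; 0; 1; 8; 23; 0; 1; 10; 18; 0;
  1; 12; 13; 0; 1; 14; 34; 0; 1; 17; 21; 0; 1; 19; 27; 0; 1; 20; 22; 0; 1; 26; 36; 0; 1; 28; 33;
  0; 1; 29; 32; 0; 1; 30; 31; 0; 1; 35; 37; 0; 2; 3; 10; 0; 2; 4; 19; 0; 2; 5; 28; 0; 2; 6; 8; 0;
  2; 7; 17; 0; 2; 9; 11; 0; 2; 12; 14; 0; 2; 13; 35; 0; 2; 16; 21; 0; 2; 18; 20; 0; 2; 22; 23; 0;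
  2; 25; 36; 0; 2; 27; 29; 0; 2; 30; 32; 0; 2; 31; 33; 0; 2; 34; 37; 0; 3; 4; 31; 0; 3; 5; 25; 0;
  3; 7; 23; 0; 3; 8; 17; 0; 3; 13; 22; 0; 3; 14; 16; 0; 3; 19; 29; 0; 3; 20; 28; 0; 3; 26; 35; 0;
  3; 32; 34; 0; 4; 5; 20; 0; 4; 6; 10; 0; 4; 7; 26; 0; 4; 8; 11; 0; 4; 12; 16; 0; 4; 13; 18; 0; 4;
  14; 21; 0; 4; 15; 35; 0; 4; 17; 25; 0; 4; 22; 27; 0; 4; 23; 36; 0; 4; 29; 33; 0; 4; 30; 34; 0;
  4; 32; 37; 0; 5; 6; 11; 0; 5; 7; 10; 0; 5; 8; 27; 0; 5; 9; 23; 0; 5; 12; 17; 0; 5; 13; 21; 0; 5;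
  14; 33; 0; 5; 15; 34; 0; 5; 18; 32; 0; 5; 19; 26; 0; 5; 22; 36; 0; 5; 30; 35; 0; 5; 31; 37; 0;
  6; 13; 19; 0; 6; 14; 20; 0; 6; 16; 22; 0; 6; 17; 23; 0; 6; 25; 31; 0; 6; 26; 32; 0; 6; 28; 34;
  0; 6; 29; 35; 0; 7; 8; 33; 0; 7; 9; 16; 0; 7; 11; 21; 0; 7; 12; 31; 0; 7; 13; 24; 0; 7; 14; 28;
  0; 7; 15; 32; 0; 7; 18; 25; 0; 7; 19; 30; 0; 7; 20; 36; 0; 7; 22; 35; 0; 7; 27; 34; 0; 7; 29;
  37; 0; 8; 9; 26; 0; 8; 10; 21; 0; 8; 12; 32; 0; 8; 13; 34; 0; 8; 14; 24; 0; 8; 15; 31; 0; 8; 16;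
  29; 0; 8; 18; 35; 0; 8; 19; 36; 0; 8; 20; 30; 0; 8; 22; 25; 0; 8; 28; 37; 0; 9; 10; 28; 0; 9;
  13; 31; 0; 9; 14; 17; 0; 9; 19; 22; 0; 9; 20; 29; 0; 9; 25; 34; 0; 9; 32; 35; 0; 10; 11; 31; 0;
  10; 12; 34; 0; 10; 13; 27; 0; 10; 14; 35; 0; 10; 15; 29; 0; 10; 16; 24; 0; 10; 17; 36; 0; 10;
  19; 33; 0; 10; 20; 23; 0; 10; 22; 30; 0; 10; 25; 32; 0; 10; 26; 37; 0; 11; 12; 35; 0; 11; 13;
  32; 0; 11; 14; 19; 0; 11; 15; 28; 0; 11; 16; 36; 0; 11; 17; 24; 0; 11; 18; 29; 0; 11; 20; 27; 0;
  11; 22; 33; 0; 11; 23; 30; 0; 11; 25; 37; 0; 11; 26; 34; 0; 13; 14; 36; 0; 13; 15; 26; 0; 13;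
  16; 17; 0; 13; 20; 33; 0; 13; 23; 37; 0; 13; 25; 30; 0; 13; 28; 29; 0; 14; 15; 25; 0; 14; 18;
  23; 0; 14; 22; 37; 0; 14; 26; 30; 0; 14; 27; 32; 0; 14; 29; 31; 0; 15; 16; 23; 0; 15; 17; 22; 0;
  15; 19; 20; 0; 16; 18; 34; 0; 16; 19; 32; 0; 16; 20; 37; 0; 16; 25; 27; 0; 16; 26; 31; 0; 16;
  28; 30; 0; 16; 33; 35; 0; 17; 18; 26; 0; 17; 19; 37; 0; 17; 20; 31; 0; 17; 27; 35; 0; 17; 28;
  32; 0; 17; 29; 30; 0; 17; 33; 34; 0; 18; 19; 28; 0; 18; 22; 31; 0; 19; 21; 35; 0; 19; 23; 34; 0;
  20; 21; 34; 0; 20; 25; 35; 0; 21; 22; 32; 0; 21; 23; 31; 0; 21; 25; 29; 0; 21; 26; 28; 0; 22;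
  26; 29; 0; 23; 25; 28; 0; 23; 26; 27; 0; 23; 32; 33; 0; 25; 26; 33; 0; 27; 28; 31; 0; 28; 35;
  36; 0; 29; 34; 36; 0; 31; 32; 36; 0; 31; 34; 35; 1; 2; 3; 16; 1; 2; 4; 11; 1; 2; 5; 27; 1; 2; 6;
  17; 1; 2; 7; 8; 1; 2; 10; 20; 1; 2; 13; 14; 1; 2; 18; 22; 1; 2; 19; 29; 1; 2; 21; 23; 1; 2; 28;
  35; 1; 2; 30; 34; 1; 2; 31; 32; 1; 2; 33; 37; 1; 3; 4; 8; 1; 3; 5; 20; 1; 3; 6; 26; 1; 3; 7; 9;
  1; 3; 10; 30; 1; 3; 13; 15; 1; 3; 17; 22; 1; 3; 18; 35; 1; 3; 19; 21; 1; 3; 23; 36; 1; 3; 29;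
  34; 1; 3; 31; 33; 1; 3; 32; 37; 1; 4; 6; 23; 1; 4; 14; 15; 1; 4; 17; 30; 1; 4; 18; 27; 1; 4; 20;
  29; 1; 4; 21; 26; 1; 4; 32; 33; 1; 5; 6; 8; 1; 5; 7; 11; 1; 5; 9; 34; 1; 5; 10; 32; 1; 5; 13;
  17; 1; 5; 14; 28; 1; 5; 15; 22; 1; 5; 18; 26; 1; 5; 19; 23; 1; 5; 21; 36; 1; 5; 30; 37; 1; 5;
  31; 35; 1; 6; 9; 10; 1; 6; 11; 27; 1; 6; 13; 30; 1; 6; 14; 22; 1; 6; 15; 19; 1; 6; 16; 35; 1; 6;
  18; 31; 1; 6; 20; 36; 1; 6; 21; 32; 1; 6; 29; 37; 1; 6; 33; 34; 1; 7; 14; 20; 1; 7; 15; 21; 1;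
  7; 17; 23; 1; 7; 26; 32; 1; 7; 27; 33; 1; 7; 29; 35; 1; 8; 9; 30; 1; 8; 10; 11; 1; 8; 13; 32; 1;
  8; 14; 25; 1; 8; 15; 29; 1; 8; 16; 33; 1; 8; 17; 19; 1; 8; 18; 36; 1; 8; 20; 31; 1; 8; 26; 28;
  1; 8; 27; 37; 1; 8; 34; 35; 1; 9; 11; 22; 1; 9; 13; 33; 1; 9; 14; 35; 1; 9; 15; 25; 1; 9; 16;
  32; 1; 9; 17; 36; 1; 9; 18; 19; 1; 9; 20; 23; 1; 9; 21; 31; 1; 9; 26; 37; 1; 9; 27; 28; 1; 10;
  14; 23; 1; 10; 15; 33; 1; 10; 17; 35; 1; 10; 26; 29; 1; 11; 13; 35; 1; 11; 14; 18; 1; 11; 15;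
  36; 1; 11; 16; 30; 1; 11; 17; 25; 1; 11; 19; 20; 1; 11; 21; 34; 1; 11; 23; 31; 1; 11; 26; 33; 1;
  11; 28; 29; 1; 14; 16; 27; 1; 14; 17; 33; 1; 14; 19; 32; 1; 14; 21; 37; 1; 14; 26; 31; 1; 14;
  29; 30; 1; 15; 16; 26; 1; 15; 18; 28; 1; 15; 20; 37; 1; 15; 23; 30; 1; 15; 27; 31; 1; 15; 32;
  35; 1; 16; 18; 23; 1; 16; 20; 21; 1; 17; 18; 37; 1; 17; 20; 28; 1; 17; 26; 34; 1; 17; 27; 32; 1;
  17; 29; 31; 1; 18; 20; 33; 1; 18; 21; 29; 1; 18; 32; 34; 1; 19; 26; 35; 1; 20; 27; 30; 1; 21;
  22; 35; 1; 21; 28; 30; 1; 22; 23; 33; 1; 22; 26; 30; 1; 22; 27; 29; 1; 23; 27; 34; 1; 23; 28;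
  32; 1; 27; 35; 36; 1; 29; 33; 36; 1; 30; 32; 36; 1; 30; 33; 35; 2; 3; 4; 17; 2; 3; 5; 7; 2; 3;
  6; 29; 2; 3; 8; 9; 2; 3; 11; 21; 2; 3; 14; 15; 2; 3; 18; 34; 2; 3; 19; 23; 2; 3; 20; 30; 2; 3;
  22; 36; 2; 3; 31; 37; 2; 3; 32; 33; 2; 4; 5; 31; 2; 4; 6; 7; 2; 4; 8; 10; 2; 4; 9; 35; 2; 4; 14;
  16; 2; 4; 18; 23; 2; 4; 21; 36; 2; 4; 22; 29; 2; 4; 30; 37; 2; 4; 32; 34; 2; 5; 6; 15; 2; 5; 9;
  19; 2; 5; 10; 18; 2; 5; 16; 30; 2; 6; 9; 22; 2; 6; 10; 27; 2; 6; 14; 30; 2; 6; 16; 23; 2; 6; 18;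
  32; 2; 6; 19; 36; 2; 6; 20; 33; 2; 6; 21; 31; 2; 6; 28; 37; 2; 7; 9; 30; 2; 7; 10; 21; 2; 7; 11;
  16; 2; 7; 14; 31; 2; 7; 15; 23; 2; 7; 18; 36; 2; 7; 19; 32; 2; 7; 22; 33; 2; 7; 27; 37; 2; 7;
  29; 34; 2; 8; 15; 21; 2; 8; 16; 22; 2; 8; 27; 33; 2; 8; 28; 34; 2; 9; 10; 31; 2; 9; 14; 33; 2;
  9; 15; 26; 2; 9; 16; 36; 2; 9; 17; 34; 2; 9; 18; 29; 2; 9; 20; 27; 2; 9; 21; 32; 2; 10; 11; 28;
  2; 10; 14; 34; 2; 10; 15; 36; 2; 10; 16; 26; 2; 10; 17; 33; 2; 10; 19; 35; 2; 10; 22; 32; 2; 11;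
  18; 27; 2; 11; 19; 22; 2; 11; 30; 33; 2; 15; 16; 35; 2; 15; 17; 28; 2; 15; 19; 37; 2; 15; 22;
  30; 2; 15; 27; 32; 2; 15; 29; 33; 2; 15; 31; 34; 2; 16; 17; 27; 2; 16; 18; 37; 2; 16; 20; 34; 2;
  16; 28; 32; 2; 17; 21; 22; 2; 18; 19; 33; 2; 18; 21; 28; 2; 18; 31; 35; 2; 19; 20; 28; 2; 19;
  21; 34; 2; 19; 27; 30; 2; 20; 22; 31; 2; 21; 30; 35; 2; 22; 27; 35; 2; 23; 27; 31; 2; 23; 28;
  30; 2; 27; 34; 36; 2; 28; 29; 31; 2; 28; 33; 36; 2; 30; 31; 36; 2; 33; 34; 35; 3; 4; 5; 6; 3; 4;
  9; 10; 3; 4; 15; 16; 3; 4; 18; 32; 3; 4; 19; 35; 3; 4; 20; 36; 3; 4; 22; 30; 3; 4; 29; 37; 3; 4;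
  33; 34; 3; 5; 8; 22; 3; 5; 9; 11; 3; 5; 15; 17; 3; 5; 18; 31; 3; 5; 19; 36; 3; 5; 21; 23; 3; 5;
  28; 37; 3; 5; 30; 32; 3; 5; 33; 35; 3; 6; 7; 34; 3; 6; 8; 19; 3; 6; 10; 17; 3; 6; 11; 20; 3; 6;
  22; 23; 3; 6; 28; 35; 3; 7; 10; 20; 3; 7; 11; 28; 3; 7; 15; 31; 3; 7; 16; 21; 3; 7; 17; 36; 3;
  7; 18; 29; 3; 7; 19; 33; 3; 7; 22; 32; 3; 8; 10; 31; 3; 8; 11; 30; 3; 8; 15; 32; 3; 8; 16; 36;
  3; 8; 18; 28; 3; 8; 20; 33; 3; 8; 21; 35; 3; 8; 23; 34; 3; 9; 16; 22; 3; 9; 17; 23; 3; 9; 28;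
  34; 3; 9; 29; 35; 3; 10; 11; 32; 3; 10; 15; 34; 3; 10; 16; 27; 3; 10; 21; 28; 3; 10; 22; 33; 3;
  10; 23; 37; 3; 11; 15; 35; 3; 11; 16; 19; 3; 11; 17; 27; 3; 11; 22; 37; 3; 11; 23; 33; 3; 16;
  17; 37; 3; 16; 18; 20; 3; 16; 23; 31; 3; 16; 28; 33; 3; 16; 29; 32; 3; 17; 18; 19; 3; 17; 28;
  31; 3; 17; 29; 33; 3; 17; 30; 35; 3; 19; 20; 34; 3; 19; 28; 30; 3; 20; 21; 29; 3; 20; 22; 35; 3;
  21; 22; 31; 3; 28; 32; 36; 3; 29; 31; 36; 3; 30; 31; 34; 3; 31; 32; 35; 3; 34; 35; 37; 4; 5; 8;
  21; 4; 5; 9; 30; 4; 5; 10; 11; 4; 5; 16; 17; 4; 5; 18; 36; 4; 5; 19; 33; 4; 5; 22; 32; 4; 5; 34;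
  35; 4; 6; 9; 20; 4; 6; 16; 30; 4; 6; 17; 36; 4; 6; 18; 34; 4; 6; 19; 32; 4; 6; 21; 29; 4; 7; 8;
  18; 4; 7; 9; 17; 4; 7; 11; 33; 4; 7; 21; 30; 4; 7; 23; 32; 4; 8; 16; 32; 4; 8; 17; 31; 4; 8; 19;
  30; 4; 8; 20; 34; 4; 8; 23; 33; 4; 9; 11; 32; 4; 9; 16; 33; 4; 9; 18; 22; 4; 9; 19; 29; 4; 9;
  21; 34; 4; 9; 23; 37; 4; 10; 17; 23; 4; 10; 29; 35; 4; 11; 16; 35; 4; 11; 17; 28; 4; 11; 20; 22;
  4; 11; 21; 37; 4; 11; 23; 34; 4; 11; 29; 31; 4; 17; 18; 33; 4; 17; 19; 21; 4; 17; 22; 35; 4; 17;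
  29; 34; 4; 18; 19; 20; 4; 18; 21; 31; 4; 20; 21; 35; 4; 20; 23; 31; 4; 29; 30; 36; 4; 30; 32;
  35; 4; 33; 35; 37; 5; 6; 9; 32; 5; 6; 10; 31; 5; 6; 17; 30; 5; 6; 18; 35; 5; 6; 19; 22; 5; 6;
  20; 34; 5; 6; 23; 33; 5; 7; 8; 34; 5; 7; 17; 31; 5; 7; 18; 21; 5; 7; 19; 35; 5; 7; 20; 33; 5; 7;
  22; 30; 5; 8; 9; 18; 5; 8; 10; 33; 5; 8; 30; 31; 5; 9; 17; 33; 5; 9; 20; 31; 5; 9; 21; 35; 5; 9;
  22; 37; 5; 10; 17; 34; 5; 10; 20; 30; 5; 10; 21; 37; 5; 10; 22; 35; 5; 18; 19; 34; 5; 18; 20;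
  22; 5; 19; 20; 21; 5; 22; 23; 31; 5; 31; 32; 34; 5; 33; 34; 37; 6; 7; 9; 35; 6; 7; 11; 32; 6; 7;
  18; 19; 6; 7; 23; 37; 6; 8; 9; 34; 6; 8; 18; 20; 6; 8; 22; 37; 6; 8; 23; 31; 6; 8; 33; 35; 6;
  10; 11; 36; 6; 10; 18; 22; 6; 10; 20; 37; 6; 10; 21; 23; 6; 10; 32; 35; 6; 11; 18; 23; 6; 11;
  19; 37; 6; 11; 21; 22; 6; 11; 31; 34; 6; 19; 20; 35; 6; 21; 34; 35; 6; 22; 31; 33; 6; 22; 35;
  36; 6; 23; 34; 36; 6; 31; 35; 37; 6; 32; 34; 37; 7; 8; 19; 20; 7; 8; 21; 37; 7; 9; 10; 32; 7; 9;
  11; 36; 7; 9; 19; 21; 7; 9; 20; 37; 7; 11; 19; 23; 7; 11; 20; 34; 7; 20; 21; 23; 7; 21; 35; 36;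
  7; 23; 33; 36; 7; 32; 33; 37; 8; 9; 10; 36; 8; 9; 20; 21; 8; 10; 20; 22; 8; 21; 34; 36; 8; 22;
  33; 36; 9; 10; 21; 22; 9; 11; 21; 23; 10; 11; 22; 23].
Definition c654_base : seq nat :=
  [:: 0; 2; 7; 9; 0; 2; 12; 20; 0; 5; 12; 18; 0; 2; 24; 27; 0; 2; 8; 15; 0; 2; 5; 17; 0; 5; 11;
  24; 0; 3; 21; 25; 0; 6; 12; 21; 0; 3; 7; 10; 0; 2; 18; 21; 0; 4; 11; 20; 0; 5; 16; 23; 0; 2; 11;
  22; 0; 5; 13; 21; 0; 2; 10; 16; 0; 1; 6; 10; 0; 1; 8; 21; 0; 1; 5; 19; 0; 1; 9; 25; 0; 1; 12;
  15; 0; 1; 11; 28; 0; 1; 7; 17; 0; 1; 18; 26; 0; 1; 2; 4; 0; 1; 14; 27; 0; 3; 20; 24; 0; 1; 16;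
  20; 0; 4; 8; 23; 0; 2; 14; 32; 0; 3; 22; 32; 0; 1; 24; 32; 0; 4; 21; 32; 0; 1; 22; 30; 0; 3; 16;
  30; 0; 7; 18; 30; 0; 2; 26; 30; 0; 1; 23; 31; 0; 2; 19; 31; 0; 3; 9; 31; 0; 4; 16; 31; 0; 1; 13;
  33; 0; 3; 11; 33; 0; 7; 21; 33; 0; 2; 6; 33].
Definition c650_base : seq nat :=
  [:: 0; 1; 16; 23; 0; 1; 15; 17; 0; 6; 15; 23; 0; 1; 8; 22; 0; 1; 7; 9; 0; 1; 10; 24; 0; 1; 13;
  21; 0; 4; 10; 16; 0; 2; 6; 14; 0; 2; 18; 26; 0; 2; 4; 19; 0; 1; 12; 18; 0; 1; 2; 20; 0; 4; 11;
  24; 0; 2; 11; 22; 0; 3; 15; 24; 0; 3; 12; 16; 0; 1; 3; 11; 0; 3; 7; 18; 0; 3; 13; 26; 0; 3; 10;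
  14; 0; 2; 9; 12; 0; 3; 17; 22; 0; 2; 8; 13; 0; 1; 6; 27; 0; 2; 7; 25; 0; 5; 11; 18; 0; 4; 14;
  25; 0; 3; 8; 20; 0; 1; 4; 26; 0; 1; 5; 14; 0; 1; 25; 28; 0; 2; 5; 21].
Definition h63_base : seq nat :=
  [:: 0; 3; 4; 7; 0; 1; 2; 9; 0; 5; 7; 15; 0; 4; 11; 13; 0; 2; 7; 11; 0; 1; 3; 16; 0; 2; 4; 15; 0;
  1; 11; 15; 0; 3; 8; 11; 0; 1; 8; 17; 0; 1; 4; 14; 0; 1; 5; 10; 0; 4; 9; 17; 0; 13; 15; 17; 0; 2;
  10; 17].
Definition c634_shifts : seq (seq nat) :=
  [:: [:: 0; 0; 0]; [:: 0; 3; 3]; [:: 1; 1; 4]; [:: 1; 4; 1]; [:: 2; 2; 2]; [:: 2; 5; 5]; [:: 3;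
  0; 3]; [:: 3; 3; 0]; [:: 4; 1; 1]; [:: 4; 4; 4]; [:: 5; 2; 5]; [:: 5; 5; 2]].
Definition c1232_shifts : seq (seq nat) :=
  [:: [:: 0; 0; 0]; [:: 4; 4; 4]; [:: 8; 8; 8]].

(** Numbers from [n] on are stem points, which the translations fix. *)
Definition cyc (n st cnt : nat) : seq (nat -> nat) :=
  [seq (fun x => if x < n then (x + k * st) %% n else x) | k <- iota 0 cnt].
(** The number a m + i is the element a of group i; a vector of [ts] translates every group by its
    own entry. *)
Definition tau (m w : nat) (ts : seq (seq nat)) : seq (nat -> nat) :=
  [seq (fun x => if x < m * w then (x %/ m + nth 0 t (x %% m)) %% w * m + x %% m else x) | t <- ts].
Definition sepn (m : nat) (tab : seq nat) (x y : nat) : bool :=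
  let a := nth m tab x in let b := nth m tab y in [&& a != m, b != m & a != b].
(** [tab] holds the group of every point, computed once for the whole check; stem points lie beyond
    its end and obtain the default value [m]. *)
Definition cqs_hole (m n : nat) : seq nat -> bool :=
  let tab := mkseq (modn^~ m) n in fun t => ~~ has (fun x => has (sepn m tab x) t) t.

Lemma has_design_bij' (A B : Type) (g : B -> A) (D : A -> A -> A -> Prop) (D' : B -> B -> B -> Prop) :
  bijective g -> (forall x y z, D (g x) (g y) (g z) <-> D' x y z) -> has_design D -> has_design D'.
Proof.
case=> f gK fK e; apply: (has_design_bij (f := f)); first by exists g.
by move=> x y z; rewrite -e !fK.
Qed.

Lemma radix_inj m (i i' : 'I_m) (a a' : nat) : a * m + i = a' * m + i' -> i = i' /\ a = a'.
Proof.
move=> e; have m0 : 0 < m by apply: leq_ltn_trans (ltn_ord i).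
have e1 : val i = val i' by have := congr1 (modn^~ m) e; rewrite !modnMDl !modn_small.
split; first exact: val_inj.
by have := congr1 (divn^~ m) e; rewrite !divnMDl // !divn_small // !addn0.
Qed.

Lemma radix_lt m w (i : 'I_m) (a : 'I_w) : a * m + i < m * w.
Proof.
apply: (@leq_trans (a.+1 * m)); first by rewrite mulSn addnC ltn_add2r.
by rewrite mulnC leq_mul2l ltn_ord orbT.
Qed.

Lemma cqs_check s m w bs : check_design (m * w + s) (cqs_hole m (m * w)) bs -> cqs 'I_s 'I_m 'I_w.
Proof.
move=> ck; pose gn (x : 'I_s + 'I_m * 'I_w) := match x with
  | inl j => m * w + j | inr q => q.2 * m + q.1 end.
have glt x : gn x < m * w + s.
  by case: x => [j|[i a]] /=; rewrite ?ltn_add2l //; apply: ltn_addr; apply: radix_lt.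
pose g x := Ordinal (glt x).
have gI : injective g.
  move=> [j|[i a]] [j'|[i' a']] /(congr1 val) /=.
  - by move/addnI => e; congr inl; apply: val_inj.
  - by move=> e; have := radix_lt i' a'; rewrite -e; lia.
  - by move=> e; have := radix_lt i a; rewrite e; lia.
  by case/radix_inj => -> /val_inj ->.
have gB : bijective g by apply: inj_card_bij gI _; rewrite card_sum card_prod !card_ord addnC.
apply: (has_design_bij' gB _ (check_designP _ ck)) => [x y z|t t' pt]; last first.
  rewrite /cqs_hole; congr negb; rewrite (perm_has _ pt); apply: eq_has => x; exact: perm_has.
have lab v : nth m (mkseq (modn^~ m) (m * w)) (gn v) = if v is inr q then val q.1 else m.
  case: v => [j|[i a]] /=; first by rewrite nth_default // size_mkseq leq_addr.
  by rewrite nth_mkseq ?radix_lt // modnMDl modn_small.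
have sE v v' : sepn m (mkseq (modn^~ m) (m * w)) (gn v) (gn v') = sep v v'.
  rewrite /sepn !lab; case: v v' => [j|[i a]] [j'|[i' a']] /=; rewrite ?eqxx ?andbF //.
  by rewrite !neq_ltn !ltn_ord -neq_ltn.
have sxx v : sep v v = false by case: v => [j|[i a]] //=; rewrite eqxx.
rewrite /cqs_dom /distinct3 !(inj_eq gI) /cqs_hole negbK /=.
rewrite !sE !sxx (sepC y x) (sepC z x) (sepC z y) /=.
by case: (sep x y); case: (sep x z); case: (sep y z).
Qed.

Lemma sqs_check N bs : check_design N pred0 bs -> sqs 'I_N.
Proof.
move=> ck; apply: has_design_eq (check_designP _ ck) => // x y z.
by rewrite andbT.
Qed.

Definition h_hole (t : seq nat) : bool := ~~ uniq (map (modn^~ 6) t).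

Lemma h_check w bs : check_design (6 * w) h_hole bs ->
  has_design (fun x y z : 'I_6 * 'I_w => distinct3 x.1 y.1 z.1).
Proof.
move=> ck; pose g (x : 'I_6 * 'I_w) : 'I_(6 * w) := Ordinal (radix_lt x.1 x.2).
have gI : injective g by move=> [i a] [i' a'] /(congr1 val) /= /radix_inj [-> /val_inj ->].
have gB : bijective g by apply: inj_card_bij gI _; rewrite card_prod !card_ord.
apply: (has_design_bij' gB _ (check_designP _ ck)) => [x y z|t t' pt]; last first.
  by rewrite /h_hole (perm_uniq (perm_map _ pt)).
rewrite /h_hole negbK /= !modnMDl !modn_small ?(leq_trans (ltn_ord _)) // !inE !andbT negb_or.
rewrite /distinct3 !(inj_eq gI) -!(inj_eq val_inj) /=.
case: x y z => [i a] [j b] [k c] /=; rewrite !xpair_eqE -!(inj_eq val_inj) /=.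
case: (val i == j); case: (val i == k); case: (val j == k); rewrite /= ?andbF ?andbT //.
Qed.

Lemma sqs4 : sqs 'I_4. Proof. by apply: (@sqs_check _ [:: [:: 0; 1; 2; 3]]); vm_compute. Qed.
Lemma sqs14 : sqs 'I_14.
Proof. by apply: (@sqs_check _ (orbits (cyc 14 2 7) sqs14_base)); vm_compute. Qed.
Lemma cqs630 : cqs 'I_0 'I_3 'I_6.
Proof. by apply: (@cqs_check _ _ _ (orbits (cyc 18 1 18) c630_base)); vm_compute. Qed.
Lemma cqs650 : cqs 'I_0 'I_5 'I_6.
Proof. by apply: (@cqs_check _ _ _ (orbits (cyc 30 1 30) c650_base)); vm_compute. Qed.
Lemma cqs654 : cqs 'I_4 'I_5 'I_6.
Proof. by apply: (@cqs_check _ _ _ (orbits (cyc 30 1 30) c654_base)); vm_compute. Qed.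
Lemma cqs634 : cqs 'I_4 'I_3 'I_6.
Proof. by apply: (@cqs_check _ _ _ (orbits (tau 3 6 c634_shifts) c634_base)); vm_compute. Qed.
Lemma cqs1232 : cqs 'I_2 'I_3 'I_12.
Proof. by apply: (@cqs_check _ _ _ (orbits (tau 3 12 c1232_shifts) c1232_base)); vm_compute. Qed.
Lemma h63 : has_design (fun x y z : 'I_6 * 'I_3 => distinct3 x.1 y.1 z.1).
Proof. by apply: (@h_check _ (orbits (cyc 18 2 9) h63_base)); vm_compute. Qed.

(* The permutation moves the block {0, 1, 2, 6} of SQS(10) to the first four points. *)
Lemma nonstem46 : has_design (fun x y z : 'I_4 + 'I_6 => nonstem x y z).
Proof.
pose pi x := nth 0 [:: 0; 1; 2; 4; 5; 6; 3; 7; 8; 9] x.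
have ck : check_design 10 (all (ltn^~ 4))
    (rem [:: 0; 1; 2; 3] (orbits [seq pi \o f | f <- cyc 10 1 10] sqs10_base)) by vm_compute.
have gB : bijective (@unsplit 4 6) by exists (@split 4 6); [exact: unsplitK|exact: splitK].
apply: (has_design_bij' gB _ (check_designP _ ck)) => [x y z|t t' pt]; last exact: perm_all.
rewrite /nonstem /distinct3 !(inj_eq (bij_inj gB)) /=.
have lt v : (val (@unsplit 4 6 v) < 4) = if v is inl _ then true else false.
  by case: v => j /=; rewrite ?ltn_ord // ltnNge leq_addr.
by rewrite !lt; case: x y z => [j|i] [j'|i'] [j''|i''].
Qed.

(** * Existence of Steiner quadruple systems *)

Lemma weight_design (A : Type) (U : zmodType) (D : A -> A -> A -> Prop) R : design D R ->
  design (fun x y z : A * U => D x.1 y.1 z.1)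
    (fun x y z w : A * U => R x.1 y.1 z.1 w.1 /\ (x.2 + y.2 + z.2 + w.2 = 0)%R).
Proof.
move=> [s1 s2 s3 sd sx su]; split.
- by move=> x y z w [/s1 h e]; split; rewrite // [(y.2 + x.2)%R]addrC.
- by move=> x y z w [/s2 h e]; split; rewrite // [(x.2 + z.2 + y.2)%R]addrAC.
- by move=> x y z w [/s3 h e]; split; rewrite // addrAC.
- by move=> x y z w [/sd].
- by move=> x y z /sx [w h]; exists (w, - (x.2 + y.2 + z.2))%R; rewrite /= subrr.
move=> x y z w w' [h e] [h' e']; have e2 : w.2 = w'.2 by move: e; rewrite -e' => /addrI.
by rewrite (surjective_pairing w) (surjective_pairing w') e2 (su _ _ _ _ _ h h').
Qed.

(** Weights in Z/2 enlarge the groups of [h63] from three points to six. *)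
Lemma h66 : has_design (fun x y z : 'I_6 * 'I_6 => distinct3 x.1 y.1 z.1).
Proof.
have [R dR] := h63; have [f bf] : exists f : 'I_3 * 'I_2 -> 'I_6, bijective f.
  by apply: card_bij; rewrite card_prod !card_ord.
have [f' fK f'K] := bf.
pose g (x : ('I_6 * 'I_3) * 'I_2) : 'I_6 * 'I_6 := (x.1.1, f (x.1.2, x.2)).
have gB : bijective g.
  exists (fun y => ((y.1, (f' y.2).1), (f' y.2).2)) => [[[i a] b]|[i a]]; rewrite /g /= ?fK //.
  by rewrite -surjective_pairing f'K.
exact: (has_design_bij gB _ (ex_intro _ _ (weight_design _ dR))).
Qed.

Definition gdom (G W : eqType) (x y z : G * W) : bool :=
  distinct3 x y z && ~~ ((x.1 == y.1) && (x.1 == z.1)).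
Definition gdes (G W : eqType) := has_design (fun x y z : G * W => gdom x y z).

Lemma gdom_sep (S G W : eqType) (x y z : G * W) :
  cqs_dom (inr x : S + G * W) (inr y) (inr z) = gdom x y z.
Proof.
rewrite /cqs_dom /gdom /distinct3 !(inj_eq (@inr_inj _ _)) /=; congr (_ && _).
by have [<-|] := eqVneq x.1 y.1; rewrite //= ?orbb.
Qed.

Lemma inr_bij (A : Type) : bijective (inr : A -> 'I_0 + A).
Proof.
have no (i : 'I_0) : False by case: i.
by exists (fun x => match x with inl i => match no i with end | inr a => a end) => [|[i|]] //; case: (no i).
Qed.

Lemma gdes_cqs (G W : eqType) : gdes G W <-> cqs 'I_0 G W.
Proof.
split; first by apply: (has_design_bij (@inr_bij _)) => x y z; rewrite gdom_sep.
by apply: (has_design_bij' (@inr_bij _)) => x y z; rewrite gdom_sep.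
Qed.

Lemma gdes_double (G : finType) : gdes G 'I_6 -> gdes (bool * G)%type 'I_6.
Proof.
case=> RU dU; have [|K [c fc]] := @onefact_even (G * 'I_6)%type.
  by rewrite card_prod card_ord; lia.
have dH : design (fun x y z : bool * (G * 'I_6) => distinct3 x.1 y.1 z.1) (fun _ _ _ _ => False).
  apply: design_eq (@design_none _) => -[[] a] [[] b] [[] d]; rewrite /distinct3 /=; by split.
pose g (x : bool * (G * 'I_6)) : (bool * G) * 'I_6 := ((x.1, x.2.1), x.2.2).
have gB : bijective g by exists (fun y => (y.1.1, (y.1.2, y.2))) => [[l [i a]]|[[l i] a]].
apply: (has_design_bij gB _ (ex_intro _ _ (asm_design fc dU dH))) => -[l [i a]] [l' [j b]] [l'' [k d]].
rewrite asm_domE /gdom /distinct3 /g /= !xpair_eqE.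
by case: l l' l'' => [] [] []; rewrite /= ?andbF ?andbT.
Qed.

Lemma gdes_card (G G' : finType) : #|G| = #|G'| -> gdes G 'I_6 -> gdes G' 'I_6.
Proof. by move=> e /gdes_cqs h; apply/gdes_cqs; apply: cqs_card h. Qed.

Lemma gdes1 (G W : finType) : #|G| = 1 -> gdes G W.
Proof.
move=> /fintype1 [g hg]; exists (fun _ _ _ _ => False); apply: design_eq (@design_none _).
by move=> x y z; rewrite /gdom (hg x.1) (hg y.1) (hg z.1) eqxx andbF.
Qed.

(** A quadruple system is a G-design whose classes are single points. No two groups share a class
    then, and the fillings inside the classes are empty. *)
Lemma cqs_fan (S : finType) m w : sqs 'I_m.+1 -> cqs S 'I_3 'I_w.+1 -> cqs S 'I_m 'I_w.+1.
Proof.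
move=> hs h3; have : sqs (option 'I_m) by apply: sqs_card hs; rewrite card_option !card_ord.
case=> R0 d0; have d0' : design (fun x y z => class_dom (fun x : option 'I_m => x) x y z) R0.
  apply: design_eq d0 => x y z; rewrite /class_dom /distinct3.
  by case: (x == y) => //=; rewrite andbT.
apply: (fan_cqs d0' h3).
  exists (fun _ _ _ _ => False); apply: design_eq (@design_none _) => x y z.
  by split => //; rewrite /fan_dom5 /cqs_dom; case: x y z => [?|?] [?|?] [?|?] //=; rewrite ?andbF.
exists (fun _ _ _ _ => False); apply: design_eq (@design_none _) => x y z.
split=> //; rewrite /fan_dom6; case: x y z => [?|[i a]] [?|[j b]] [?|[k c]] //=; rewrite ?andbF //.
by case/and3P => /and3P [n /eqP [e]]; rewrite e eqxx in n.
Qed.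

Section GFan.
Variables (S : finType) (n m w : nat).
Hypothesis nm : 6 * n = m.+2.
Local Notation W := 'I_w.+1.
Hypothesis hG : gdes 'I_n 'I_6.
Hypothesis h3 : cqs S 'I_3 W.
Hypothesis h5 : cqs S 'I_5 W.
Hypothesis h6 : has_design (fun x y z : 'I_6 * W => distinct3 x.1 y.1 z.1).

(** The fan is a G-design on 6n = m + 2 points. Removing one point leaves five groups in its class
    and six in each other class, as [h5] and [h6] expect. *)
Lemma cqs_gfan : cqs S 'I_m.+1 W.
Proof.
have [f bf] : exists f : option 'I_m.+1 -> 'I_n * 'I_6, bijective f.
  by apply: card_bij; rewrite card_option card_prod !card_ord -nm mulnC.
have [g fK gK] := bf; have fI := can_inj fK.
pose cl x := (f x).1.
have [R0 d0] : has_design (fun x y z => class_dom cl x y z).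
  apply: (has_design_bij' bf _ hG) => x y z.
  by rewrite /gdom /class_dom /distinct3 !(inj_eq fI).
pose k0 := (f None).1; pose j0 := (f None).2.
(* The default [ord0] would be returned only at the removed point, whose position [j0] is skipped by
   [lift]. *)
pose e5 (j : 'I_5) : 'I_m.+1 := odflt ord0 (g (k0, lift j0 j)).
have e5E j : f (Some (e5 j)) = (k0, lift j0 j).
  rewrite /e5; case e : (g _) => [i|] /=; first by rewrite -e gK.
  by have := congr1 f e; rewrite gK [f None]surjective_pairing => -[] /eqP; rewrite lift_eqF.
have e5I : injective e5.
  by move=> j j' e; have := e5E j; rewrite e e5E => /(congr1 snd) /lift_inj ->.
pose e6 (k : {k : 'I_n | k != k0}) (j : 'I_6) : 'I_m.+1 := odflt ord0 (g (val k, j)).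
have e6E k j : f (Some (e6 k j)) = (val k, j).
  rewrite /e6; case e : (g _) => [i|] /=; first by rewrite -e gK.
  have h1 := congr1 f e; rewrite gK in h1.
  have h : val k = k0 := congr1 fst h1.
  by have := valP k; rewrite h eqxx.
apply: (fan_cqs d0 h3).
- have [R5 d5] := h5.
  pose em (x : S + 'I_5 * W) : S + 'I_m.+1 * W :=
    match x with inl s => inl s | inr q => inr (e5 q.1, q.2) end.
  have emI : injective em by move=> [s|[j a]] [s'|[j' a']] //= [] => [->|/e5I -> ->].
  have emD x y z : cqs_dom (em x) (em y) (em z) = cqs_dom x y z.
    rewrite /cqs_dom /distinct3 !(inj_eq emI); congr (_ && _).
    have sE u v : sep (em u) (em v) = sep u v.
      by case: u v => [s|[j a]] [s'|[j' a']] //=; rewrite (inj_eq e5I).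
    by rewrite !sE.
  have emA x : at_inf cl (em x) by case: x => [s|[j a]] //=; rewrite /cl e5E.
  have emS (x : S + 'I_m.+1 * W) : at_inf cl x -> exists a, x = em a.
    case: x => [s|[i a]] /=; first by exists (inl s).
    move/eqP => e; have : (f (Some i)).2 != j0.
      apply: contraTneq isT => e2; have /fI // : f (Some i) = f None.
      by rewrite [LHS]surjective_pairing [RHS]surjective_pairing -/(cl (Some i)) e e2.
    rewrite eq_sym => /unlift_some [j ej _]; exists (inr (j, a)) => /=; congr (inr (_, _)).
    by apply: Some_inj; apply: fI; rewrite e5E [LHS]surjective_pairing ej -/(cl (Some i)) e.
  eexists; apply: design_eq (design_map emI d5) => x y z; split.
    by case=> a [b [c [-> -> -> h]]]; rewrite /fan_dom5 emD h !emA.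
  case/and4P => h /emS [a ea] /emS [b eb] /emS [c ec]; exists a, b, c; split=> //.
  by rewrite -emD -ea -eb -ec.
pose em (k : {k : 'I_n | k != k0}) (x : 'I_6 * W) : S + 'I_m.+1 * W := inr (e6 k x.1, x.2).
have emI k : injective (em k).
  move=> [j a] [j' a'] [e ->]; have := e6E k j; rewrite /= in e; rewrite e e6E.
  by case=> ->.
have emk k k' x x' : em k x = em k' x' -> k = k'.
  case: x x' => [j a] [j' a'] [e _]; have := e6E k j; rewrite /= in e; rewrite e e6E.
  by case=> h _; apply: val_inj.
have ag k k' a b c a' b' c' : distinct3 (a : 'I_6 * W).1 b.1 c.1 -> distinct3 (a' : 'I_6 * W).1 b'.1 c'.1 ->
    em k a = em k' a' -> em k b = em k' b' -> em k c = em k' c' -> em k =1 em k'.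
  by move=> _ _ /emk -> .
apply: has_design_eq (has_design_bigmap emI ag h6) => x y z; split.
  case=> k [[j a] [[j' b] [[j'' c] [-> -> -> /and3P [/= d1 d2 d3]]]]].
  rewrite /fan_dom6 /= /cl !e6E /= !eqxx (valP k) !andbT.
  have ne i i' : i != i' -> e6 k i != e6 k i'.
    by apply: contra_neq => e; have := e6E k i; rewrite e e6E => -[].
  by rewrite !ne.
case: x y z => [//|[i a]] [s|[i' b]] [s'|[i'' c]]; rewrite /fan_dom6 /= ?andbF //.
case/and3P => /and3P [n1 /eqP c1 k1] /and3P [n2 /eqP c2 _] /and3P [n3 _ _].
pose k : {k : 'I_n | k != k0} := exist _ (cl (Some i)) k1.
have eE i0 : cl (Some i0) = cl (Some i) -> i0 = e6 k (f (Some i0)).2.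
  move=> e; apply: Some_inj; apply: fI; rewrite e6E /= [LHS]surjective_pairing.
  by rewrite -/(cl (Some i0)) e.
exists k, ((f (Some i)).2, a), ((f (Some i')).2, b), ((f (Some i'')).2, c).
rewrite /em /= -!eE //; split=> //.
have ne i0 i1 : cl (Some i0) = cl (Some i1) -> i0 != i1 -> (f (Some i0)).2 != (f (Some i1)).2.
  move=> ec; apply: contra_neq => e2; apply: Some_inj; apply: fI.
  by rewrite [LHS]surjective_pairing [RHS]surjective_pairing e2 -!/(cl (Some _)) ec.
by rewrite /distinct3 /= !ne // -c1 -c2.
Qed.
End GFan.

Lemma sqs_fill4 m : cqs 'I_4 'I_m 'I_6 -> sqs 'I_(6 * m + 4).
Proof.
move=> h; apply: sqs_card (cqs_fill h nonstem46 sqs4).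
by rewrite card_sum card_prod !card_ord; lia.
Qed.

Lemma sqs_fan12 m : sqs 'I_m.+1 -> sqs 'I_(12 * m + 2).
Proof.
move=> h; have hc : cqs bool 'I_m 'I_12.
  by apply: (@cqs_card 'I_2 _ _ _ _ _ _ erefl erefl (cqs_fan h cqs1232)); rewrite card_ord card_bool.
have : sqs (bool + 'I_12)%type by apply: sqs_card sqs14; rewrite card_sum card_bool !card_ord.
by move/(sqs_cqs2 hc); apply: sqs_card; rewrite card_sum card_prod card_bool !card_ord; lia.
Qed.

(** The two statements need each other: orders 70 mod 72 use a G-design as fan, and G-designs with m
    = 1, 3 mod 6 groups use a quadruple system of order m + 1. Doubling gives the orders 4, 8 mod 12
    and quadrupling 2, 10 mod 24. Of the other residues mod 72, tripling gives 62, groups of size 12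
    give 14 and 38, and groups of size 6 with four stem points give 22, 46 and 70. *)
Lemma sqs_gdes N :
  (forall v, v <= N -> v %% 6 \in [:: 2; 4] -> sqs 'I_v) /\
  (forall m, 0 < m -> 6 * m <= N -> gdes 'I_m 'I_6).
Proof.
elim/ltn_ind: N => N IH; split=> [v lv|m m0 lm].
  case: (ltnP v N) => [l|l vm]; first by apply: (IH v l).1.
  have ev : v = N by lia.
  subst v; clear l lv.
  have IS v : v < N -> v %% 6 \in [:: 2; 4] -> sqs 'I_v by move=> l; apply: (IH v l).1.
  have IG m : 0 < m -> 6 * m < N -> gdes 'I_m 'I_6 by move=> m0 l; apply: (IH _ l).2.
  have cN a : a = N -> sqs 'I_a -> sqs 'I_N by move=> ->.
  move: vm; rewrite !inE => vm.
  have [e2|n2] := eqVneq N 2; first by rewrite e2; apply: sqs_card sqs_bool; rewrite card_bool card_ord.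
  case h12: (N %% 12 \in [:: 4; 8]).
    have hh : sqs 'I_N./2 by apply: IS; move: h12; rewrite !inE; lia.
    have : sqs (bool * 'I_N./2)%type by apply: sqs_double => //; rewrite card_ord; move: h12; rewrite !inE; lia.
    by apply: sqs_card; rewrite card_prod card_bool !card_ord; move: h12; rewrite !inE; lia.
  rewrite !inE in h12.
  case h24: (N %% 24 \in [:: 2; 10]).
    rewrite !inE in h24; pose k := (N - 10) %/ 8.
    have ek : N = 4 * k.*2.+2 + 2 by rewrite /k; lia.
    by apply: cN (sqs_quad (k := k) _); [lia|apply: IS; rewrite ?inE; lia].
  rewrite !inE in h24.
  have h72 : [|| N %% 72 == 14, N %% 72 == 38, N %% 72 == 62, N %% 72 == 22, N %% 72 == 46 | N %% 72 == 70] by lia.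
  (* Groups of size 12 fail here: the fan would have order 6t + 6, for which there is no quadruple
     system. *)
  case h62: (N %% 72 == 62).
    pose t := N %/ 72; have et : 72 * t + 62 = N by rewrite /t; lia.
    by apply: (cN _ et); apply: sqs_triple; apply: IS; rewrite ?inE; lia.
  case h14: (N %% 72 \in [:: 14; 38]).
    rewrite !inE in h14; pose m := (N - 2) %/ 12; have em : 12 * m + 2 = N by rewrite /m; lia.
    by apply: (cN _ em); apply: sqs_fan12; apply: IS; rewrite ?inE; lia.
  rewrite !inE in h14; pose m := (N - 4) %/ 6; have em : 6 * m + 4 = N by rewrite /m; lia.
  apply: (cN _ em); apply: sqs_fill4.
  case h70: (N %% 72 == 70).
    (* The order m + 1 = 12(k + 1) admits no quadruple system, so a G-design with 2k + 2 groups
       serves as fan. *)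
    have [k ek] : exists k, m = 12 * k + 11 by exists (N %/ 72); lia.
    rewrite ek addnS; apply: (@cqs_gfan _ (2 * k + 2) _ _ _ _ cqs634 cqs654 h66); first lia.
    by apply: IG; lia.
  by apply: cqs_fan cqs634; apply: IS; rewrite ?inE; lia.
case: (ltnP (6 * m) N) => [l|l]; first by apply: (IH _ l).2.
have IS v : v < N -> v %% 6 \in [:: 2; 4] -> sqs 'I_v by move=> l'; apply: (IH v l').1.
have IG m' : 0 < m' -> 6 * m' < N -> gdes 'I_m' 'I_6 by move=> m0' l'; apply: (IH _ l').2.
have [e1|n1] := eqVneq m 1; first by apply: gdes1; rewrite card_ord.
case ev: (odd m); last first.
  apply: (@gdes_card (bool * 'I_m./2)%type); first by rewrite card_prod card_bool !card_ord; lia.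
  by apply: gdes_double; apply: IG; lia.
apply/gdes_cqs; case h5: (m %% 6 == 5).
  have [k ek] : exists k, m = k.+1 by exists m.-1; lia.
  rewrite ek; apply: (@cqs_gfan _ (m.+1 %/ 6) _ _ _ _ cqs630 cqs650 h66); first lia.
  by apply: IG; lia.
by apply: cqs_fan cqs630; apply: IS; rewrite ?inE; lia.
Qed.

Lemma sqs_exists v : v %% 6 \in [:: 2; 4] -> sqs 'I_v.
Proof. exact: (sqs_gdes v).1. Qed.
Lemma gdes_exists m : 0 < m -> gdes 'I_m 'I_6.
Proof. by move=> h; apply: (sqs_gdes (6 * m)).2. Qed.

(** * Codes from invariant designs *)

Lemma design_front (T : eqType) (D : T -> T -> T -> Prop) R a b c d x : design D R -> R a b c d ->
  x \in [:: a; b; c; d] -> exists b' c' d', R x b' c' d' /\ perm_eq [:: a; b; c; d] [:: x; b'; c'; d'].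
Proof.
move=> dR h; rewrite !inE => /or4P [] /eqP ->.
- by exists b, c, d.
- by exists a, c, d; split; [apply: design12 dR _ _ _ _ h|apply: perm4_12].
- exists a, b, d; split; first by apply: (design12 dR); apply: (design23 dR).
  by apply/permP => f /=; lia.
exists a, b, c; split; first by apply: (design12 dR); apply: (design23 dR); apply: (design34 dR).
by apply/permP => f /=; lia.
Qed.

Lemma design_perm (T : eqType) (D : T -> T -> T -> Prop) R a b c d x y z w : design D R -> R a b c d ->
  perm_eq [:: a; b; c; d] [:: x; y; z; w] -> R x y z w.
Proof.
move=> dR h pe.
have [b1 [c1 [d1 [h1 p1]]]] : exists b' c' d', R x b' c' d' /\ perm_eq [:: a; b; c; d] [:: x; b'; c'; d'].
  by apply: design_front dR h _; rewrite (perm_mem pe) inE eqxx.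
have := perm_trans (etrans (perm_sym _ _) p1) pe; rewrite perm_cons => pe1.
have [c2 [d2 [h2 p2]]] : exists c' d', R x y c' d' /\ perm_eq [:: b1; c1; d1] [:: y; c'; d'].
  have : y \in [:: b1; c1; d1] by rewrite (perm_mem pe1) inE eqxx.
  rewrite !inE => /or3P [] /eqP ->.
  - by exists c1, d1.
  - by exists b1, d1; split; [apply: (design23 dR)|apply/permP => f /=; lia].
  by exists b1, c1; split; [apply: (design23 dR); apply: (design34 dR)|apply/permP => f /=; lia].
have := perm_trans (etrans (perm_sym _ _) p2) pe1; rewrite perm_cons => pe2.
have : z \in [:: c2; d2] by rewrite (perm_mem pe2) inE eqxx.
rewrite !inE => /orP [] /eqP e; subst z; move: pe2.
  rewrite perm_cons => /perm_mem /(_ d2); rewrite !inE eqxx => /esym /eqP <-; exact: h2.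
have : perm_eq [:: c2; d2] [:: d2; c2] by apply/permP => f /=; lia.
rewrite perm_sym => pc pe3; have := perm_trans pc pe3.
rewrite perm_cons => /perm_mem /(_ c2); rewrite !inE eqxx => /esym /eqP <-.
exact: (design34 dR).
Qed.

Lemma sum_pred (I : finType) (P : pred I) : \sum_(q : I) (P q : nat) = #|P|.
Proof. by rewrite -sum1_card [RHS]big_mkcond /=; apply: eq_bigr => q _; rewrite unfold_in; case: (P q). Qed.

Section OOC.
Variables (p u : nat).
Hypotheses (pp : prime p) (p4 : 4 < p).
Local Notation F := 'F_p.
Local Notation T := (F * 'I_u)%type.
Variables (D : T -> T -> T -> bool) (R : T -> T -> T -> T -> Prop) (M : nat).
Hypothesis dR : design (fun x y z => D x y z) R.
Definition shift (t : F) (x : T) : T := ((x.1 + t)%R, x.2).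
Hypothesis inv : forall t x y z w, R x y z w -> R (shift t x) (shift t y) (shift t z) (shift t w).
Hypothesis dist : forall x y z, D x y z -> distinct3 x y z.
Hypothesis cM : forall i, #|[set q : T * T | D (0%R, i) q.1 q.2]| = M.

Let four : (4%:R != 0 :> F)%R.
Proof. by have := val_Fp_nat pp 4; rewrite modn_small // => e; apply/eqP => z; move: e; rewrite z. Qed.

Let shiftK t : cancel (shift t) (shift (- t)%R).
Proof. by case=> a i; rewrite /shift /= addrK. Qed.
Let shiftNK t : cancel (shift (- t)%R) (shift t).
Proof. by case=> a i; rewrite /shift /= subrK. Qed.
Let shift_inj t : injective (shift t) := can_inj (@shiftK t).

Let ph (q : 'I_u * 'I_p) : T := ((val q.2)%:R%R, q.1).
Let ph_bij : bijective ph.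
Proof.
apply: inj_card_bij; last by rewrite !card_prod card_Fp // !card_ord mulnC.
move=> [i j] [i' j'] [e ->]; congr (_, _); apply: val_inj.
by have := congr1 val e; rewrite /= !val_Fp_nat // !modn_small.
Qed.
Let ph_shift i (j : 'I_p) r : ph (i, colshift j r) = shift (r%:R)%R (ph (i, j)).
Proof. by rewrite /ph /shift /= Fp_nat_mod // natrD. Qed.

Let mxof (B : {set T}) : 'M[bool]_(u, p) := \matrix_(i < u, j < p) (ph (i, j) \in B).

Let mxof_inj : injective mxof.
Proof.
move=> B B' e; have [g gK Kg] := ph_bij; apply/setP => x; rewrite -(Kg x).
by case: (g x) => i j; move/matrixP/(_ i j): e; rewrite !mxE.
Qed.

Let Ru x y z w : R x y z w -> uniq [:: x; y; z; w].
Proof.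
move=> h; have /and3P [h1 h2 h3] := dist (design_dom dR h).
have /and3P [_ h4 h5] := dist (design_dom dR (design34 dR h)).
have /and3P [_ _ h6] := dist (design_dom dR (design34 dR (design23 dR h))).
by rewrite /= !inE !negb_or h1 h2 h3 h4 h5 h6.
Qed.

(** The code has to be a finite set while [R] is an arbitrary relation, hence the classical
    decision. *)
Let Rb x y z w : bool := if excluded_middle_informative (R x y z w) then true else false.
Let RbP x y z w : reflect (R x y z w) (Rb x y z w).
Proof. by rewrite /Rb; case: excluded_middle_informative => h; constructor. Qed.

Let sum4 (x y z w : T) : F := (x.1 + y.1 + z.1 + w.1)%R.
Let blk (x y z w : T) : {set T} := [set v | v \in [:: x; y; z; w]].
Let B0 : {set {set T}} := [set B | [exists x, exists y, exists z, exists w,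
  [&& B == blk x y z w, Rb x y z w & sum4 x y z w == 0%R]]].

Let B0P B : reflect (exists x y z w, [/\ B = blk x y z w, R x y z w & sum4 x y z w = 0%R]) (B \in B0).
Proof.
rewrite inE; apply: (iffP existsP) => [[x /existsP [y /existsP [z /existsP [w /and3P [/eqP -> /RbP h /eqP s]]]]]|].
  by exists x, y, z, w.
case=> x [y [z [w [-> h s]]]]; exists x; apply/existsP; exists y; apply/existsP; exists z.
by apply/existsP; exists w; rewrite eqxx s eqxx andbT; apply/RbP.
Qed.

Let pick3 B a b c : B \in B0 -> a \in B -> b \in B -> c \in B -> distinct3 a b c ->
  exists d, [/\ R a b c d, B = blk a b c d & sum4 a b c d = 0%R].
Proof.
case/B0P => x [y [z [w [-> h s]]]]; rewrite !in_set => ha hb hc /and3P [nab nac nbc].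
have us := Ru h.
have p1 := perm_to_rem ha.
have hb' : b \in rem a [:: x; y; z; w] by rewrite mem_rem_uniq // inE hb andbT eq_sym.
have p2 := perm_to_rem hb'.
have hc' : c \in rem b (rem a [:: x; y; z; w]).
  by rewrite mem_rem_uniq ?rem_uniq // inE mem_rem_uniq // inE hc !(eq_sym c) nac nbc.
have p3 := perm_to_rem hc'.
have : size (rem c (rem b (rem a [:: x; y; z; w]))) = 1 by rewrite !size_rem.
case e : (rem c _) => [|d []] // _; rewrite e in p3.
have pe : perm_eq [:: x; y; z; w] [:: a; b; c; d].
  apply: (perm_trans p1); rewrite perm_cons; apply: (perm_trans p2); rewrite perm_cons.
  exact: p3.
exists d; split; first exact: design_perm dR h pe.
  by apply/setP => v; rewrite !in_set; apply: perm_mem.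
have sE q1 q2 q3 q4 : sum4 q1 q2 q3 q4 = (\sum_(q <- [:: q1; q2; q3; q4]) q.1)%R.
  by rewrite !big_cons big_nil addr0 !addrA.
by rewrite -s !sE; apply/esym/perm_big.
Qed.

Let C := mxof @: B0.

Let cardB B : B \in B0 -> #|B| = 4.
Proof.
by case/B0P => x [y [z [w [-> h _]]]]; rewrite cardsE; apply/card_uniqP: (Ru h).
Qed.

Let corrE B B' r : corr (mxof B) (mxof B') r = #|[pred q | (ph q \in B) && (shift (r%:R)%R (ph q) \in B')]|.
Proof.
rewrite /corr pair_bigA -sum_pred; apply: eq_bigr => -[i j] _.
by rewrite !mxE /= -ph_shift.
Qed.

Let sum_shift t x y z w : sum4 (shift t x) (shift t y) (shift t z) (shift t w) = (sum4 x y z w + t * 4%:R)%R.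
Proof. rewrite /sum4 /=; ring. Qed.

Let ooc : is_OOC_4_2 C.
Proof.
split=> [A /imsetP [B hB ->]|A A' r /imsetP [B hB ->] /imsetP [B' hB' ->]].
  rewrite -(cardB hB) /mx_weight pair_bigA (eq_bigr (fun q => (ph q \in B) : nat)); last first.
    by move=> [i j] _; rewrite mxE.
  rewrite (sum_pred (fun q => ph q \in B)) -(on_card_preimset (onW_bij _ ph_bij)).
  by apply: eq_card => q; rewrite !inE.
rewrite (inj_eq mxof_inj) corrE leqNgt => nz; apply/negP => /card_gt2P [x [y [z]]].
rewrite !inE => -[[/andP [x1 x2] /andP [y1 y2] /andP [z1 z2]] [n1 n2 n3]].
have phI := bij_inj ph_bij.
have d3 : distinct3 (ph x) (ph y) (ph z) by rewrite /distinct3 !(inj_eq phI) n1 n2 eq_sym n3.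
have [d [h1 e1 s1]] := pick3 hB x1 y1 z1 d3.
have d3' : distinct3 (shift (r%:R)%R (ph x)) (shift (r%:R)%R (ph y)) (shift (r%:R)%R (ph z)).
  by move: d3; rewrite /distinct3 !(inj_eq (@shift_inj _)).
have [d' [h2 e2 s2]] := pick3 hB' x2 y2 z2 d3'.
(* By uniqueness the second block is the shift of the first. Both coordinate sums are 0 and the
   shift adds 4r, so r = 0 in the field. *)
have e := design_uniq dR h2 (inv (r%:R)%R h1); subst d'.
have : ((r%:R : F) * 4%:R = 0)%R by move: s2; rewrite sum_shift s1 add0r.
move/eqP; rewrite mulf_eq0 (negPf four) orbF => /eqP r0.
case/orP: nz => [/eqP []|/eqP []]; last by have := congr1 val r0; rewrite /= val_Fp_nat.
have s0 v : shift (r%:R)%R v = v by case: v => a i; rewrite /shift r0 addr0.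
by rewrite e1 e2 !s0.
Qed.

(** Ordered triples inside the blocks with coordinate sum 0 are counted twice: each block contains 4
    * 3 * 2 = 24 of them, and every covered triple that starts at a point (0, i) has exactly one
    translate among them. *)
Let t3 (s : seq T) : bool := if s is [:: x; y; z] then
  [exists w, Rb x y z w && (sum4 x y z w == 0%R)] else false.
Let N3 := [set t : 3.-tuple T | t3 t].

Let N3_24 : #|N3| = 24 * #|C|.
Proof.
rewrite (card_imset _ mxof_inj).
have -> : #|N3| = \sum_(t : 3.-tuple T) \sum_(B in B0) (all [in B] t && uniq t : nat).
  rewrite -sum1_card big_mkcond /=; apply: eq_bigr => -[[|x [|y [|z []]]] //= st] _.
  rewrite inE /=; case: existsP => [[w /andP [/RbP h /eqP s]]|ne].
    have hB : blk x y z w \in B0 by apply/B0P; exists x, y, z, w.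
    have /and3P [h1 h2 _] := Ru h.
    rewrite (bigD1 _ hB) /= !inE !eqxx !orbT /= big1 ?addn0 => [|B /andP [hB' nB]].
      by move: (Ru h); rewrite /= !inE !negb_or => /and4P [/and3P [-> -> _] /andP [-> _] _ _].
    case: andP => // -[/and4P [xB yB zB _] uq]; case/eqP: nB.
    have d3 : distinct3 x y z by case/and3P: uq; rewrite negb_or /distinct3 => /andP [-> ->] ->.
    have [d [h' -> _]] := pick3 hB' xB yB zB d3.
    by rewrite (design_uniq dR h' h).
  rewrite big1 // => B hB; case: andP => // -[/and4P [xB yB zB _] uq]; case: ne.
  have d3 : distinct3 x y z by move: uq; rewrite /= !inE negb_or /distinct3 => /and3P [/andP [-> ->] ->].
  have [d [h' _ s]] := pick3 hB xB yB zB d3; exists d; rewrite s eqxx andbT; exact/RbP.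
rewrite exchange_big /= (eq_bigr (fun=> 24)) => [|B hB]; first by rewrite sum_nat_const mulnC.
rewrite (sum_pred (fun t : 3.-tuple T => all [in B] t && uniq t)).
transitivity (#|B| ^_ 3); last by rewrite cardB.
by rewrite -card_uniq_tuples; apply: eq_card => t; rewrite !inE.
Qed.

(** The translation that brings the coordinate sum of the block through the three points to 0;
    outside the domain its value is an arbitrary 0. *)
Let tq (q : 'I_u * (T * T)) : F :=
  if [pick w | Rb (0%R, q.1) q.2.1 q.2.2 w] is Some w then
    (- (q.2.1.1 + q.2.2.1 + w.1) / 4%:R)%R else 0%R.
Let kq (q : 'I_u * (T * T)) : 3.-tuple T :=
  [tuple shift (tq q) (0%R, q.1); shift (tq q) q.2.1; shift (tq q) q.2.2].
Let DQ := [set q : 'I_u * (T * T) | D (0%R, q.1) q.2.1 q.2.2].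

Let N3_M : #|N3| = u * M.
Proof.
have -> : N3 = kq @: DQ.
  apply/setP => -[[|x [|y [|z []]]] //= st]; rewrite inE /=.
  apply/existsP/imsetP => [[w /andP [/RbP h /eqP s]]|[[i [y' z']]]].
    pose q := (x.2, (shift (- x.1)%R y, shift (- x.1)%R z)).
    have x0 : (0%R, x.2) = shift (- x.1)%R x by rewrite /shift subrr.
    have hh := inv (- x.1)%R h.
    exists q; first by rewrite inE /= x0; exact: (design_dom dR hh).
    have tE : tq q = x.1.
      rewrite /tq; case: pickP => [w'|/(_ (shift (- x.1)%R w))] /=; rewrite x0; last by move/RbP; case.
      move/RbP => /(design_uniq dR hh) <- /=.
      apply: (mulIf four); rewrite divfK //.
      have -> : (x.1 * 4%:R = x.1 * 4%:R - sum4 x y z w)%R by rewrite s subr0.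
      rewrite /sum4; ring.
    apply: val_inj; rewrite /= tE /q /= !shiftNK; congr [:: _; _; _].
    by case: (x) => a i; rewrite /shift /= add0r.
  rewrite inE /= => /(design_ex dR) [w h] /(congr1 val) /= [-> -> ->].
  exists (shift (tq (i, (y', z'))) w); apply/andP; split; first by apply/RbP; apply: inv.
  rewrite sum_shift /tq; case: pickP => [w'|/(_ w)] /=; last by move/RbP; case.
  move/RbP => /(design_uniq dR h) <-; rewrite /sum4 /= divfK //; apply/eqP; ring.
rewrite card_in_imset => [|[i [y z]] [i' [y' z']] _ _ e]; last first.
  have e1 : shift (tq (i, (y, z))) (0%R, i) = shift (tq (i', (y', z'))) (0%R, i') :=
    congr1 (fun t : 3.-tuple T => nth (0%R, i) t 0) e.
  have e2 : shift (tq (i, (y, z))) y = shift (tq (i', (y', z'))) y' :=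
    congr1 (fun t : 3.-tuple T => nth (0%R, i) t 1) e.
  have e3 : shift (tq (i, (y, z))) z = shift (tq (i', (y', z'))) z' :=
    congr1 (fun t : 3.-tuple T => nth (0%R, i) t 2) e.
  have et : tq (i, (y, z)) = tq (i', (y', z')).
    have : (0 + tq (i, (y, z)) = 0 + tq (i', (y', z')))%R := congr1 fst e1.
    by rewrite !add0r.
  have ei : i = i' := congr1 snd e1.
  rewrite et in e2 e3; have {}e2 := shift_inj e2; have {}e3 := shift_inj e3.
  by rewrite e2 e3 ei.
rewrite -sum1_card big_mkcond /= (eq_bigr (fun q => (D (0%R, q.1) q.2.1 q.2.2) : nat)); last first.
  by move=> q _; rewrite inE; case: ifP.
rewrite -(pair_bigA _ (fun i q => (D (0%R, i) q.1 q.2) : nat)) /=.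
rewrite (eq_bigr (fun=> M)) => [|i _]; first by rewrite sum_nat_const card_ord.
by rewrite (sum_pred (fun q : T * T => D (0%R, i) q.1 q.2)) -(cM i) cardsE.
Qed.

Lemma ooc_of_design : exists C : {set 'M[bool]_(u, p)}, is_OOC_4_2 C /\ 24 * #|C| = u * M.
Proof. by exists C; split; [exact: ooc|rewrite -N3_24 N3_M]. Qed.
End OOC.

(** * Rotational systems on a prime field *)

Local Open Scope ring_scope.

Section CubicTriangles.
Variables (F : fieldType) (om : F) (C : pred F).
(** For a triangle x = t + c, y = t + [om] c, z = t + [om]^2 c the value is c, the vector from the
    centre t to x. The equation in [ctri0] is x + [om] y + [om]^2 z = 0, since [om]^2 = -1 - [om];
    it fixes the orientation, and [ctri] admits both. *)
Definition centre (x y : F) : F := (x - y) / (1 - om).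
Definition ctri0 (x y z : F) : bool := (x + om * y - (1 + om) * z == 0) && C (centre x y).
Definition ctri (x y z : F) : bool := ctri0 x y z || ctri0 y x z.
End CubicTriangles.

Record rosqs (p : nat) (om : 'F_p) (C : pred 'F_p) (Q : 'F_p -> 'F_p -> 'F_p -> 'F_p -> Prop) : Prop :=
  Rosqs {
  rosqs_om : om ^+ 2 = - om - 1;
  rosqs_om1 : om != 1;
  rosqs_0 : C 0 = false;
  rosqs_N : forall c, c != 0 -> C (- c) = ~~ C c;
  rosqs_rot : forall c, C (om * c) = C c;
  rosqs_design : design (fun x y z => distinct3 x y z && ~~ ctri om C x y z) Q;
  rosqs_inv : forall t x y z w, Q x y z w -> Q (x + t) (y + t) (z + t) (w + t) }.

Lemma Fp_nat_inj p (n n' : nat) : prime p -> (n < p)%N -> (n' < p)%N -> n%:R = n'%:R :> 'F_p -> n = n'.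
Proof.
move=> pp l l' e; have := val_Fp_nat pp n; have := val_Fp_nat pp n'.
by rewrite !modn_small // e => ->.
Qed.
Lemma Fp_val_lt p (a : 'F_p) : prime p -> (val a < p)%N.
Proof. by move=> pp; rewrite -[X in (_ < X)%N](Fp_cast pp); apply: ltn_ord. Qed.
Lemma Fp_valK p (a : 'F_p) : prime p -> (val a)%:R = a.
Proof. by move=> pp; apply: val_inj; rewrite /= val_Fp_nat // modn_small // Fp_val_lt. Qed.
Lemma Fp_p0 p : prime p -> p%:R = 0 :> 'F_p.
Proof. by move=> pp; apply: val_inj; rewrite /= val_Fp_nat // modnn. Qed.

(** The three residues are the positions of the apex along the sides of a missing triangle when it
    is placed k steps from one vertex. They must be odd for the matching in [H2] to exist. *)
Definition has_rosqs (p : nat) := exists (om k : 'F_p) C Q, @rosqs p om C Q /\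
  [&& odd (val k), odd (val (om ^+ 2 * (k + 1))%R) & odd (val (om * k - 1)%R)].

Local Close Scope ring_scope.

Local Open Scope ring_scope.

Lemma Fp_expf1 p (a : 'F_p) : prime p -> a != 0 -> a ^+ p.-1 = 1.
Proof.
move=> pp n; apply: (mulfI n); rewrite -exprS prednK ?prime_gt0 // mulr1.
by have := expf_card a; rewrite card_Fp.
Qed.

(** With n = (p - 1)/3, the polynomial X^n - 1 has at most n roots, so some nonzero a has a^n
    different from 1; this power is a primitive cube root of unity. *)
Lemma Fp_cube_root p : prime p -> (3 %| p.-1)%N -> (3 < p)%N ->
  exists2 om : 'F_p, om ^+ 2 = - om - 1 & om != 1.
Proof.
move=> pp d3 p3; pose n := (p.-1 %/ 3)%N.
have n3 : (n * 3 = p.-1)%N by rewrite divnK.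
pose rs := [seq x <- enum 'F_p | x != 0].
have [a an a1] : exists2 a : 'F_p, a != 0 & a ^+ n != 1.
  have : ~~ all n.-unity_root rs.
    apply/negP => al; have := max_unity_roots _ al (filter_uniq _ (enum_uniq _)).
    have -> : size rs = p.-1.
      have := count_predC (pred1 (0 : 'F_p)) (enum 'F_p); rewrite -cardE card_Fp //.
      by rewrite (count_uniq_mem _ (enum_uniq _)) mem_enum /= size_filter => e; rewrite -[in RHS]e.
    by move/(_ ltac:(lia)); lia.
  case/allPn => a; rewrite mem_filter => /andP [an _]; rewrite unity_rootE => a1.
  by exists a.
exists (a ^+ n) => //; have e : (a ^+ n) ^+ 3 = 1 by rewrite -exprM n3 Fp_expf1.
have : (a ^+ n - 1) * ((a ^+ n) ^+ 2 + a ^+ n + 1) = 0.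
  by transitivity ((a ^+ n) ^+ 3 - 1); [ring|rewrite e subrr].
move/eqP; rewrite mulf_eq0 subr_eq0 (negPf a1) /= => /eqP h.
by rewrite -[LHS]subr0 -h; ring.
Qed.

Section Ro7.
Variables (p : nat) (om : 'F_p).
Hypotheses (pp : prime p) (p7 : (p %% 12 = 7)%N) (omE : om ^+ 2 = - om - 1) (om1 : om != 1).
Local Notation F := 'F_p.
Implicit Types a b c x y z w t : F.

(** The quadratic character. For p = 7 mod 12 the exponent (p - 1)/2 is odd and divisible by 3, so
    -1 is a nonsquare and [om] is a square. *)
Let chi a := a ^+ p./2 == 1.
Let pm a : a != 0 -> a ^+ p./2 = 1 \/ a ^+ p./2 = -1.
Proof.
move=> n; have : (a ^+ p./2) ^+ 2 = 1.
  by rewrite -exprM muln2 (_ : p./2.*2 = p.-1) ?Fp_expf1 //; lia.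
by move/eqP; rewrite sqrf_eq1 => /orP [/eqP|/eqP]; [left|right].
Qed.
Let two : (1 : F) != -1.
Proof.
rewrite -subr_eq0 opprK; apply/eqP => e.
have : (2 = 0)%N by apply: (@Fp_nat_inj p 2 0 pp); [lia|lia|].
by [].
Qed.
Let chiN a : a != 0 -> chi (- a) = ~~ chi a.
Proof.
move=> n; rewrite /chi exprNn -signr_odd (_ : odd p./2 = true) ?expr1; last lia.
by rewrite mulN1r; case: (pm n) => ->; rewrite ?opprK ?eqxx // eq_sym (negPf two).
Qed.
Let chiM2 a b : b != 0 -> chi (a * b ^+ 2) = chi a.
Proof.
by move=> n; rewrite /chi exprMn -exprM mulnC muln2 (_ : p./2.*2 = p.-1) ?Fp_expf1 ?mulr1 //; lia.
Qed.
Let om3 : om ^+ 3 = 1. Proof. by rewrite exprS omE; ring: omE. Qed.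
Let chi_om a : chi (om * a) = chi a.
Proof.
rewrite /chi exprMn (_ : p./2 = (3 * (p./2 %/ 3))%N) ?exprM ?om3 ?expr1n ?mul1r //.
by lia.
Qed.

(** On a cubic triangle c(1 - [om]) is the side x - y, and by [Vtri] its character is that of the
    product [V] that governs the orientation. *)
Let C c := (c != 0) && ~~ chi (c * (1 - om)).
Let om1' : 1 - om != 0. Proof. by rewrite subr_eq0 eq_sym. Qed.
Let om0 : om != 0. Proof. by apply/eqP => e; move: om3; rewrite e expr0n /= => /eqP; rewrite eq_sym oner_eq0. Qed.

Let ro_N c : c != 0 -> C (- c) = ~~ C c.
Proof. by move=> n; rewrite /C oppr_eq0 n /= mulNr chiN // mulf_neq0. Qed.
Let ro_rot c : C (om * c) = C c.
Proof. by rewrite /C mulf_eq0 (negPf om0) /= -mulrA chi_om. Qed.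

(** For a primitive cube root a this is (xy + zw) + a(xz + yw) + a^2(xw + yz), and it vanishes when
    the four points are equianharmonic. Its coefficient of w is [L], so [L] = 0 sends the fourth
    point to infinity. A triple has one such fourth point for each of the two roots; [rt] chooses by
    the character of the Vandermonde product [V], which changes under a transposition just as the
    roots are exchanged in [Phi]. *)
Let Phi a x y z w := x * y + z * w + a * (x * z + y * w) - (1 + a) * (x * w + y * z).
Let L a x y z := z + a * y - (1 + a) * x.
Let V x y z := (x - y) * (y - z) * (z - x).
Let rt x y z := if chi (V x y z) then om else - 1 - om.
Let Q x y z w : Prop := distinct3 x y z /\ Phi (rt x y z) x y z w = 0.

Let root a := (a ^+ 2 = - a - 1).
Let rt_root x y z : root (rt x y z).
Proof. by rewrite /rt /root; case: ifP => _ //; ring: omE. Qed.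
Let root0 a : root a -> a != 0.
Proof. by move=> h; apply/eqP => e; move: h; rewrite /root e expr0n /= oppr0 add0r => /eqP; rewrite eq_sym oppr_eq0 oner_eq0. Qed.
Let root1 a : root a -> 1 + a != 0.
Proof.
move=> h; have : - (a ^+ 2) != 0 by rewrite oppr_eq0 expf_neq0 // root0.
by apply: contra_neq => e; rewrite h -e; ring.
Qed.
Let V0 x y z : distinct3 x y z -> V x y z != 0.
Proof. by case/and3P => a b c; rewrite /V !mulf_neq0 // subr_eq0 // eq_sym. Qed.
Let rtC x y z x' y' z' : V x' y' z' = - V x y z -> distinct3 x y z -> rt x' y' z' = - 1 - rt x y z.
Proof.
move=> e d; rewrite /rt e chiN ?V0 //; case: chi => //=; ring.
Qed.

Let Lx a x y z w : root a -> Phi a x y z w = 0 -> L a x y z * (w - x) = (1 + a) * (x - y) * (x - z).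
Proof.
move=> ra h; apply/eqP; rewrite -subr_eq0 -h /Phi /L; apply/eqP; ring: ra.
Qed.
Let Ly a x y z w : root a -> Phi a x y z w = 0 -> L a x y z * (y - w) = a * (y - x) * (y - z).
Proof.
move=> ra h; apply/eqP; rewrite -subr_eq0 -oppr_eq0 -h /Phi /L; apply/eqP; ring: ra.
Qed.
Let L0 x y z w : Q x y z w -> L (rt x y z) x y z != 0.
Proof.
case=> /and3P [a b c] h; have r := rt_root x y z; apply/eqP => e.
have := Lx r h; rewrite e mul0r => /esym /eqP; rewrite !mulf_eq0 (negPf (root1 r)) !subr_eq0.
by rewrite (negPf a) (negPf b).
Qed.

Let Q12 x y z w : Q x y z w -> Q y x z w.
Proof.
case=> d h; have r := rt_root x y z; split.
  by case/and3P: d => a b c; rewrite /distinct3 eq_sym a b c.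
by rewrite (@rtC x y z) //; [rewrite -h /Phi; ring|rewrite /V; ring].
Qed.
Let Q23 x y z w : Q x y z w -> Q x z y w.
Proof.
case=> d h; have r := rt_root x y z; split.
  by case/and3P: d => a b c; rewrite /distinct3 (eq_sym z) a b c.
rewrite (@rtC x y z) //; last by rewrite /V; ring.
transitivity ((- 1 - rt x y z) * Phi (rt x y z) x y z w); last by rewrite h mulr0.
rewrite /Phi; ring: r.
Qed.
Let Q34 x y z w : Q x y z w -> Q x y w z.
Proof.
move=> q; have l0 := L0 q; case: (q) => d h; have r := rt_root x y z; have /and3P [a b c] := d.
have lx := Lx r h; have ly := Ly r h; set l := L _ x y z in lx ly l0.
have wx : w - x != 0.
  apply/eqP => e; move: lx; rewrite e mulr0 => /esym /eqP.
  by rewrite !mulf_eq0 (negPf (root1 r)) !subr_eq0 (negPf a) (negPf b).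
have wy : y - w != 0.
  apply/eqP => e; move: ly; rewrite e mulr0 => /esym /eqP.
  by rewrite !mulf_eq0 (negPf (root0 r)) !subr_eq0 (eq_sym y) (negPf a) (negPf c).
split; first by rewrite /distinct3 a (eq_sym x) -!(subr_eq0 w) -(subr_eq0 y) wx wy.
have e : rt x y w = - 1 - rt x y z.
  have xy : x - y != 0 by rewrite subr_eq0.
  (* Up to squares, [Lx] and [Ly] turn V x y w into -V x y z, so replacing z by w reverses the
     orientation as a transposition has to. *)
  have ev : V x y w * l ^+ 2 = - (V x y z * (x - y) ^+ 2).
    transitivity ((x - y) * (l * (y - w)) * (l * (w - x))); first by rewrite /V; ring.
    by rewrite lx ly /V; ring: r.
  rewrite {1}/rt -(chiM2 (V x y w) l0) ev -mulNr chiM2 // chiN ?V0 // /rt.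
  by case: chi => //=; ring.
by rewrite e -h /Phi; ring.
Qed.

Let chi3 a : a != 0 -> chi (a ^+ 3) = chi a.
Proof. by move=> n; rewrite exprS chiM2. Qed.

Let Vtri x y z : x + om * y - (1 + om) * z = 0 -> V x y z = (x - y) ^+ 3.
Proof.
move=> e; have ex : x = (1 + om) * z - om * y by apply/eqP; rewrite -subr_eq0 -e; apply/eqP; ring.
by rewrite /V ex; ring: omE.
Qed.

(** For the two roots, [L] is [om] times the two linear forms of [ctri0]. On a triangle where one of
    them vanishes, V is the cube of a side, so the root chosen by [rt] agrees with the class of
    c. *)
Let ctriE x y z : distinct3 x y z -> ctri om C x y z = (L (rt x y z) x y z == 0).
Proof.
move=> d; have /and3P [nxy _ _] := d.
have Cc u v : u != v -> C (centre om u v) = ~~ chi (u - v).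
  by move=> n; rewrite /C /centre mulf_eq0 invr_eq0 !subr_eq0 (negPf n) [1 == om]eq_sym (negPf om1) /= divfK.
have d' : distinct3 y x z by case/and3P: d => a b c; rewrite /distinct3 eq_sym a b c.
have e1 : L (- 1 - om) x y z = om * (x + om * y - (1 + om) * z) by rewrite /L; ring: omE.
have e2 : L om x y z = om * (y + om * x - (1 + om) * z) by rewrite /L; ring: omE.
have vt u v : V v u z = - V u v z by rewrite /V; ring.
have nyx : y != x by rewrite eq_sym.
have xy0 : x - y != 0 by rewrite subr_eq0.
have yx0 : y - x != 0 by rewrite subr_eq0.
rewrite /ctri /ctri0 (Cc _ _ nxy) (Cc _ _ nyx) /rt; apply/orP/eqP => [[/andP [/eqP t c]|/andP [/eqP t c]]|].
- by rewrite Vtri // chi3 ?subr_eq0 // (negPf c) e1 t mulr0.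
- have := Vtri t; rewrite (vt x y) => ev; rewrite -[V x y z]opprK ev chiN ?expf_neq0 //.
  by rewrite chi3 // c e2 t mulr0.
case: ifP => ch; rewrite ?e1 ?e2 => /eqP; rewrite mulf_eq0 (negPf om0) /= => t; [right|left]; rewrite t /=.
  move/eqP: t => t; have := Vtri t; rewrite (vt x y) => ev.
  by rewrite -(chi3 yx0) -ev chiN ?V0 // ch.
by move/eqP: t => t; rewrite -(chi3 xy0) -(Vtri t) ch.
Qed.

Let PhiL a x y z w : Phi a x y z w = w * L a x y z + (x * y + a * (x * z) - (1 + a) * (y * z)).
Proof. by rewrite /Phi /L; ring. Qed.

Lemma rosqs7 : exists C Q, @rosqs p om C Q.
Proof.
exists C, Q; split => //.
  split => //.
  - by move=> x y z w q; case: (q) => d _; rewrite d ctriE // (negPf (L0 q)).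
  - move=> x y z /andP [d]; rewrite ctriE // => l0.
    exists (- (x * y + rt x y z * (x * z) - (1 + rt x y z) * (y * z)) / L (rt x y z) x y z).
    by split => //; rewrite PhiL divfK // addNr.
  move=> x y z w w' q [_ h']; have l0 := L0 q; case: q => _; rewrite -h' !PhiL => /addIr.
  exact: mulIf.
move=> t x y z w [d h]; have e : V (x + t) (y + t) (z + t) = V x y z by rewrite /V; ring.
split; first by move: d; rewrite /distinct3 !(inj_eq (addIr t)).
by rewrite /rt e -/(rt x y z) -h /Phi; ring.
Qed.
End Ro7.

Local Close Scope ring_scope.

(** * H-designs with two layers *)

Local Open Scope ring_scope.

Section TwoLabels.
Variables (F : zmodType) (Q tri par : F -> F -> F -> F -> Prop).
Hypotheses (q12 : forall x y z w, Q x y z w -> Q y x z w) (q23 : forall x y z w, Q x y z w -> Q x z y w)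
  (q34 : forall x y z w, Q x y z w -> Q x y w z)
  (tri12 : forall x y z w, tri x y z w -> tri y x z w) (tri23 : forall x y z w, tri x y z w -> tri x z y w)
  (par12 : forall x y z w, par x y z w -> par y x z w) (par34 : forall x y z w, par x y z w -> par x y w z)
  (par_dual : forall x y w v, par x y w v -> par (- w) (- v) (- x) (- y)).
Hypotheses (Q_uniq : forall x y z w, Q x y z w -> uniq [:: x; y; z; w])
  (tri_uniq : forall x y z w, tri x y z w -> uniq [:: x; y; z; w])
  (par_uniq : forall x y z w, par x y z w -> uniq [:: x; y; z; w]).
Hypothesis H1 : forall x y z, distinct3 x y z ->
  (exists2 w, Q x y z w & (forall w', Q x y z w' -> w = w') /\ (forall v, ~ tri x y z v)) \/
  (exists2 w, tri x y z w & (forall w', tri x y z w' -> w = w') /\ (forall v, ~ Q x y z v)).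
Hypothesis H2 : forall x y w, distinct3 x y w ->
  (exists2 z, tri x y z w & (forall z', tri x y z' w -> z = z') /\ (forall v, ~ par x y w v)) \/
  (exists2 v, par x y w v & (forall v', par x y w v' -> v = v') /\ (forall z, ~ tri x y z w)).
Hypotheses (Qt : forall t x y z w, Q x y z w -> Q (x + t) (y + t) (z + t) (w + t))
  (trit : forall t x y z w, tri x y z w -> tri (x + t) (y + t) (z + t) (w + t))
  (part : forall t x y z w, par x y z w -> par (x + t) (y + t) (z + t) (w + t)).

(** [Q] gives the blocks inside a layer, [tri x y z w] a triangle with its apex w in the other
    layer, [par x y w v] two points in each layer. The layer [true] uses negated coordinates in [Q]
    and [tri]; together with [par_dual] this makes [neg] an automorphism, and only triples with at
    least two points in the layer [false] need to be checked ([H1], [H2]). *)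
Let R (a b c d : F * bool) : Prop := match a, b, c, d with
  | (x, false), (y, false), (z, false), (w, false) => Q x y z w
  | (x, true), (y, true), (z, true), (w, true) => Q (- x) (- y) (- z) (- w)
  | (x, false), (y, false), (z, false), (w, true) => tri x y z w
  | (x, false), (y, false), (w, true), (z, false) => tri x y z w
  | (x, false), (w, true), (y, false), (z, false) => tri x y z w
  | (w, true), (x, false), (y, false), (z, false) => tri x y z w
  | (x, true), (y, true), (z, true), (w, false) => tri (- x) (- y) (- z) (- w)
  | (x, true), (y, true), (w, false), (z, true) => tri (- x) (- y) (- z) (- w)
  | (x, true), (w, false), (y, true), (z, true) => tri (- x) (- y) (- z) (- w)
  | (w, false), (x, true), (y, true), (z, true) => tri (- x) (- y) (- z) (- w)
  | (x, false), (y, false), (w, true), (v, true) => par x y w v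
  | (x, false), (w, true), (y, false), (v, true) => par x y w v
  | (x, false), (w, true), (v, true), (y, false) => par x y w v
  | (w, true), (x, false), (y, false), (v, true) => par x y w v
  | (w, true), (x, false), (v, true), (y, false) => par x y w v
  | (w, true), (v, true), (x, false), (y, false) => par x y w v
  end.

Let R12 a b c d : R a b c d -> R b a c d.
Proof.
by case: a b c d => [x []] [y []] [z []] [w []] /= h;
  first [exact: h|exact: (q12 h)|exact: tri12 h|exact: par12 h|exact: par34 h].
Qed.
Let R23 a b c d : R a b c d -> R a c b d.
Proof.
by case: a b c d => [x []] [y []] [z []] [w []] /= h;
  first [exact: h|exact: (q23 h)|exact: tri12 h|exact: tri23 h|exact: par12 h|exact: par34 h].
Qed.
Let R34 a b c d : R a b c d -> R a b d c.
Proof.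
by case: a b c d => [x []] [y []] [z []] [w []] /= h;
  first [exact: h|exact: (q34 h)|exact: tri12 h|exact: tri23 h|exact: par12 h|exact: par34 h].
Qed.

Let neg (a : F * bool) : F * bool := (- a.1, ~~ a.2).
Let negK : involutive neg. Proof. by case=> x l; rewrite /neg /= opprK negbK. Qed.
Let RN a b c d : R a b c d -> R (neg a) (neg b) (neg c) (neg d).
Proof.
by case: a b c d => [x []] [y []] [z []] [w []] /=; rewrite ?opprK //; apply: par_dual.
Qed.

Let R_uniq a b c d : R a b c d -> uniq [:: a.1; b.1; c.1; d.1].
Proof.
have pu (s s' : seq F) : uniq s' -> perm_eq s s' -> uniq s by move=> u /perm_uniq ->.
have pn (s s' : seq F) : uniq s' -> perm_eq (map -%R s) s' -> uniq s.
  by move=> u /perm_uniq; rewrite (map_inj_uniq oppr_inj) => ->.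
by case: a b c d => [x []] [y []] [z []] [w []] h;
  first [apply: pu (Q_uniq h) _; apply/permP => f /=; lia|apply: pu (tri_uniq h) _; apply/permP => f /=; lia
  |apply: pu (par_uniq h) _; apply/permP => f /=; lia|apply: pn (Q_uniq h) _; apply/permP => f /=; lia
  |apply: pn (tri_uniq h) _; apply/permP => f /=; lia].
Qed.

Let E a b c := exists2 d, R a b c d & forall d', R a b c d' -> d = d'.
Let Esym12 a b c : E a b c -> E b a c.
Proof. by case=> d h u; exists d => [|d' /R12 /u //]; apply: R12. Qed.
Let Esym23 a b c : E a b c -> E a c b.
Proof. by case=> d h u; exists d => [|d' /R23 /u //]; apply: R23. Qed.
Let EN a b c : E (neg a) (neg b) (neg c) -> E a b c.
Proof.
case=> d h u; exists (neg d); first by have := RN h; rewrite !negK.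
by move=> d' /RN /u ->; rewrite negK.
Qed.

Let E000 x y z : distinct3 x y z -> E (x, false) (y, false) (z, false).
Proof.
move=> /H1 [[w h [u n]]|[w h [u n]]].
  by exists (w, false) => // -[z' []] /=; [move/n|move/u ->].
by exists (w, true) => // -[z' []] /=; [move/u ->|move/n].
Qed.

Let E001 x y w : distinct3 x y w -> E (x, false) (y, false) (w, true).
Proof.
move=> /H2 [[z h [u n]]|[v h [u n]]].
  by exists (z, false) => // -[z' []] /=; [move/n|move/u ->].
by exists (v, true) => // -[z' []] /=; [move/u ->|move/n].
Qed.

Let RE a b c : distinct3 a.1 b.1 c.1 -> E a b c.
Proof.
have dN (x y z : F) : distinct3 x y z -> distinct3 (- x) (- y) (- z) by rewrite /distinct3 !eqr_opp.
have d12 (x y z : F) : distinct3 x y z -> distinct3 y x z.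
  by case/and3P => a1 a2 a3; rewrite /distinct3 eq_sym a1 a2 a3.
have d23 (x y z : F) : distinct3 x y z -> distinct3 x z y.
  by case/and3P => a1 a2 a3; rewrite /distinct3 (eq_sym z) a1 a2 a3.
have F2 l x y w : distinct3 x y w -> E (x, l) (y, l) (w, ~~ l).
  by case: l => d; [apply: EN; apply: E001; apply: dN|apply: E001].
have F1 l x y w : distinct3 x y w -> E (x, l) (y, l) (w, l).
  by case: l => d; [apply: EN; apply: E000; apply: dN|apply: E000].
case: a b c => [x l] [y l'] [z l''] /= d.
have [<-|n1] := eqVneq l l'; first have [<-|n2] := eqVneq l l''.
- exact: F1.
- by have -> : l'' = ~~ l by [case: (l) (l'') n2 => [] []]; apply: F2.
have -> : l' = ~~ l by case: (l) (l') n1 => [] [].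
have [<-|n2] := eqVneq l l''; first by apply: Esym23; apply: F2; apply: d23.
have -> : l'' = ~~ l by case: (l) (l'') n2 => [] [].
by apply: Esym12; apply: Esym23; rewrite -{3}[l]negbK; apply: F2; apply: d23; apply: d12.
Qed.

Lemma two_labels : exists R : F * bool -> F * bool -> F * bool -> F * bool -> Prop,
  design (fun a b c => distinct3 a.1 b.1 c.1) R /\
  forall t a b c d, R a b c d -> R (a.1 + t, a.2) (b.1 + t, b.2) (c.1 + t, c.2) (d.1 + t, d.2).
Proof.
exists R; split.
  split.
  - exact: R12.
  - exact: R23.
  - exact: R34.
  - by move=> a b c d /R_uniq; rewrite /= !inE !negb_or /distinct3 => /and4P [/and3P [-> -> _] /andP [-> _] _ _].
  - by move=> a b c /RE [d]; exists d.
  move=> a b c d d' h h'; have : distinct3 a.1 b.1 c.1.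
    by have := R_uniq h; rewrite /= !inE !negb_or /distinct3 => /and4P [/and3P [-> -> _] /andP [-> _] _ _].
  by case/RE => e _ u; rewrite -(u _ h) (u _ h').
by move=> t [x []] [y []] [z []] [w []] /= h; rewrite ?opprD;
  first [exact: Qt h|exact: trit h|exact: part h].
Qed.
End TwoLabels.

Lemma okn_bounds (p n : nat) : (0 < n)%N -> (n < p.-2)%N ->
  [/\ (0 < p)%N, [/\ n < p, n.+1 < p & p.-1 < p]%N, [/\ 0 != n, 0 != n.+1 & p.-1 != n]%N,
    p.-1 != n.+1 & n != n.+1].
Proof. by move=> h1 h2; split; try split; lia. Qed.

Section H2.
Variables (p : nat) (om : 'F_p) (C : pred 'F_p) (Q : 'F_p -> 'F_p -> 'F_p -> 'F_p -> Prop).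
Hypotheses (pp : prime p) (p3 : (3 < p)%N) (rQ : rosqs om C Q).
Local Notation F := 'F_p.
Variables (kap : F -> nat) (mu : F -> F).
Hypothesis kapN : forall d, d != 0 -> (kap (- d) + kap d = p.-1)%N.
Hypothesis kap_odd : forall d, d != 0 -> odd (kap d).
Hypothesis mu_rot : forall c, mu (om * c) = mu c.
Hypothesis kap_mu : forall c, c != 0 -> C c -> mu c - c = (kap ((1 - om) * c))%:R * ((1 - om) * c).
Implicit Types x y z w v : F.

Let omE := rosqs_om rQ.
Let om1 : 1 - om != 0. Proof. by rewrite subr_eq0 eq_sym (rosqs_om1 rQ). Qed.
Let om2 : 1 + om != 0.
Proof.
apply/eqP => e; have : (om ^+ 2 = - (1 + om)) by rewrite omE; ring.
rewrite e oppr0 => /eqP; rewrite expf_eq0 /= => /eqP o0; move: e; rewrite o0 addr0 => /eqP.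
by rewrite oner_eq0.
Qed.
Let podd : odd p.
Proof. by case: (even_prime pp) => [e|//]; lia. Qed.
Local Notation cc := (centre om).

Let ccN x y : cc y x = - cc x y. Proof. by rewrite /centre -mulNr opprB. Qed.
Let cc1 x y : (1 - om) * cc x y = x - y. Proof. by rewrite /centre mulrC divfK. Qed.
Let cc0 x y : x != y -> cc x y != 0.
Proof. by move=> n; rewrite /centre mulf_neq0 ?subr_eq0 // invr_eq0. Qed.

(** The apex lies at offset [mu c] from the centre x - c. As [mu] agrees on c, [om] c and [om]^2 c,
    it depends on the triangle alone. *)
Let tri0 x y z w : Prop := ctri0 om C x y z /\ w = x - cc x y + mu (cc x y).
Let tri x y z w : Prop := tri0 x y z w \/ tri0 y x z w.

Let tri0_rot x y z w : tri0 x y z w -> tri0 y z x w.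
Proof.
case=> /andP [/eqP L c] ->.
have e : y - z = om * (x - y).
  apply/eqP; rewrite -subr_eq0; apply/eqP.
  transitivity (- om * (x + om * y - (1 + om) * z)); last by rewrite L mulr0.
  by ring: omE.
have ec : cc y z = om * cc x y by rewrite /centre e mulrA.
split; last by rewrite ec mu_rot; have := cc1 x y; set c0 := cc x y => e1; rewrite -[x](subrK y) -e1; ring.
rewrite /ctri0 ec (rosqs_rot rQ) c andbT; apply/eqP.
transitivity (- (1 + om) * (x + om * y - (1 + om) * z)); last by rewrite L mulr0.
by ring: omE.
Qed.

Let tri12 x y z w : tri x y z w -> tri y x z w. Proof. by case; [right|left]. Qed.
Let tri23 x y z w : tri x y z w -> tri x z y w.
Proof. by case=> h; [right; do 2 apply: tri0_rot|left; apply: tri0_rot]. Qed.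

(** Two cubic triangles have the side xy, with opposite values of c, and [rosqs_N] makes exactly one
    of them missing; this is its third vertex. [ww] is its apex. *)
Let zz x y : F := (if C (cc x y) then x + om * y else y + om * x) / (1 + om).
Let ww x y : F := x + (kap (x - y))%:R * (x - y).

Let Lz x y z : x + om * y - (1 + om) * z == 0 = (z == (x + om * y) / (1 + om)).
Proof.
rewrite subr_eq0; apply/eqP/eqP => [->|->]; first by rewrite mulrC mulKf.
by rewrite [RHS]mulrC divfK.
Qed.

Let natN (a b : nat) : (a + b)%N = p.-1 -> a%:R = - 1 - b%:R :> F.
Proof.
move=> e; have : (a + b + 1)%:R = 0 :> F by rewrite e addn1 prednK ?prime_gt0 // Fp_p0.
by rewrite !natrD => h; apply/eqP; rewrite -subr_eq0 -h; apply/eqP; ring.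
Qed.

Let triE x y z w : x != y -> tri x y z w <-> z = zz x y /\ w = ww x y.
Proof.
move=> n; have CN := rosqs_N rQ (cc0 n); rewrite -ccN in CN.
have e1 : C (cc x y) -> x - cc x y + mu (cc x y) = ww x y.
  by move=> c; have := kap_mu (cc0 n) c; rewrite cc1 /ww => <-; ring.
have e2 : C (cc y x) -> y - cc y x + mu (cc y x) = ww x y.
  move=> c; have n' : y != x by rewrite eq_sym.
  have := kap_mu (cc0 n') c; rewrite cc1 /ww.
  have := kapN (d := x - y); rewrite subr_eq0 opprB => /(_ n) => ek.
  rewrite (natN ek).
  move=> h; have -> : mu (cc y x) = mu (cc y x) - cc y x + cc y x by ring.
  rewrite h; ring.
rewrite /tri /tri0 /ctri0 !Lz CN /zz; case: ifP => c; rewrite /= ?andbF ?andbT.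
  by split=> [[[/eqP -> ->]|[//]]|[-> ->]]; [rewrite e1|left; rewrite eqxx e1].
rewrite CN c in e2.
by split=> [[[//]|[/eqP -> ->]]|[-> ->]]; [rewrite e2|right; rewrite eqxx e2].
Qed.

(** The position [k] belongs to the apex. Pairs n, n + 1 start at odd n below [k] and at even n
    above it; with [k] and p odd they fill 1, ..., k - 1 and k + 1, ..., p - 2. *)
Let okn (k n : nat) := [&& 0 < n, n < p.-2, n != k, n.+1 != k & odd n == (n < k)]%N.
Let pos x y n : F := x + n%:R * (x - y).
Let par x y w v : Prop := x != y /\ exists2 n, okn (kap (x - y)) n &
  (w = pos x y n /\ v = pos x y n.+1) \/ (v = pos x y n /\ w = pos x y n.+1).

Let kap_lt d : d != 0 -> (0 < kap d < p.-1)%N.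
Proof.
move=> n; have := kapN n; have := kap_odd n; have : - d != 0 by rewrite oppr_eq0.
by move/kap_odd; lia.
Qed.

Let par34 x y w v : par x y w v -> par x y v w.
Proof. by case=> n [k ok h]; split => //; exists k => //; case: h; [right|left]. Qed.

Let posC x y n n' : (n + n')%N = p.-1 -> pos x y n = pos y x n'.
Proof.
move=> e; rewrite /pos (@natN n' n) 1?addnC //.
ring.
Qed.

Let par12 x y w v : par x y w v -> par y x w v.
Proof.
case=> n [k ok h]; have nd : x - y != 0 by rewrite subr_eq0.
have := kapN nd; have := kap_odd nd; rewrite opprB => o e.
case/and5P: ok => k0 k1 k2 k3 k4.
split; first by rewrite eq_sym.
have ok' : okn (kap (y - x)) (p.-2 - k).
  by rewrite /okn; move: (kap_lt nd) k2 k3 k4; move: (kap (x - y)) (kap (y - x)) e o => a b; lia.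
exists (p.-2 - k)%N => //.
have e1 : pos x y k = pos y x (p.-2 - k).+1 by apply: posC; lia.
have e2 : pos x y k.+1 = pos y x (p.-2 - k) by apply: posC; lia.
by rewrite -e1 -e2; case: h => [[-> ->]|[-> ->]]; [right|left].
Qed.

(** The progression that starts at -w with difference x - y reaches -x at position n and -y at
    position n + 1, so the pair keeps its index. *)
Let par_dual x y w v : par x y w v -> par (- w) (- v) (- x) (- y).
Proof.
have key x' y' w' v' n : x' != y' -> okn (kap (x' - y')) n -> w' = pos x' y' n -> v' = pos x' y' n.+1 ->
    par (- w') (- v') (- x') (- y').
  move=> nxy ok -> ->; have e : - pos x' y' n - - pos x' y' n.+1 = x' - y'.
    by rewrite /pos -natr1; ring.
  split; first by rewrite -subr_eq0 e subr_eq0.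
  by exists n; [rewrite e|left; rewrite /pos -natr1; split; ring].
case=> n [k ok [[e1 e2]|[e1 e2]]]; first exact: key ok e1 e2.
by apply: par12; apply: key ok e1 e2.
Qed.

Let pos_inj x y n n' : x != y -> (n < p)%N -> (n' < p)%N -> pos x y n = pos x y n' -> n = n'.
Proof.
move=> nxy l l' /addrI /mulIf e; apply: (Fp_nat_inj pp l l'); apply: e.
by rewrite subr_eq0.
Qed.

Let pos0 x y : pos x y 0 = x. Proof. by rewrite /pos mul0r addr0. Qed.
Let pos1 x y : pos x y p.-1 = y.
Proof. by rewrite (@posC x y p.-1 0) ?pos0 // addn0. Qed.

Let par_uniq x y w v : par x y w v -> uniq [:: x; y; w; v].
Proof.
case=> nxy [n /and5P [n0 n1 _ _ _] h].
have ne i j : (i < p)%N -> (j < p)%N -> i != j -> pos x y i != pos x y j.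
  by move=> li lj; apply: contra_neq; apply: pos_inj.
case: (okn_bounds n0 n1) => lp [l1 l2 l3] [d1 d2 d3] d4 d5.
have f2 := ne _ _ lp l1 d1; have f3 := ne _ _ lp l2 d2; have f4 := ne _ _ l3 l1 d3.
have f5 := ne _ _ l3 l2 d4; have f6 := ne _ _ l1 l2 d5; rewrite !pos0 !pos1 in f2 f3 f4 f5.
case: h => [[-> ->]|[-> ->]]; rewrite /= !inE !negb_or nxy f2 f3 f4 f5 ?f6 //.
by rewrite eq_sym f6.
Qed.

Let pos_ex x y w : distinct3 x y w -> exists2 n, (0 < n < p.-1)%N & w = pos x y n.
Proof.
case/and3P => nxy nxw nyw; have nd : x - y != 0 by rewrite subr_eq0.
pose d : F := (w - x) / (x - y).
have e : w = pos x y (val d).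
  have e1 : d * (x - y) = w - x by rewrite /d divfK.
  by rewrite /pos (Fp_valK d pp) e1; ring.
exists (val d) => //; have := Fp_val_lt d pp; move: e; set n := val d => e l.
have : n != 0%N by apply: contra_neq nxw => n0; rewrite e n0 pos0.
have : n != p.-1 by apply: contra_neq nyw => n0; rewrite e n0 pos1.
by lia.
Qed.

Let tri_uniq x y z w : tri x y z w -> uniq [:: x; y; z; w].
Proof.
have n01 x' y' z' w' : tri x' y' z' w' -> x' != y'.
  have C0 : ~~ C 0 by rewrite (rosqs_0 rQ).
  case=> [] [/andP [_ c] _]; apply: contraTneq c => e; rewrite /centre e subrr mul0r //.
have nw x' y' z' w' : tri x' y' z' w' -> (x' != w') /\ (y' != w').
  move=> h; have n := n01 _ _ _ _ h; have [_ ->] := (triE _ _ n).1 h.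
  have nd : x' - y' != 0 by rewrite subr_eq0.
  have := kap_lt nd; rewrite /ww -/(pos x' y' _) => l.
  by split; [rewrite -{1}(pos0 x' y')|rewrite -{1}(pos1 x' y')]; apply/eqP => /(pos_inj n) e; lia.
move=> h; have [a b] := nw _ _ _ _ h; have [_ c] := nw _ _ _ _ (tri23 h).
have d := n01 _ _ _ _ h; have e := n01 _ _ _ _ (tri23 h).
have f := n01 _ _ _ _ (tri23 (tri12 h)).
by rewrite /= !inE !negb_or a b c d e f.
Qed.

Let Q_uniq x y z w : Q x y z w -> uniq [:: x; y; z; w].
Proof.
have dQ := rosqs_design rQ; move=> h.
have /andP [/and3P [a b c] _] := design_dom dQ h.
have /andP [/and3P [_ d e] _] := design_dom dQ (design34 dQ h).
have /andP [/and3P [_ _ f] _] := design_dom dQ (design34 dQ (design23 dQ h)).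
by rewrite /= !inE !negb_or a b c d e f.
Qed.

Let okn_or k n : odd k -> (k < p.-1)%N -> (0 < n < p.-1)%N -> n != k -> okn k n || okn k n.-1.
Proof. by rewrite /okn; move: podd; case: p => [|[|q]] //=; lia. Qed.
Let okn_and k n : odd k -> okn k n -> okn k n.-1 -> False.
Proof. by rewrite /okn; lia. Qed.

Let par_at x y n v : x != y -> (0 < n < p.-1)%N -> par x y (pos x y n) v ->
  (okn (kap (x - y)) n /\ v = pos x y n.+1) \/ (okn (kap (x - y)) n.-1 /\ v = pos x y n.-1).
Proof.
move=> nxy ln [_ [k ok [[e ->]|[-> e]]]]; have /and5P [k0 k1 _ _ _] := ok.
  by move/(pos_inj nxy): e => e; rewrite e; [left|lia|lia].
by move/(pos_inj nxy): e => e; rewrite e /=; [right|lia|lia].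
Qed.

Let E2 x y w : distinct3 x y w ->
  (exists2 z, tri x y z w & (forall z', tri x y z' w -> z = z') /\ (forall v, ~ par x y w v)) \/
  (exists2 v, par x y w v & (forall v', par x y w v' -> v = v') /\ (forall z, ~ tri x y z w)).
Proof.
move=> d; have [n ln e] := pos_ex d; have /and3P [nxy _ _] := d; subst w.
have nd : x - y != 0 by rewrite subr_eq0.
have lk := kap_lt nd; have ok := kap_odd nd.
have [en|nn] := eqVneq n (kap (x - y)).
  left; exists (zz x y); first by apply/(triE _ _ nxy); rewrite en.
  split=> [z' /(triE _ _ nxy) [-> //]|v /(par_at nxy ln) []].
    by case=> /and5P [_ _]; rewrite en eqxx.
  by case=> /and5P [_ _ _]; rewrite prednK ?en ?eqxx //; lia.
right.
have nt z : ~ tri x y z (pos x y n).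
  by move/(triE _ _ nxy) => [_ /(pos_inj nxy) h]; case/eqP: nn; apply: h; lia.
case/orP: (okn_or ok (proj2 (andP lk)) ln nn) => o.
  exists (pos x y n.+1); first by split => //; exists n => //; left.
  by split=> // v' /(par_at nxy ln) [[_ ->] //|[o' _]]; case: (okn_and ok o o').
exists (pos x y n.-1).
  by split => //; exists n.-1 => //; right; rewrite prednK //; lia.
by split=> // v' /(par_at nxy ln) [[o' _]|[_ ->] //]; case: (okn_and ok o' o).
Qed.

Let H1 x y z : distinct3 x y z ->
  (exists2 w, Q x y z w & (forall w', Q x y z w' -> w = w') /\ (forall v, ~ tri x y z v)) \/
  (exists2 w, tri x y z w & (forall w', tri x y z w' -> w = w') /\ (forall v, ~ Q x y z v)).
Proof.
have dQ := rosqs_design rQ.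
move=> d; have /and3P [nxy _ _] := d; case: (boolP (ctri om C x y z)) => ct; last first.
  left; have [|w h] := design_ex dQ (x := x) (y := y) (z := z); first by rewrite d.
  exists w => //; split; first by move=> w' h'; apply: (design_uniq dQ h h').
  by move=> v [] [c _]; case/negP: ct; rewrite /ctri c ?orbT.
right; have [w h] : exists w, tri x y z w by case/orP: ct => c; [exists (x - cc x y + mu (cc x y)); left|exists (y - cc y x + mu (cc y x)); right].
exists w => //; split; last by move=> v h'; have /andP [_ /negP []] := design_dom dQ h'.
by move=> w' h'; have [_ ->] := (triE _ _ nxy).1 h; have [_ ->] := (triE _ _ nxy).1 h'.
Qed.

Lemma h2_design : exists R : F * bool -> F * bool -> F * bool -> F * bool -> Prop,
  design (fun a b c => distinct3 a.1 b.1 c.1) R /\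
  forall t a b c d, R a b c d -> R (a.1 + t, a.2) (b.1 + t, b.2) (c.1 + t, c.2) (d.1 + t, d.2).
Proof.
have tc t x y : cc (x + t) (y + t) = cc x y by rewrite /centre; congr (_ / _); ring.
have tt0 t x y z w : tri0 x y z w -> tri0 (x + t) (y + t) (z + t) (w + t).
  case=> /andP [/eqP L c] ->; split; last by rewrite tc; ring.
  rewrite /ctri0 tc c andbT -L; apply/eqP; ring.
have ttr t x y z w : tri x y z w -> tri (x + t) (y + t) (z + t) (w + t).
  by case=> /(tt0 t); [left|right].
have tp t x y z w : par x y z w -> par (x + t) (y + t) (z + t) (w + t).
  case=> n [k ok h]; have e : x + t - (y + t) = x - y by ring.
  split; first by rewrite -subr_eq0 e subr_eq0.
  exists k; first by rewrite e.
  by case: h => [[-> ->]|[-> ->]]; [left|right]; split; rewrite /pos; ring.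
have dQ := rosqs_design rQ.
exact: (two_labels (design12 dQ) (design23 dQ) (design34 dQ) tri12 tri23 par12 par34 par_dual
  Q_uniq tri_uniq par_uniq H1 E2 (rosqs_inv rQ) ttr tp).
Qed.
End H2.

Local Close Scope ring_scope.

(** * Choice of the apices *)

(** [N] represents a root of X^2 + X + 1 mod p. The inequalities place kN/p between 2m - 1 and 2m,
    and (k + 1)(N + 1)/p between 2m and 2m + 1. As k and N are odd, the parities of these quotients
    make the residues of [om] k - 1 and [om]^2 (k + 1) odd. *)
Lemma apex_nat p N : odd p -> 7 < p -> p %| N ^ 2 + N + 1 -> odd N -> 2 * N < p ->
  exists k m, [/\ odd k, k < p & [&& m.*2 * p < k * N + p, k * N < m.*2 * p,
    m.*2 * p < k.+1 * N.+1 & k.+1 * N.+1 < m.*2.+1 * p]].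
Proof.
move=> op p7 /dvdnP [h]; rewrite -mulnn => hp oN lN.
have N1 : N != 1 by apply/eqP => e; move: hp; rewrite e; case: h => [|[|h]]; lia.
have N3 : 2 < N by lia.
have [l3|l3] := leqP p (3 * N).
  pose e := p - 2 * N; have ep : p = 2 * N + e by rewrite /e; lia.
  have e3 : 2 < e.
    suff : e != 1 by lia.
    (* For p = 2N + 1 one has 4(N^2 + N + 1) = p^2 + 3, so p would divide 3. *)
    apply/eqP => e1; have E : p * (4 * h) = p * p + 3 by rewrite ep e1 in hp *; lia.
    have : p %| p * p + 3 by rewrite -E dvdn_mulr.
    by rewrite dvdn_addr ?dvdn_mulr // => /dvdn_leq; lia.
  (* For k = 4m + 1 and p = 2N + e the inequality kN < 2mp reads N < 2me; the least such m is i +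
     1. *)
  pose i := N %/ (2 * e).
  have j1 : 2 * (i * e) <= N by have := leq_trunc_div N (2 * e); rewrite -/i; lia.
  have j2 : N < 2 * (i * e) + 2 * e by have := ltn_ceil N (d := 2 * e); rewrite -/i; lia.
  have x3 : i * 3 <= i * e by rewrite leq_mul2l; lia.
  have xe : (i == 0) || (e <= i * e) by case: (i) => //= i'; rewrite leq_pmull.
  have x0 : (i == 0) ==> (i * e == 0) by case: (i).
  move: (ep) (l3) => ep' l3'; clearbody e i.
  exists (4 * i.+1 + 1), i.+1; split; [lia|lia|].
  by rewrite ep; apply/and4P; split; lia.
have hodd : odd h by have : odd (h * p) by [rewrite -hp oddD oddD oddM oN]; rewrite oddM => /andP [].
(* With N^2 + N + 1 = hp and 2m = h + 1, the third inequality reads N^2 + p < k(N + 1). Its least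
   solution is [k0], and k is the least odd one. *)
pose k0 := ((N * N + p) %/ N.+1).+1.
have a1 : N * N + p < k0 * N.+1 by have := ltn_ceil (N * N + p) (d := N.+1); rewrite /k0; lia.
have a2 : k0.-1 * N.+1 <= N * N + p by rewrite /k0 /=; apply: leq_trunc_div.
clearbody k0.
have [k [ok b1 b2]] : exists k, [/\ odd k, N * N + p < k * N.+1 & k.-2 * N.+1 <= N * N + p].
  case o : (odd k0).
    exists k0; split => //; apply: leq_trans a2; rewrite leq_mul2r; lia.
  by exists k0.+1; split; [rewrite /= o|rewrite mulSn; lia|exact: a2].
have k2 : N.+2 <= k.
  rewrite leqNgt; apply/negP => lk; have : k * N.+1 <= N.+1 * N.+1 by rewrite leq_mul2r; lia.
  by lia.
have [k' ek] : exists k', k = k'.+2 by exists (k - 2); lia.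
subst k; rewrite /= in b2.
have b3 : k'.+2 * N < N * N + N + 1 + p.
  have c2 : N * (k' * N.+1) <= N * (N * N + p) by rewrite leq_mul2l b2 orbT.
  have : (k'.+2 * N) * N.+1 < (N * N + N + 1 + p) * N.+1 by lia.
  by rewrite ltn_mul2r => /andP [].
have b4 : k'.+2 + N + 1 <= p.
  have : (k'.+2 + N + 1) * N <= p * N.
    have [eN|nN] := eqVneq N 3.
      have h1 : h = 1 by move: hp; rewrite eN; case: (h) => [|[|h']]; lia.
      by rewrite eN h1 in hp b3 *; lia.
    have [N' eN'] : exists N', N = N'.+1 by exists N.-1; lia.
    have c1 : (3 * N + 1) * N' <= p * N' by rewrite leq_mul2r; lia.
    have c2 : N * 5 <= N * N by rewrite leq_mul2l; lia.
    by rewrite eN' in c1 c2 b3 *; lia.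
  by rewrite leq_mul2r => /orP [/eqP|//]; lia.
have eh : (h.+1./2).*2 = h.+1 by lia.
have c3 : N.+2 * N <= k'.+2 * N by rewrite leq_mul2r k2 orbT.
exists k'.+2, h.+1./2; split => //; first lia.
by rewrite eh !mulSn -hp; apply/and4P; split; lia.
Qed.

Definition select (T : Type) (va vb vd : nat) (a b d : T) : T :=
  if (va <= vb) && (va <= vd) then a else if vb <= vd then b else d.

Lemma select_rot (T : Type) (va vb vd : nat) (a b d : T) : va <> vb -> vb <> vd -> vd <> va ->
  select vb vd va b d a = select va vb vd a b d.
Proof.
rewrite /select => n1 n2 n3.
by case: (ltngtP va vb); case: (ltngtP va vd); case: (ltngtP vb vd) => //=; lia.
Qed.

Section Apex.
Variables (p : nat).
Hypotheses (pp : prime p) (p3 : 3 < p).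
Local Notation F := 'F_p.
Local Open Scope ring_scope.

(** One of the two primitive cube roots has a representative N below p/2. For even N the choice k =
    1 works: the residues are 1, p - 2 - 2N and N - 1. For odd N [apex_nat] supplies k. *)
Lemma apex_exists : (p %% 12 = 7)%N -> exists om k : F, [/\ om ^+ 2 = - om - 1, om != 1 &
  [&& odd (val k), odd (val (om ^+ 2 * (k + 1))) & odd (val (om * k - 1))]].
Proof.
move=> p7; have op : odd p by lia.
have vF (n : nat) (a : F) : (n < p)%N -> a = n%:R -> val a = n.
  by move=> l ->; rewrite /= val_Fp_nat // modn_small.
have [om [omE om1 lN]] : exists om : F, [/\ om ^+ 2 = - om - 1, om != 1 & (2 * val om < p)%N].
  have [om omE om1] := @Fp_cube_root p pp ltac:(lia) p3.
  case: (ltnP (2 * val om) p) => l; first by exists om.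
  have om2 : - om - 1 != 1 by apply: contra_neq om1 => e; apply/eqP; rewrite -subr_eq0; apply/eqP;
    have := omE; rewrite e => e2; have -> : om = om ^+ 2 * om ^+ 2 by [transitivity (om ^+ 2 * (- om - 1)); [ring: omE|rewrite -omE]]; rewrite e2 mulr1 subrr.
  exists (- om - 1); split => //; first by ring: omE.
  have lo := Fp_val_lt om pp; rewrite (vF (p.-1 - val om)%N); [lia|lia|].
  have : (p.-1 - val om + val om + 1)%:R = 0 :> F by rewrite (_ : _ + 1 = p)%N ?Fp_p0 //; lia.
  rewrite !natrD Fp_valK // => e; apply/eqP; rewrite -subr_eq0 -oppr_eq0 -e; apply/eqP; ring.
have eN : om = (val om)%:R by rewrite Fp_valK.
have dv : (p %| val om ^ 2 + val om + 1)%N.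
  have e : (val om ^ 2 + val om + 1)%:R = 0 :> F by rewrite !natrD natrX -eN omE; ring.
  by have := val_Fp_nat pp (val om ^ 2 + val om + 1)%N; rewrite e /dvdn => <-.
move: eN dv lN; move: (val om) => N eN dv lN.
have npos : (0 < N)%N by case: (N) dv => //; rewrite dvdn1; lia.
have ne : (2 * N).+1 != p.
  apply/eqP => e; move: dv; have d4 : (4 * (N ^ 2 + N + 1) = p * p + 3)%N by rewrite -e; nia.
  move=> /(dvdn_mull 4); rewrite d4 dvdn_addr ?dvdn_mulr // => /dvdn_leq; lia.
have [oN|eN2] := boolP (odd N); last first.
  exists om, 1; split => //; apply/and3P; split; first by rewrite (vF 1%N) //; lia.
    rewrite (vF (p - 2 - 2 * N)%N); [lia|lia|rewrite omE].
    have : (p - 2 - 2 * N + (1 + 1 + (N + N)))%:R = 0 :> F by rewrite (_ : _ + _ = p)%N ?Fp_p0 //; lia.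
    rewrite !natrD -eN => e; apply/eqP; rewrite -subr_eq0 -oppr_eq0 -e; apply/eqP; ring.
  rewrite (vF N.-1); [lia|lia|rewrite mulr1 eN].
  have -> : N%:R = N.-1%:R + 1 :> F by rewrite natr1 prednK.
  by rewrite addrK.
have p77 : (7 < p)%N.
  suff : p != 7%N by lia.
  by apply/eqP => e; rewrite e in dv lN; case: (N) oN lN dv => [|[|[|[|?]]]] //; lia.
have [k [m [ok lk /and4P [h1 h2 h3 h4]]]] := apex_nat op p77 dv oN lN.
exists om, k%:R; split => //; apply/and3P; split; first by rewrite (vF k).
  rewrite (vF (m.*2.+1 * p - k.+1 * N.+1)%N).
  - by rewrite oddB ?oddM //= ?oddM ?odd_double ?op ?ok /= ?oN //; lia.
  - by rewrite mulSn; lia.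
  have : (m.*2.+1 * p - k.+1 * N.+1 + k.+1 * N.+1)%:R = 0 :> F.
    by rewrite subnK ?(ltnW h4) // natrM Fp_p0 // mulr0.
  rewrite natrD natrM -!natr1 -eN => e.
  by rewrite -[RHS](addrK ((k%:R + 1) * (om + 1))) e; ring: omE.
rewrite (vF (k * N + p - m.*2 * p).-1).
- by move: h1 h2; have : odd (k * N) by [rewrite oddM ok oN]; have : ~~ odd (m.*2 * p) by [rewrite oddM odd_double]; lia.
- by lia.
have : ((k * N + p - m.*2 * p).-1 + 1 + m.*2 * p)%:R = (k * N + p)%:R :> F by congr _%:R; lia.
rewrite !natrD !natrM Fp_p0 // mulr0 !addr0 -eN => e.
by rewrite -[RHS](addrK 1) e mulrC.
Qed.

Variables (om k : F) (C : pred F).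
Hypotheses (omE : om ^+ 2 = - om - 1) (om1 : om != 1).
Hypotheses (k1 : odd (val k)) (k2 : odd (val (om ^+ 2 * (k + 1)))) (k3 : odd (val (om * k - 1))).
Hypothesis CN : forall c, c != 0 -> C (- c) = ~~ C c.

Let om1' : 1 - om != 0. Proof. by rewrite subr_eq0 eq_sym. Qed.
Let om3 : om ^+ 3 = 1. Proof. by rewrite exprS omE; ring: omE. Qed.
(** The member of {c, [om] c, [om]^2 c} with the least residue marks one vertex of the triangle;
    through [mu] the apex is k steps from this vertex along a side. *)
Let rep (c : F) : F := select (val c) (val (om * c)) (val (om * (om * c))) c (om * c) (om * (om * c)).

Let rep_rot c : rep (om * c) = rep c.
Proof.
have [->|c0] := eqVneq c 0; first by rewrite mulr0.
have e3 : om * (om * (om * c)) = c by rewrite -{2}[c]mul1r -om3; ring.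
have ne (a : F) : a != 0 -> val (om * a) <> val a.
  move=> a0 /val_inj /eqP; rewrite -subr_eq0 -{2}[a]mul1r -mulrBl mulf_eq0 subr_eq0.
  by rewrite (negPf om1) (negPf a0).
have om0 : om != 0 by apply/eqP => e; move: om3; rewrite e expr0n /= => /eqP; rewrite eq_sym oner_eq0.
have n1 := ne _ c0; have n2 := ne (om * c) (mulf_neq0 om0 c0).
have n3 := ne (om * (om * c)) (mulf_neq0 om0 (mulf_neq0 om0 c0)).
by rewrite e3 in n3; rewrite /rep e3; apply: select_rot; apply: nesym.
Qed.

Let mu (c : F) := (1 + k * (1 - om)) * rep c.
Let q (c : F) := (mu c - c) / ((1 - om) * c).

(** Depending on the member chosen by [rep], the quotient is k, [om] k - 1 or [om]^2 (k + 1). *)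
Let q_odd c : c != 0 -> odd (val (q c)).
Proof.
move=> c0; have n0 : (1 - om) * c != 0 by rewrite mulf_neq0.
have e r a : rep c = r -> (1 + k * (1 - om)) * r - c = a * ((1 - om) * c) -> q c = a.
  by move=> er h; rewrite /q /mu er h mulfK.
have : rep c = c \/ rep c = om * c \/ rep c = om * (om * c).
  rewrite /rep /select; case: ifP => _; first by left.
  by case: ifP => _; [right; left|right; right].
case=> [h|[h|h]].
- by rewrite (e _ k h) //; ring.
- by rewrite (e _ (om * k - 1) h) //; ring.
by rewrite (e _ (om ^+ 2 * (k + 1)) h) //; ring: omE.
Qed.

Let kap (d : F) : nat := let c := d / (1 - om) in if C c then val (q c) else (p.-1 - val (q (- c)))%N.

Lemma apex_kap : exists (kap : F -> nat) (mu : F -> F),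
  [/\ forall d, d != 0 -> (kap (- d) + kap d = p.-1)%N, forall d, d != 0 -> odd (kap d),
    forall c, mu (om * c) = mu c &
    forall c, c != 0 -> C c -> mu c - c = (kap ((1 - om) * c))%:R * ((1 - om) * c)].
Proof.
have ep : ~~ odd p.-1 by case: (even_prime pp) => [e|]; lia.
have dn d : d != 0 -> d / (1 - om) != 0 by move=> n; rewrite mulf_neq0 // invr_eq0.
have lq c : (val (q c) <= p.-1)%N by rewrite -ltnS prednK ?prime_gt0 // Fp_val_lt.
exists kap, mu; split.
- move=> d n; rewrite /kap mulNr CN ?dn //; have l1 := lq (d / (1 - om)); have l2 := lq (- (d / (1 - om))).
  by rewrite opprK; case: (C _); [exact: subnK l1|exact: subnKC l2].
- move=> d n; rewrite /kap; case: ifP => c; first exact/q_odd/dn.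
  by rewrite oddB ?lq // (negPf ep) q_odd // oppr_eq0 dn.
- by move=> c; rewrite /mu rep_rot.
move=> c c0 hc; have e : (1 - om) * c / (1 - om) = c by rewrite mulrC mulKf.
have eq : q c * ((1 - om) * c) = mu c - c by rewrite /q divfK // mulf_neq0.
have ek : kap ((1 - om) * c) = val (q c) by rewrite /kap e hc.
by rewrite ek (Fp_valK (q c) pp) eq.
Qed.
End Apex.

(** * Rotational systems for the listed primes *)

Local Open Scope ring_scope.

(** The powers g^i with i < 2h represent the cosets of the group of m-th roots of unity; the factor
    f from this group carries d to its representative. *)
Definition nrm p (g : 'F_p) (h m : nat) (d : 'F_p) (i : nat) (f : 'F_p) : Prop :=
  [/\ (i < h.*2)%N, f ^+ m = 1 & d * f = g ^+ i].

(** The union of the first h cosets, recognized by m-th powers. If (g^m)^h = -1 and m is odd,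
    negation shifts cosets by h, so exactly one of c, -c belongs to it; if 3 divides m,
    multiplication by a cube root of unity preserves it. *)
Definition res_class p (g : 'F_p) (h m : nat) (c : 'F_p) : bool :=
  (c != 0) && has (fun j => c ^+ m == (g ^+ m) ^+ j) (iota 0 h).

Section Orbits.
Variables (p : nat) (om g : 'F_p) (h m : nat) (Wp : nat -> 'F_p -> 'F_p -> Prop).
Hypotheses (pp : prime p) (p3 : (3 < p)%N).
Local Notation F := 'F_p.
Local Notation idx := (h.*2).
Implicit Types x y z w c f a b d t : F.
Hypotheses (omE : om ^+ 2 = - om - 1) (om1 : om != 1).
Let zeta := g ^+ m.
Hypotheses (m_odd : odd m) (m3 : (3 %| m)%N) (h0 : (0 < h)%N) (zh : zeta ^+ h = -1).
Hypothesis zI : forall i j, (i < idx)%N -> (j < idx)%N -> zeta ^+ i = zeta ^+ j -> i = j.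
Local Notation nrm := (nrm g h m).
Hypothesis nrm_ex : forall d, d != 0 -> exists i f, nrm d i f.
Local Notation C := (res_class g h m).
Let nrm_pow d i f : nrm d i f -> d ^+ m = zeta ^+ i.
Proof. by case=> _ f1 e; rewrite -[LHS]mulr1 -f1 -exprMn e /zeta -!exprM mulnC. Qed.
Let m0 : (0 < m)%N. Proof. by case: (m) m_odd. Qed.
Let f0 f : f ^+ m = 1 -> f != 0.
Proof. by apply: contra_eq_neq => ->; rewrite expr0n; case: (m) m0 => //= n _; rewrite eq_sym oner_eq0. Qed.

Let nrm_uniq d i f i' f' : d != 0 -> nrm d i f -> nrm d i' f' -> i = i' /\ f = f'.
Proof.
move=> d0 n n'; have e : i = i'.
  by case: (n) (n') => l _ _ [l' _ _]; apply: zI => //; rewrite -(nrm_pow n) (nrm_pow n').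
split=> //; subst i'; case: n n' => _ _ e [_ _ e']; apply: (mulfI d0); by rewrite e e'.
Qed.

Let nrm_scale d i f u : u ^+ m = 1 -> nrm (d * u) i f -> nrm d i (u * f).
Proof. by move=> u1 [l f1 e]; split => //; rewrite ?exprMn ?u1 ?f1 ?mulr1 // mulrA. Qed.

Lemma res_class_nrm c i f : c != 0 -> nrm c i f -> C c = (i < h)%N.
Proof.
move=> c0 n; have [li _ _] := n; have e := nrm_pow n; rewrite /res_class c0 /=; apply/hasP/idP => [[j]|l].
  rewrite mem_iota add0n e => /andP [_ lj] /eqP ez.
  have lj' : (j < idx)%N by apply: leq_trans lj _; rewrite -addnn leq_addl.
  by rewrite (zI li lj' ez).
by exists i; rewrite ?mem_iota ?e //=.
Qed.

Let classE c : c != 0 -> exists2 i, (i < idx)%N & c ^+ m = zeta ^+ i /\ C c = (i < h)%N.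
Proof.
move=> c0; have [i [f n]] := nrm_ex c0; have [li _ _] := n; have e := nrm_pow n.
by exists i => //; split=> //; apply: res_class_nrm n.
Qed.

Lemma res_classN c : c != 0 -> C (- c) = ~~ C c.
Proof.
move=> c0; have [i li [e ->]] := classE c0; have n0 : - c != 0 by rewrite oppr_eq0.
have [j lj [e' ->]] := classE n0.
have {}e' : zeta ^+ j = zeta ^+ h * zeta ^+ i.
  by rewrite zh -e -e' exprNn -signr_odd m_odd expr1 mulN1r.
have z2 : zeta ^+ h * zeta ^+ h = 1 by rewrite zh mulrNN mulr1.
case: (ltnP i h) => l.
  by have := zI lj (j := (h + i)%N); rewrite exprD e' => /(_ ltac:(lia) erefl); lia.
have := zI lj (j := (i - h)%N); have -> : zeta ^+ (i - h) = zeta ^+ j.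
  by rewrite e' -[in RHS](subnKC l) exprD mulrA z2 mul1r.
by move=> /(_ ltac:(lia) erefl); lia.
Qed.

Hypothesis W1 : forall i a b b', Wp i a b -> Wp i a b' -> b = b'.
Hypothesis W2 : forall i a, (i < idx)%N -> distinct3 0 (g ^+ i) a -> ~~ ctri om C 0 (g ^+ i) a ->
  exists b, Wp i a b.
Hypothesis W3 : forall i a b, Wp i a b -> distinct3 0 (g ^+ i) a /\ ~~ ctri om C 0 (g ^+ i) a.
Hypothesis W34 : forall i a b, Wp i a b -> Wp i b a.
Hypothesis W23 : forall i a b, (i < idx)%N -> Wp i a b ->
  exists i' f, nrm a i' f /\ Wp i' (g ^+ i * f) (b * f).
Hypothesis W12 : forall i a b, (i < idx)%N -> Wp i a b ->
  exists i' f, nrm (- g ^+ i) i' f /\ Wp i' ((a - g ^+ i) * f) ((b - g ^+ i) * f).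

Let CM u c : u ^+ m = 1 -> C (u * c) = C c.
Proof. by move=> u1; rewrite /res_class mulf_eq0 (negPf (f0 u1)) /= exprMn u1 mul1r. Qed.
Let omm : om ^+ m = 1.
Proof.
have o3 : om ^+ 3 = 1 by rewrite exprS omE; ring: omE.
by case/dvdnP: m3 => k ->; rewrite mulnC exprM o3 expr1n.
Qed.

Let ctriM u x y z t : u ^+ m = 1 -> ctri om C ((x - t) * u) ((y - t) * u) ((z - t) * u) = ctri om C x y z.
Proof.
move=> u1; have u0 := f0 u1.
have e0 x' y' : ctri0 om C ((x' - t) * u) ((y' - t) * u) ((z - t) * u) = ctri0 om C x' y' z.
  rewrite /ctri0; congr (_ && _).
    have -> : (x' - t) * u + om * ((y' - t) * u) - (1 + om) * ((z - t) * u) =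
      u * (x' + om * y' - (1 + om) * z) by ring.
    by rewrite mulf_eq0 (negPf u0).
  have -> : centre om ((x' - t) * u) ((y' - t) * u) = u * centre om x' y' by rewrite /centre; ring.
  exact: CM.
by rewrite /ctri !e0.
Qed.

(** An affine map with multiplier f carries x to 0 and y to some g^i, after which [Wp i] relates the
    other two points. The symmetries of [Q] that move x or y therefore require renormalizing, as in
    [W12] and [W23]. *)
Let Q x y z w : Prop := exists i f, nrm (y - x) i f /\ Wp i ((z - x) * f) ((w - x) * f).

Let Qneq x y z w : Q x y z w -> x != y.
Proof.
case=> i [f [[_ f1 e] wp]]; have [/and3P [n _ _] _] := W3 wp.
by apply: contra_neq n => exy; rewrite -e exy subrr mul0r.
Qed.

Let Q34 x y z w : Q x y z w -> Q x y w z.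
Proof. by case=> i [f [n wp]]; exists i, f; split => //; apply: W34. Qed.

Let Q12 x y z w : Q x y z w -> Q y x z w.
Proof.
case=> i [f [n wp]]; have [li f1 e] := n; have [i' [f' [n' wp']]] := W12 li wp.
exists i', (f * f'); split.
  by apply: nrm_scale f1 _; rewrite (_ : (x - y) * f = - g ^+ i) // -e; ring.
have ez v : (v - y) * (f * f') = ((v - x) * f - g ^+ i) * f' by rewrite -e; ring.
by rewrite !ez.
Qed.

Let Q23 x y z w : Q x y z w -> Q x z y w.
Proof.
case=> i [f [n wp]]; have [li f1 e] := n; have [i' [f' [n' wp']]] := W23 li wp.
by exists i', (f * f'); split; [apply: nrm_scale f1 _|rewrite !mulrA e].
Qed.

Let norm_dom x y z i f : nrm (y - x) i f ->
  (distinct3 0 (g ^+ i) ((z - x) * f) = distinct3 x y z) /\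
  (ctri om C 0 (g ^+ i) ((z - x) * f) = ctri om C x y z).
Proof.
case=> li f1 e; split; last by rewrite -(ctriM x y z x f1) -e subrr mul0r.
have inj : injective (fun v => (v - x) * f) by move=> a b /(mulIf (f0 f1)) /addIr.
have e0 : 0 = (x - x) * f by rewrite subrr mul0r.
by rewrite {1}e0 -e /distinct3 !(inj_eq inj).
Qed.

Lemma rosqs_orbits : rosqs om C Q.
Proof.
split => //.
- exact: res_classN.
- by move=> c; apply: CM.
- split => //.
  + move=> x y z w [i [f [n wp]]]; have [<- <-] := norm_dom z n.
    by have [-> ->] := W3 wp.
  + move=> x y z /andP [d c]; have /and3P [nxy _ _] := d.
    have [|i [f n]] := nrm_ex (d := y - x); first by rewrite subr_eq0 eq_sym.
    have [li f1 e] := n; have [e1 e2] := norm_dom z n.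
    have [|||b wb] := @W2 i ((z - x) * f); rewrite ?e1 ?e2 //.
    exists (x + b / f), i, f; split => //; have -> : (x + b / f - x) * f = b; last by [].
    by rewrite addrAC subrr add0r divfK // f0.
  move=> x y z w w' q [i' [f' [n' wp']]]; have nxy := Qneq q; case: q => i [f [n wp]].
  have yx : y - x != 0 by rewrite subr_eq0 eq_sym.
  have [ei ef] := nrm_uniq yx n n'; subst i' f'; have [_ f1 _] := n.
  have /(mulIf (f0 f1)) := W1 wp wp'; exact: addIr.
move=> t x y z w [i [f [n wp]]]; exists i, f.
have e a b : b + t - (a + t) = b - a by ring.
by rewrite !e.
Qed.
End Orbits.

Local Close Scope ring_scope.

(** * Checking base blocks by computation *)

Section Compute.
Variable P : N.
Definition mulm (a b : N) : N := N.modulo (N.mul a b) P.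
Definition subm (a b : N) : N := N.modulo (N.sub (N.add a P) b) P.
Fixpoint powp (a : N) (e : positive) : N := match e with
  | xH => a | xO e' => let b := powp a e' in mulm b b
  | xI e' => let b := powp a e' in mulm a (mulm b b) end.
Fixpoint powers (a c : N) (n : nat) : seq N := if n is n'.+1 then c :: powers a (mulm a c) n' else [::].
Definition look (T : seq (nat * N)) (d : N) := nth (0, N0) T (N.to_nat d).
Definition look2 (W : seq (seq N)) (i : nat) (z : N) := nth N0 (nth [::] W i) (N.to_nat z).

(** The entry of d = g^i hh^j is (i, hh^-j), where hh = g^(2h); its inverse is hi = hh^(m-1). *)
Definition norm_table (g : N) (h m : nat) : seq (nat * N) :=
  let hh := last N0 (powers g 1 h.*2.+1) in let hi := last N0 (powers hh 1 m) in
  foldr (fun (ie : nat * N) T => foldr (fun (hf : N * N) T =>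
    set_nth (0, N0) T (N.to_nat (mulm ie.2 hf.1)) (ie.1, hf.2)) T (zip (powers hh 1 m) (powers hi 1 m)))
  [::] (zip (iota 0 h.*2) (powers g 1 h.*2)).

Fixpoint foursN (s : seq N) : seq (seq N) :=
  if s is a :: b :: c :: d :: s' then [:: a; b; c; d] :: foursN s' else [::].
(** Row i holds at position z the point w of the block {0, g^i, z, w}, produced from all 24
    orderings of each base block; 0 stands for no block. Both tables are mere witnesses: [table_ok]
    checks everything that is used about them. *)
Definition block_table (T : seq (nat * N)) (base : seq N) : seq (seq N) :=
  let ps := permutations (iota 0 4) in
  foldl (fun W b => foldl (fun W q =>
    if [seq nth N0 b j | j <- q] is [:: x; y; z; w] then
      let: (i, f) := look T (subm y x) in
      set_nth [::] W i (set_nth N0 (nth [::] W i) (N.to_nat (mulm (subm z x) f)) (mulm (subm w x) f))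
    else W) W ps) [::] (foursN base).

(** [iv] is the inverse of 1 - [om]. The last clause checks the hypotheses on [Wp] of the section
    [Orbits] for every z: totality outside the hole, the symmetry [W34], then [W23] and [W12]. *)
Definition table_ok (g om iv k : N) (h : nat) (M : positive) (T : seq (nat * N)) (W : seq (seq N)) : bool :=
  let G := powers g 1 h.*2 in let zs := iota 1 (N.to_nat P).-1 in
  [&& [&& N.ltb 1 g && N.ltb g P, N.ltb om P && N.ltb 1 om, N.eqb (N.modulo (om * om + om + 1) P) 0,
       N.eqb (mulm iv (subm 1 om)) 1 & (0 < h)%N],
    [&& N.odd k, N.ltb k P, N.odd (mulm (mulm om om) (k + 1)) & N.odd (subm (mulm om k) 1)],
    all (fun n => let d := N.of_nat n in let: (i, f) := look T d in
      [&& (i < h.*2)%N, N.eqb (mulm d f) (nth N0 G i) & N.eqb (powp f M) 1]) zs,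
    uniq [seq N.to_nat (powp x M) | x <- G] && N.eqb (powp (nth N0 G h) M) (P - 1) &
    all (fun i => let y := nth N0 G i in
      (* The third vertex of the missing triangle on 0 and y, where the table must be empty. *)
      let hole := if ((look T (mulm y iv)).1 < h)%N then mulm (P - om) y else mulm (1 + om) y in
      let: (i2, f2) := look T (P - y) in
      all (fun n => let z := N.of_nat n in let w := look2 W i z in
        if N.eqb z y || N.eqb z hole then N.eqb w 0 else
        [&& N.ltb 0 w, N.ltb w P, N.eqb (look2 W i w) z,
            let: (i', f) := look T z in N.eqb (look2 W i' (mulm y f)) (mulm w f) &
            N.eqb (look2 W i2 (mulm (subm z y) f2)) (mulm (subm w y) f2)]) zs) (iota 0 h.*2)].
End Compute.

Lemma N_odd_nat (n : N) : N.odd n -> odd (N.to_nat n).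
Proof.
move/N.odd_spec => [q ->]; have -> : N.to_nat (2 * q + 1)%num = (N.to_nat q).*2.+1 by lia.
by rewrite /= odd_double.
Qed.

Section Table.
Variables (p : nat) (P g om iv k : N) (h : nat) (M : positive) (T : seq (nat * N)) (W : seq (seq N)).
Hypotheses (pp : prime p) (p3 : 3 < p) (Pp : N.to_nat P = p).
Let m := Pos.to_nat M.
Hypotheses (mo : odd m) (m3 : 3 %| m).
Hypothesis ok : table_ok P g om iv k h M T W.
Local Notation F := 'F_p.
Local Open Scope ring_scope.
Let toF (n : N) : F := (N.to_nat n)%:R.
Let ltP (n : N) : bool := (N.to_nat n < p)%N.
Local Notation idx := h.*2.
Local Notation G := (powers P g 1 h.*2).

Let valF n : ltP n -> val (toF n) = N.to_nat n.
Proof. by move=> l; rewrite /toF /= val_Fp_nat // modn_small. Qed.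
Let toF_inj n n' : ltP n -> ltP n' -> toF n = toF n' -> n = n'.
Proof. by move=> l l' e; apply: N2Nat.inj; apply: (Fp_nat_inj pp l l' e). Qed.
Let ofF (a : F) : N := N.of_nat (val a).
Let toFK a : toF (ofF a) = a.
Proof. by rewrite /toF /ofF Nat2N.id Fp_valK. Qed.
Let ofFK n : ltP n -> ofF (toF n) = n.
Proof. by move=> l; rewrite /ofF valF // N2Nat.id. Qed.
Let ofF_lt a : ltP (ofF a).
Proof. by rewrite /ltP /ofF Nat2N.id Fp_val_lt. Qed.
Let P0 : P <> N0. Proof. by move=> e; move: p3; rewrite -Pp e. Qed.
Let mod_lt n : ltP (N.modulo n P).
Proof. by rewrite /ltP -Pp; have := N.mod_lt n P P0; lia. Qed.
Let toF_mod n : toF (N.modulo n P) = toF n.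
Proof.
by rewrite [in RHS](N.div_mod n P P0) /toF N2Nat.inj_add N2Nat.inj_mul natrD natrM Pp Fp_p0 // mul0r add0r.
Qed.
Let toFM a b : toF (mulm P a b) = toF a * toF b.
Proof. by rewrite /mulm toF_mod /toF N2Nat.inj_mul natrM. Qed.
Let toF_P : toF P = 0. Proof. by rewrite /toF Pp Fp_p0. Qed.
Let toFD a b : toF (N.add a b) = toF a + toF b. Proof. by rewrite /toF N2Nat.inj_add natrD. Qed.
Let toFB a b : (N.to_nat b <= N.to_nat a)%N -> toF (N.sub a b) = toF a - toF b.
Proof. by move=> l; rewrite /toF N2Nat.inj_sub -natrB. Qed.
Let ltP_le n : ltP n -> (N.to_nat n <= N.to_nat P)%N.
Proof. by rewrite Pp; apply: ltnW. Qed.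
Let N0_lt n : N.lt 0 n -> (0 < N.to_nat n)%N.
Proof. by clear; lia. Qed.
Let NltP n : N.lt n P -> ltP n.
Proof. by rewrite /ltP -Pp; clear; lia. Qed.
Let subP_lt n : (0 < N.to_nat n)%N -> ltP (N.sub P n).
Proof. by move=> n0; rewrite /ltP N2Nat.inj_sub Pp; change (p - N.to_nat n < p)%N; rewrite ltn_subrL n0 prime_gt0. Qed.
Let toF_sub a b : ltP b -> toF (subm P a b) = toF a - toF b.
Proof.
move=> l; rewrite /subm toF_mod toFB ?toFD ?toF_P ?addr0 //.
by rewrite N2Nat.inj_add Pp; rewrite /ltP in l; lia.
Qed.
Let mulm_lt a b : ltP (mulm P a b). Proof. exact: mod_lt. Qed.
Let subm_lt a b : ltP (subm P a b). Proof. exact: mod_lt. Qed.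
Let toF1 : toF 1 = 1. Proof. by []. Qed.
Let toF_pow a e : toF (powp P a e) = toF a ^+ Pos.to_nat e.
Proof.
elim: e => [e IH|e IH|] /=.
- have -> : Pos.to_nat (xI e) = (Pos.to_nat e * 2).+1 by lia.
  by rewrite !toFM IH exprS exprM expr2.
- have -> : Pos.to_nat (xO e) = (Pos.to_nat e * 2)%N by lia.
  by rewrite !toFM IH exprM expr2.
by rewrite expr1.
Qed.
Let powers_nth a c n i : (i < n)%N -> ltP c -> ltP (nth N0 (powers P a c n) i) /\
  toF (nth N0 (powers P a c n) i) = toF c * toF a ^+ i.
Proof.
elim: n c i => [|n IH] c [|i] //= l lc; first by rewrite expr0 mulr1.
have [-> ->] := IH (mulm P a c) i l (mulm_lt _ _); split=> //.
by rewrite toFM exprS; ring.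
Qed.
Let one_lt : ltP 1. Proof. by rewrite /ltP /=; lia. Qed.
Let G_lt i : (i < idx)%N -> ltP (nth N0 G i). Proof. by move=> l; have [] := powers_nth g l one_lt. Qed.
Let G_toF i : (i < idx)%N -> toF (nth N0 G i) = toF g ^+ i.
Proof. by move=> l; have [_ ->] := powers_nth g l one_lt; rewrite toF1 mul1r. Qed.
Let powp_lt a e : ltP a -> ltP (powp P a e).
Proof. by case: e => [e|e|] //= _; apply: mulm_lt. Qed.
Let eqF a b : ltP a -> ltP b -> N.eqb a b = (toF a == toF b).
Proof.
move=> la lb; case: N.eqb_spec => [->|n]; first by rewrite eqxx.
by apply/esym/negbTE/eqP => e; apply: n; apply: toF_inj.
Qed.
Let size_G n a c : size (powers P a c n) = n.
Proof. by elim: n c => //= n IH c; rewrite IH. Qed.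

Let zeta := toF g ^+ m.
Local Notation C := (res_class (toF g) h m).
Local Notation nr := (nrm (toF g) h m).

Let num : [/\ toF om ^+ 2 = - toF om - 1, toF om != 1, toF iv * (1 - toF om) = 1, ltP om & (0 < h)%N].
Proof.
case/and5P: ok => /and5P [_ /andP [/N.ltb_lt l1 /N.ltb_lt l2] /N.eqb_eq e1 /N.eqb_eq e2 h0] _ _ _ _.
have lo : ltP om by rewrite /ltP -Pp; lia.
split=> //.
- have := toF_mod (om * om + om + 1); rewrite e1 !toFD toF1 => e.
  have em : toF (om * om) = toF om * toF om by rewrite /toF N2Nat.inj_mul natrM.
  rewrite em in e; have {}e : toF om * toF om + toF om + 1 = 0 by rewrite -e.
  by rewrite expr2 -[LHS]subr0 -e; ring.
- by apply/eqP => /(toF_inj lo one_lt) e; move: l2; rewrite e.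
by have := congr1 toF e2; rewrite toFM toF_sub // toF1.
Qed.

Let Tok d : (0 < N.to_nat d)%N -> ltP d -> nr (toF d) (look T d).1 (toF (look T d).2).
Proof.
move=> d0 ld; case/and5P: ok => _ _ /allP h1 _ _.
have /h1 : N.to_nat d \in iota 1 (N.to_nat P).-1 by rewrite mem_iota Pp; rewrite /ltP in ld; lia.
lazy zeta; rewrite N2Nat.id; case: (look T d) => i f /and3P [li /N.eqb_eq e1 /N.eqb_eq e2]; split=> //=.
  by have := congr1 toF e2; rewrite toF_pow.
by rewrite -G_toF // -e1 toFM.
Qed.

Let toF_neq0 d : ltP d -> (0 < N.to_nat d)%N -> toF d != 0.
Proof. by move=> ld d0; apply/eqP => e; have := valF ld; rewrite e /=; lia. Qed.
Let of_pos a : a != 0 -> (0 < N.to_nat (ofF a))%N.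
Proof. by move=> a0; rewrite /ofF Nat2N.id lt0n; apply: contra a0 => /eqP e; apply/eqP/val_inj. Qed.

Let nrT a : a != 0 -> nr a (look T (ofF a)).1 (toF (look T (ofF a)).2).
Proof. by move=> a0; have := Tok (of_pos a0) (ofF_lt a); rewrite toFK. Qed.

Let zI i j : (i < idx)%N -> (j < idx)%N -> zeta ^+ i = zeta ^+ j -> i = j.
Proof.
move=> li lj e; case/and5P: ok => _ _ _ /andP [u _] _.
have en l : (l < idx)%N -> nth 0%N [seq N.to_nat (powp P x M) | x <- G] l = val (zeta ^+ l).
  move=> ll; rewrite (nth_map N0) ?size_G // -valF ?powp_lt ?G_lt //.
  by rewrite toF_pow G_toF // /zeta -!exprM mulnC.
have /(uniqP 0%N) := u; apply; rewrite ?inE ?size_map ?size_G //.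
by rewrite !en // e.
Qed.

Let zh : zeta ^+ h = -1.
Proof.
have [_ _ _ _ h0] := num; case/and5P: ok => _ _ _ /andP [_ /N.eqb_eq e] _.
have lh : (h < idx)%N by lia.
have := congr1 toF e; rewrite toF_pow G_toF // toFB ?toF_P ?toF1 ?sub0r => [<-|]; last by rewrite Pp /=; lia.
by rewrite /zeta -!exprM mulnC.
Qed.

Let nr_ex d : d != 0 -> exists i f, nr d i f.
Proof. by move=> d0; exists (look T (ofF d)).1, (toF (look T (ofF d)).2); apply: nrT. Qed.

(** Of the two cubic triangles on 0 and y, one has c = y/(1 - [om]) and the other the negative of
    it; the class [C] decides which is missing. *)
Let hole i : F := let y := toF g ^+ i in
  if C (y * toF iv) then - toF om * y else (1 + toF om) * y.

Let gi0 : toF g != 0.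
Proof.
case/and5P: ok => /and5P [/andP [/N.ltb_lt l1 /N.ltb_lt l2] _ _ _ _] _ _ _ _.
by apply: toF_neq0; rewrite /ltP; lia.
Qed.
Let iv0 : toF iv != 0.
Proof. by have [_ _ e _ _] := num; apply/eqP => e0; move: e; rewrite e0 mul0r => /eqP; rewrite eq_sym oner_eq0. Qed.

Let holeE i a : (i < idx)%N -> ctri (toF om) C 0 (toF g ^+ i) a = (a == hole i).
Proof.
have [omE om1 ie _ h0] := num; move=> li; set y := toF g ^+ i.
have y0 : y != 0 by rewrite expf_neq0.
have o1 : 1 - toF om != 0 by rewrite subr_eq0 eq_sym.
have ivE : toF iv = (1 - toF om)^-1 by apply: (mulIf o1); rewrite ie mulVf.
have ec : centre (toF om) y 0 = y * toF iv by rewrite /centre subr0 ivE.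
have ec' : centre (toF om) 0 y = - (y * toF iv) by rewrite -ec /centre sub0r subr0 mulNr.
rewrite /ctri /ctri0 ec ec' (res_classN (om := toF om)) ?mulf_neq0 //.
have root u b : (u - (1 + toF om) * b == 0) = (b == - toF om * u).
  apply/eqP/eqP => [e|->]; last by ring: omE.
  transitivity (- toF om * ((1 + toF om) * b)); first by ring: omE.
  by congr (_ * _); apply/eqP; rewrite -subr_eq0 -oppr_eq0 opprB e.
rewrite add0r mulr0 addr0 !root /hole -/y; case: ifP => c /=; rewrite ?andbF ?andbT ?orbF //=.
congr (_ == _); by ring: omE.
Qed.

Let Wok i a : (i < idx)%N -> a != 0 ->
  let w := look2 W i (ofF a) in
  if (a == toF g ^+ i) || (a == hole i) then w = N0 else
  [/\ (0 < N.to_nat w)%N, ltP w, look2 W i w = ofF a,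
    look2 W (look T (ofF a)).1 (ofF (toF g ^+ i * toF (look T (ofF a)).2)) = ofF (toF w * toF (look T (ofF a)).2) &
    let f2 := toF (look T (ofF (- toF g ^+ i))).2 in
    look2 W (look T (ofF (- toF g ^+ i))).1 (ofF ((a - toF g ^+ i) * f2)) = ofF ((toF w - toF g ^+ i) * f2)].
Proof.
have [omE om1 ie lo h0] := num.
move=> li a0; case/and5P: ok => _ _ _ _ /allP /(_ i); rewrite mem_iota /= add0n => /(_ li).
have ly := G_lt li; have ey := G_toF li; set y := nth N0 G i in ly ey *.
have y0 : toF y != 0 by rewrite ey expf_neq0.
have yp : (0 < N.to_nat y)%N.
  by rewrite lt0n; apply: contra y0 => /eqP e; rewrite /toF e.
have Py : ofF (- toF g ^+ i) = N.sub P y.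
  by rewrite -(ofFK (subP_lt yp)); congr ofF; rewrite (toFB (ltP_le ly)) toF_P sub0r ey.
have hE : toF (if ((look T (mulm P y iv)).1 < h)%N then mulm P (P - om) y else mulm P (1 + om) y) = hole i.
  have c0 : toF (mulm P y iv) != 0 by rewrite toFM mulf_neq0.
  have n := nrT c0; rewrite ofFK // in n.
  have cE : C (toF (mulm P y iv)) = ((look T (mulm P y iv)).1 < h)%N.
    exact: (res_class_nrm zI c0 n).
  rewrite /hole -ey -toFM cE; case: ifP => _; rewrite toFM.
    by rewrite (toFB (ltP_le lo)) toF_P sub0r ey.
  by rewrite toFD toF1 ey.
have hl : ltP (if ((look T (mulm P y iv)).1 < h)%N then mulm P (P - om) y else mulm P (1 + om) y).
  by case: ifP => _; apply: mulm_lt.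
have inz : val a \in iota 1 p.-1.
  rewrite mem_iota; apply/andP; split; last by rewrite add1n prednK ?prime_gt0 //; exact: Fp_val_lt.
  by rewrite lt0n; apply: contra a0 => /eqP e; apply/eqP/val_inj.
rewrite Py; case: (look T (N.sub P y)) => i2 f2 /= /allP /(_ (val a)).
rewrite Pp => /(_ inz); rewrite -/(ofF a) => hh.
move: hh; rewrite (eqF (ofF_lt a) ly) (eqF (ofF_lt a) hl) toFK hE ey.
case: ifP => _; first by move/N.eqb_eq.
case/and5P => /N.ltb_lt l1 /N.ltb_lt l2 /N.eqb_eq e3.
have lw := NltP l2.
case: (look T (ofF a)) => i' f /= /N.eqb_eq e4 /N.eqb_eq e5; split=> //; first exact: N0_lt.
  by rewrite -ey -!toFM !ofFK.
by rewrite -ey -{1}(toFK a) -!toF_sub // -!toFM !ofFK.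
Qed.

Let Wp i a b : Prop := [/\ (i < idx)%N, a != 0, b != 0 & look2 W i (ofF a) = ofF b].

Let Wp_in i a b : Wp i a b -> (a == toF g ^+ i) || (a == hole i) = false.
Proof.
case=> li a0 b0 e; have := Wok li a0; rewrite /= e; case: ifP => // _ eb.
by move: (of_pos b0); rewrite eb.
Qed.

Let Wp34 i a b : Wp i a b -> Wp i b a.
Proof.
move=> wp; have n := Wp_in wp; case: wp => li a0 b0 e; have := Wok li a0; rewrite /= n e.
by case=> _ _ e2 _ _.
Qed.

Lemma table_ok_rosqs : has_rosqs p.
Proof.
have [omE om1 ie lo h0] := num.
have gi i : toF g ^+ i != 0 by rewrite expf_neq0.
exists (toF om), (toF k), C; eexists; split.
  apply: (@rosqs_orbits p (toF om) (toF g) h m Wp) => //.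
  - by move=> i a b b' [_ _ _ e] [_ _ _]; rewrite e => e'; rewrite -(toFK b) -(toFK b') e'.
  - move=> i a li /and3P [n1 n2 n3]; rewrite holeE // => nh.
    have a0 : a != 0 by rewrite eq_sym.
    have := Wok li a0; rewrite /= [a == _]eq_sym (negPf n3) (negPf nh) /= => -[w0 lw _ _ _].
    by exists (toF (look2 W i (ofF a))); split; rewrite ?ofFK ?toF_neq0.
  - move=> i a b wp; have /negbT := Wp_in wp; rewrite negb_or => /andP [n1 n2].
    by case: wp => li a0 b0 e; rewrite holeE // n2 /distinct3 ![_ == a]eq_sym a0 n1 eq_sym gi.
  - move=> i a b li wp; have n := Wp_in wp; case: wp => _ a0 b0 e; have := Wok li a0.
    rewrite /= n e toFK => -[_ _ _ e4 _]; have nn := nrT a0.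
    exists (look T (ofF a)).1, (toF (look T (ofF a)).2); split=> //; have [l f1 ef] := nn.
    have f0 : toF (look T (ofF a)).2 != 0.
      by apply/eqP => z; move: ef; rewrite z mulr0 => /esym /eqP; rewrite (negPf (gi _)).
    by split; rewrite ?mulf_neq0.
  move=> i a b li wp; have n := Wp_in wp; have n' := Wp_in (Wp34 wp); case: wp => _ a0 b0 e; have := Wok li a0.
  rewrite /= n e toFK => -[_ _ _ _ e5]; have y0 : - toF g ^+ i != 0 by rewrite oppr_eq0.
  have nn := nrT y0; move/negbT: n n'; rewrite negb_or => /andP [n _] /negbT; rewrite negb_or => /andP [n' _].
  exists (look T (ofF (- toF g ^+ i))).1, (toF (look T (ofF (- toF g ^+ i))).2).
  split=> //; have [l f1 ef] := nn.
  have f0 : toF (look T (ofF (- toF g ^+ i))).2 != 0.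
    by apply/eqP => z; move: ef; rewrite z mulr0 => /esym /eqP; rewrite (negPf (gi _)).
  by split; rewrite ?mulf_neq0 ?subr_eq0.
case/and5P: ok => _ /and4P [k1 /N.ltb_lt k2 k3 k4] _ _ _.
have lk := NltP k2.
have e2 : toF om ^+ 2 * (toF k + 1) = toF (mulm P (mulm P om om) (k + 1)) by rewrite !toFM toFD toF1 expr2.
have e3 : toF om * toF k - 1 = toF (subm P (mulm P om k) 1) by rewrite toF_sub // toFM toF1.
by rewrite e2 e3 !valF // !N_odd_nat.
Qed.
End Table.

Definition table_check p (P g om iv k : N) (h : nat) (M : positive) (base : seq N) : bool :=
  let m := Pos.to_nat M in let T := norm_table P g h m in
  [&& prime p, 3 < p, N.to_nat P == p, odd m, 3 %| m &
     table_ok P g om iv k h M T (block_table P T base)].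

Lemma table_rosqs p (P g om iv k : N) (h : nat) (M : positive) (base : seq N) :
  table_check p P g om iv k h M base -> has_rosqs p.
Proof.
rewrite /table_check => /and5P [pp p3 /eqP Pp mo /andP [m3 ok]].
exact: (table_ok_rosqs pp p3 Pp mo m3 ok).
Qed.

(** Every four entries form a base block for the maps sending x to fx + t with f^m = 1. *)
Definition base37 : seq N := [::   0; 1; 5; 25; 0; 1; 7; 8; 0; 1; 2; 4; 0; 1; 6; 15; 0; 1; 9; 14; 0; 1; 12; 28; 0; 2; 17; 31]%num.
Definition base61 : seq N := [::   0; 1; 3; 26; 0; 1; 7; 22; 0; 1; 20; 30; 0; 1; 17; 40; 0; 1; 5; 34; 0; 1; 6; 56; 0; 1; 18; 36;
  0; 1; 4; 10; 0; 1; 2; 55; 0; 1; 15; 49; 0; 2; 30; 37]%num.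
Definition base73 : seq N := [::   0; 5; 28; 35; 0; 5; 11; 56; 0; 5; 26; 31; 0; 5; 10; 29; 0; 1; 12; 24; 0; 1; 22; 51; 0; 1; 6;
  23; 0; 1; 11; 68; 0; 1; 21; 27; 0; 1; 7; 15; 0; 1; 20; 60; 0; 1; 29; 47; 0; 1; 28; 49; 0; 1; 25;
  30; 0; 1; 3; 50; 0; 1; 16; 53; 0; 1; 19; 62; 0; 1; 13; 71; 0; 1; 8; 45; 0; 1; 42; 69; 0; 1; 34;
  40; 0; 1; 2; 5; 0; 5; 38; 50; 0; 1; 10; 66; 0; 25; 31; 44; 0; 1; 9; 52]%num.
Definition base109 : seq N := [::   0; 1; 17; 93; 0; 1; 67; 86; 0; 1; 38; 79; 0; 1; 13; 60; 0; 1; 56; 98; 0; 1; 6; 23; 0; 1; 7; 62;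
  0; 1; 55; 57; 0; 1; 11; 43; 0; 1; 2; 31; 0; 1; 24; 37; 0; 1; 9; 50; 0; 1; 19; 72; 0; 1; 18; 26;
  0; 1; 10; 103; 0; 1; 4; 16; 0; 1; 3; 105; 0; 1; 46; 52; 0; 1; 47; 65]%num.
Definition base157 : seq N := [::   0; 1; 15; 121; 0; 1; 10; 71; 0; 1; 3; 4; 0; 1; 47; 142; 0; 1; 36; 64; 0; 1; 25; 83; 0; 1; 26;
  132; 0; 1; 11; 62; 0; 1; 17; 67; 0; 1; 12; 30; 0; 1; 9; 43; 0; 1; 60; 136; 0; 1; 6; 22; 0; 1;
  24; 125; 0; 1; 16; 27; 0; 1; 23; 104; 0; 1; 18; 80; 0; 1; 38; 152; 0; 1; 5; 29; 0; 1; 2; 79; 0;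
  1; 20; 116; 0; 1; 8; 139; 0; 1; 44; 129; 0; 1; 21; 66; 0; 1; 7; 61; 0; 1; 14; 146; 0; 5; 34; 97]%num.
Definition base181 : seq N := [::   0; 1; 7; 24; 0; 2; 8; 112; 0; 1; 90; 104; 0; 1; 54; 57; 0; 1; 23; 99; 0; 1; 28; 59; 0; 1; 2;
  152; 0; 1; 8; 78; 0; 1; 25; 174; 0; 1; 17; 91; 0; 1; 9; 47; 0; 1; 58; 83; 0; 1; 11; 89; 0; 1;
  21; 109; 0; 1; 52; 84; 0; 1; 6; 53; 0; 1; 94; 112; 0; 1; 12; 19; 0; 1; 30; 35; 0; 1; 5; 32; 0;
  1; 41; 172; 0; 1; 3; 62; 0; 1; 22; 101; 0; 1; 10; 127; 0; 1; 15; 177; 0; 1; 61; 178; 0; 1; 31;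
  100; 0; 1; 4; 82; 0; 1; 33; 108; 0; 1; 49; 77; 0; 1; 50; 134]%num.
Definition base229 : seq N := [::   0; 1; 12; 203; 0; 1; 4; 148; 0; 1; 3; 17; 0; 1; 19; 122; 0; 1; 2; 46; 0; 1; 48; 187; 0; 1; 5;
  128; 0; 1; 16; 172; 0; 1; 56; 144; 0; 1; 24; 50; 0; 1; 109; 120; 0; 1; 28; 192; 0; 1; 23; 210;
  0; 1; 75; 87; 0; 1; 18; 88; 0; 1; 110; 129; 0; 1; 8; 34; 0; 1; 77; 111; 0; 1; 7; 53; 0; 1; 6;
  130; 0; 1; 10; 93; 0; 1; 11; 168; 0; 1; 89; 106; 0; 1; 73; 161; 0; 1; 124; 152; 0; 1; 30; 182;
  0; 1; 117; 190; 0; 1; 29; 189; 0; 1; 9; 39; 0; 1; 42; 114; 0; 1; 195; 223; 0; 1; 54; 72; 0; 1;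
  40; 92; 0; 1; 74; 97; 0; 1; 13; 150; 0; 1; 200; 208; 0; 1; 14; 156; 0; 1; 96; 136; 0; 1; 32; 95]%num.
Definition base277 : seq N := [::   0; 1; 84; 148; 0; 1; 59; 122; 0; 1; 9; 256; 0; 1; 4; 201; 0; 1; 11; 238; 0; 1; 14; 261; 0; 1;
  10; 33; 0; 1; 16; 231; 0; 1; 49; 131; 0; 1; 3; 58; 0; 1; 21; 270; 0; 1; 40; 264; 0; 1; 22; 78;
  0; 1; 28; 128; 0; 1; 18; 247; 0; 1; 2; 114; 0; 1; 6; 42; 0; 1; 25; 193; 0; 1; 51; 220; 0; 1; 13;
  142; 0; 1; 43; 82; 0; 1; 23; 96; 0; 1; 8; 76; 0; 1; 7; 269; 0; 1; 74; 245; 0; 1; 29; 153; 0; 1;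
  30; 125; 0; 1; 27; 183; 0; 1; 38; 81; 0; 1; 39; 260; 0; 1; 15; 166; 0; 1; 105; 234; 0; 1; 167;
  198; 0; 1; 26; 129; 0; 1; 62; 99; 0; 1; 12; 163; 0; 1; 172; 240; 0; 1; 135; 150; 0; 1; 35; 61;
  0; 1; 37; 152; 0; 1; 44; 98; 0; 1; 17; 195; 0; 1; 32; 126; 0; 1; 111; 184; 0; 1; 104; 254; 0; 1;
  117; 224; 0; 1; 118; 162]%num.

(** The numbers are p twice, g, [om], the inverse of 1 - [om], k, h and m, where p - 1 = 2hm. *)
Lemma rosqs37 : has_rosqs 37.
Proof. by apply: (@table_rosqs 37 37 2 26 34 3 2 9%positive base37); vm_compute. Qed.
Lemma rosqs61 : has_rosqs 61.
Proof. by apply: (@table_rosqs 61 61 2 47 57 5 2 15%positive base61); vm_compute. Qed.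
Lemma rosqs73 : has_rosqs 73.
Proof. by apply: (@table_rosqs 73 73 5 8 52 1 4 9%positive base73); vm_compute. Qed.
Lemma rosqs109 : has_rosqs 109.
Proof. by apply: (@table_rosqs 109 109 6 63 58 3 2 27%positive base109); vm_compute. Qed.
Lemma rosqs157 : has_rosqs 157.
Proof. by apply: (@table_rosqs 157 157 5 12 57 1 2 39%positive base157); vm_compute. Qed.
Lemma rosqs181 : has_rosqs 181.
Proof. by apply: (@table_rosqs 181 181 2 48 77 1 2 45%positive base181); vm_compute. Qed.
Lemma rosqs229 : has_rosqs 229.
Proof. by apply: (@table_rosqs 229 229 6 134 198 7 2 57%positive base229); vm_compute. Qed.
Lemma rosqs277 : has_rosqs 277.
Proof. by apply: (@table_rosqs 277 277 5 116 224 1 2 69%positive base277); vm_compute. Qed.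

(** * The invariant design on all fibres *)

Lemma has_rosqs7 p : prime p -> p %% 12 = 7 -> has_rosqs p.
Proof.
move=> pp p7; have p3 : 3 < p by lia.
have [om [k [omE om1 hk]]] := apex_exists pp p3 p7.
by have [C [Q rQ]] := rosqs7 pp p7 omE om1; exists om, k, C, Q.
Qed.

Lemma h2_exists p : prime p -> 3 < p -> has_rosqs p ->
  exists R : 'F_p * bool -> 'F_p * bool -> 'F_p * bool -> 'F_p * bool -> Prop,
  design (fun a b c => distinct3 a.1 b.1 c.1) R /\
  forall t a b c d, R a b c d ->
    R (a.1 + t, a.2)%R (b.1 + t, b.2)%R (c.1 + t, c.2)%R (d.1 + t, d.2)%R.
Proof.
move=> pp p3 [om [k [C [Q [rQ /and3P [k1 k2 k3]]]]]].
have [kap [mu [h1 h2 h3 h4]]] :=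
  apex_kap pp p3 (rosqs_om rQ) (rosqs_om1 rQ) k1 k2 k3 (rosqs_N rQ).
exact: (h2_design pp p3 rQ h1 h2 h3 h4).
Qed.

Lemma design_pull (A B : Type) (f : B -> A) (D : A -> A -> A -> Prop) R : bijective f -> design D R ->
  design (fun x y z => D (f x) (f y) (f z)) (fun x y z w => R (f x) (f y) (f z) (f w)).
Proof.
move=> [g fK gK] [s1 s2 s3 sd sx su]; split; try by move=> x y z w; eauto.
  by move=> x y z /sx [w h]; exists (g w); rewrite gK.
by move=> x y z w w' h h'; apply: (can_inj fK); apply: su h h'.
Qed.

Lemma distinct3_card (T : finType) (x : T) :
  #|[set q : T * T | distinct3 x q.1 q.2]| = (#|T| - 1) * (#|T| - 2).
Proof.
rewrite cardsE -(sum_pred (fun q : T * T => distinct3 x q.1 q.2)).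
rewrite -(pair_bigA _ (fun y z => distinct3 x y z : nat)) /= (bigID (pred1 x)) /=.
rewrite big1 ?add0n => [|y /eqP ->]; last first.
  by rewrite big1 // => z _; rewrite /distinct3 eqxx.
rewrite (eq_bigr (fun=> #|T| - 2)) => [|y nyx].
  rewrite sum_nat_const; congr (_ * _).
  by have := cardC1 x; rewrite -subn1 => <-; apply: eq_card => y; rewrite !inE.
rewrite (sum_pred (fun z => distinct3 x y z)); have := cardsC [set x; y]; rewrite cards2 eq_sym nyx => e.
rewrite -[#|T|]e addKn -[RHS]cardsE; apply: eq_card => z; rewrite !inE /distinct3 unfold_in.
by rewrite eq_sym nyx negb_or !(eq_sym z).
Qed.

Lemma eq_fst (A B : eqType) (x y : A * B) : x.1 = y.1 -> (x == y) = (x.2 == y.2).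
Proof. by case: x y => [a b] [a' b'] /= ->; rewrite xpair_eqE eqxx. Qed.

Lemma distinct3_fst (A B : eqType) (x y z : A * B) : x.1 = y.1 -> x.1 = z.1 ->
  distinct3 x y z = distinct3 x.2 y.2 z.2.
Proof. by move=> e1 e2; rewrite /distinct3 !eq_fst // -e1. Qed.

Section Final.
Variables (p : nat) (U : finType).
Hypotheses (pp : prime p) (p4 : 4 < p) (hr : has_rosqs p) (evU : ~~ odd #|U|) (U0 : 0 < #|U|).
Local Notation F := 'F_p.
Variables (DU : U -> U -> U -> Prop) (RU : U -> U -> U -> U -> Prop).
Hypothesis dU : design DU RU.
Let sh (t : F) (x : F * U) : F * U := ((x.1 + t)%R, x.2).

Lemma invariant_design : exists R : F * U -> F * U -> F * U -> F * U -> Prop,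
  design (@asm_dom F U DU) R /\ forall t x y z w, R x y z w -> R (sh t x) (sh t y) (sh t z) (sh t w).
Proof.
have [R2 [d2 i2]] := h2_exists pp (ltnW p4) hr.
have [K [c fc]] := onefact_even evU.
have [n en] : exists n, #|U| = n.+1.*2 by exists #|U|.-2./2; lia.
(* As u is even, an index in [U] can be read as a layer of the H-design together with a weight in
   Z/(u/2). *)
have [b [b' bK b'K]] : exists b : U -> bool * 'I_n.+1, bijective b.
  by apply: card_bij; rewrite card_prod card_bool card_ord en; lia.
pose f (x : F * U) : (F * bool) * 'I_n.+1 := ((x.1, (b x.2).1), (b x.2).2).
have fB : bijective f.
  exists (fun y => (y.1.1, b' (y.1.2, y.2))) => [[a v]|[[a l] v]]; rewrite /f /=.
    by rewrite -surjective_pairing bK.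
  by rewrite b'K.
have dH := design_pull fB (weight_design 'I_n.+1 d2).
pose RH x y z w := R2 (f x).1 (f y).1 (f z).1 (f w).1 /\
  ((f x).2 + (f y).2 + (f z).2 + (f w).2 = 0)%R.
have dH' : design (fun x y z : F * U => distinct3 x.1 y.1 z.1) RH := dH.
exists (asm_rel c RU RH); split; first exact: (asm_design fc dU dH').
move=> t x y z w [[e1 e2 e3 h]|[h|[h e]]].
- by left; split; rewrite /= -?e1 -?e2 -?e3.
- have ip a1 a2 a3 a4 : pair_rel (@neqr U) c a1 a2 a3 a4 -> pair_rel (@neqr U) c (sh t a1) (sh t a2) (sh t a3) (sh t a4).
    by case=> [[e1 e2 n'] n1 n2 ec]; split => //; split; [by rewrite /= e1|by rewrite /= e2|by rewrite /= (inj_eq (addIr t))].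
  by right; left; case: h => /ip h; [apply: Or31|apply: Or32|apply: Or33].
by right; right; split => //; exact: i2 h.
Qed.
End Final.

Lemma ooc_exists (p u : nat) (U : finType) (D : U -> U -> U -> bool) (M : nat) :
  prime p -> 4 < p -> has_rosqs p -> ~~ odd u -> 0 < u -> #|U| = u ->
  has_design (fun x y z => D x y z) -> (forall x y z, D x y z -> distinct3 x y z) ->
  (forall x : 'F_p * U, #|[set q : ('F_p * U) * ('F_p * U) |
     if (x.1 == q.1.1) && (x.1 == q.2.1) then D x.2 q.1.2 q.2.2 else distinct3 x q.1 q.2]| = M) ->
  exists C : {set 'M[bool]_(u, p)}, is_OOC_4_2 C /\ 24 * #|C| = u * M.
Proof.
move=> pp p4 hr ev u0 cU [RU dU] dD cM.
rewrite -cU in ev u0; have [R [dR iR]] := invariant_design pp p4 hr ev u0 dU.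
have [b [b' bK b'K]] : exists b : 'I_u -> U, bijective b by apply: card_bij; rewrite card_ord.
pose f (x : 'F_p * 'I_u) : 'F_p * U := (x.1, b x.2).
have fB : bijective f.
  by exists (fun y => (y.1, b' y.2)) => [[a v]|[a v]]; rewrite /f /= ?bK ?b'K.
pose DD (x y z : 'F_p * U) : bool := if (x.1 == y.1) && (x.1 == z.1) then D x.2 y.2 z.2 else distinct3 x y z.
have dR' : design (fun x y z => DD (f x) (f y) (f z)) (fun x y z w => R (f x) (f y) (f z) (f w)).
  have dR1 : design (fun x y z => DD x y z) R.
    by apply: design_eq dR => x y z; rewrite asm_domE /DD; case: ifP.
  exact: (design_pull fB dR1).
apply: (@ooc_of_design p u pp p4 _ _ M dR').
- by move=> t x y z w /(iR t).
- move=> x y z; rewrite /DD /distinct3 !(inj_eq (bij_inj fB)); case: ifP => // /andP [/eqP e1 /eqP e2].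
  move/dD; rewrite /distinct3 !(inj_eq (can_inj bK)).
  by case: x y z e1 e2 => [a i] [a' j] [a'' k] /= <- <-; rewrite !xpair_eqE eqxx.
move=> i; rewrite -(cM (f (0%R, i))).
pose f2 (q : ('F_p * 'I_u) * ('F_p * 'I_u)) := (f q.1, f q.2).
have f2B : bijective f2.
  case: fB => g fK gK; exists (fun q => (g q.1, g q.2)) => -[x y]; rewrite /f2 /= ?fK ?gK //.
rewrite -(on_card_preimset (onW_bij _ f2B)); apply: eq_card => q; rewrite !inE /DD.
by [].
Qed.

(** A group of six points is three pairs. The three unions of two pairs are the blocks added inside
    it, and the 8 triples with one point from each pair stay uncovered. *)
Definition pack_bad (m : nat) (x y z : 'I_m * ('I_3 * bool)) : bool :=
  [&& x.1 == y.1, x.1 == z.1 & distinct3 x.2.1 y.2.1 z.2.1].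

Lemma pairs3 (a b c : 'I_3 * bool) :
  pairs_dom (@neqr bool) a b c <-> distinct3 a b c && ~~ distinct3 a.1 b.1 c.1.
Proof.
case: a b c => [a i] [b j] [c k]; rewrite /pairs_dom /pair_dom /neqr /distinct3 /= !xpair_eqE.
have [<-|n1] := eqVneq a b; have [<-|n2] := eqVneq a c; rewrite /= ?andbT ?andbF.
- split; first by case=> [] [].
  by case: i j k => [] [] [].
- by split; [case=> [] [] // e; rewrite e eqxx in n2|move=> h; apply: Or31].
- rewrite (eq_sym b) (negPf n1) /= andbT; split; last by move=> h; apply: Or32.
  by case=> [] [] // e; rewrite e eqxx in n1.
have [<-|n3] := eqVneq b c; rewrite /= ?andbT ?andbF.
  split; last by move=> h; apply: Or33; split => //; rewrite eq_sym.
  by case=> [] [] // e; rewrite e eqxx in n1.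
by split=> //; case=> [] [] e; rewrite ?e ?eqxx // in n1 n2 n3.
Qed.

Lemma pack_design m : 0 < m -> has_design (fun x y z : 'I_m * ('I_3 * bool) =>
  distinct3 x y z && ~~ pack_bad x y z).
Proof.
move=> m0; have : cqs 'I_0 'I_m ('I_3 * bool)%type.
  apply: (@cqs_card _ _ _ 'I_0 'I_m _ erefl erefl _ (proj1 (gdes_cqs _ _) (gdes_exists m0))).
  by rewrite card_prod card_bool !card_ord.
move/gdes_cqs => dG.
have [|K [c fc]] := @onefact_even bool; first by rewrite card_bool.
have dF := fibre_design 'I_m (pairs_design 'I_3 fc).
apply: (has_design_union _ _ dG (ex_intro _ _ dF)) => x y z.
  by move=> /andP [_ n] [e1 e2 _]; case/negP: n; rewrite -e1 -e2 eqxx.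
rewrite /gdom /pack_bad; split=> [/andP [d]|].
  case: (boolP ((x.1 == y.1) && (x.1 == z.1))) => [/andP [/eqP e1 /eqP e2]|n _]; last by left; rewrite d.
  rewrite -e1 -e2 eqxx /= => nd; right; split => //; apply/pairs3.
  by rewrite nd andbT -distinct3_fst.
case=> [/andP [-> n]|[e1 e2 /pairs3 /andP [d nd]]].
  by move: n; rewrite !negb_and => /orP [->|->]; rewrite ?orbT.
by rewrite -e1 -e2 eqxx /= nd andbT distinct3_fst.
Qed.

(** An uncovered triple through x takes one point from each of the two other pairs of its group, in
    either order, which gives 2 * 2 * 2 = 8 ordered pairs. *)
Lemma pack_count p m (x : 'F_p * ('I_m * ('I_3 * bool))) :
  #|[set q : ('F_p * ('I_m * ('I_3 * bool))) * ('F_p * ('I_m * ('I_3 * bool))) |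
     if (x.1 == q.1.1) && (x.1 == q.2.1) then distinct3 x.2 q.1.2 q.2.2 && ~~ pack_bad x.2 q.1.2 q.2.2
     else distinct3 x q.1 q.2]| =
  (#|{: 'F_p * ('I_m * ('I_3 * bool))}| - 1) * (#|{: 'F_p * ('I_m * ('I_3 * bool))}| - 2) - 8.
Proof.
set A := [set q | distinct3 x q.1 q.2].
pose f (r : ('I_3 * 'I_3) * (bool * bool)) :=
  ((x.1, (x.2.1, (r.1.1, r.2.1))), (x.1, (x.2.1, (r.1.2, r.2.2)))).
pose B := f @: setX [set q : 'I_3 * 'I_3 | distinct3 x.2.2.1 q.1 q.2] [set: bool * bool].
have fI : injective f by move=> [[a b] [i j]] [[a' b'] [i' j']] [-> -> -> ->].
have cB : #|B| = 8.
  by rewrite card_imset // cardsX distinct3_card cardsT card_prod card_bool card_ord.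
have BE q : q \in B = [&& x.1 == q.1.1, x.1 == q.2.1 & pack_bad x.2 q.1.2 q.2.2].
  apply/imsetP/idP => [[r]|].
    by rewrite !inE andbT => d ->; rewrite /pack_bad /= !eqxx.
  case: q => [[a [k [i l]]] [a' [k' [i' l']]]] /= /and3P [/eqP <- /eqP <-] /and3P /= [/eqP <- /eqP <- d].
  by exists ((i, i'), (l, l')); rewrite ?inE ?andbT.
rewrite -(distinct3_card x) -/A -cB.
have sBA : B \subset A.
  apply/subsetP => q; rewrite BE inE /pack_bad => /and3P [_ _ /and3P [_ _ /and3P [n1 n2 n3]]].
  have ne (v v' : 'F_p * ('I_m * ('I_3 * bool))) : v.2.2.1 != v'.2.2.1 -> v != v' by apply: contra_neq => ->.
  by rewrite /distinct3 !ne.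
rewrite -(setIidPr sBA) -cardsD; apply: eq_card => q; rewrite !inE BE.
case: ifP => [/andP [/eqP e1 /eqP e2]|n].
  by rewrite -e1 -e2 eqxx /= andbC (distinct3_fst e1 e2).
by move: n; case: (x.1 == q.1.1) => //=; case: (x.1 == q.2.1).
Qed.

Lemma listed_primes p : p \in [:: 37; 61; 73; 109; 157; 181; 229; 277] -> has_rosqs p /\ 4 < p /\ p %% 6 = 1.
Proof.
rewrite !inE => /orP [/eqP ->|].
  by split; [exact: rosqs37|].
move => /orP [/eqP ->|].
  by split; [exact: rosqs61|].
move => /orP [/eqP ->|].
  by split; [exact: rosqs73|].
move => /orP [/eqP ->|].
  by split; [exact: rosqs109|].
move => /orP [/eqP ->|].
  by split; [exact: rosqs157|].
move => /orP [/eqP ->|].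
  by split; [exact: rosqs181|].
move => /orP [/eqP ->|].
  by split; [exact: rosqs229|].
by move/eqP => ->; split; [exact: rosqs277|].
Qed.

(** Put (up - 1)(up - 2) - 8 = 6x. The nested floors give x + 1, the subtraction leaves x, and ux/4
    = c is an integer, so the packing has exactly the size of the bound. *)
Lemma Jstar_eq u p s c : u * p = 6 * s -> 0 < s -> 24 * c = u * ((u * p - 1) * (u * p - 2) - 8) ->
  c = Jstar u p.
Proof.
case: s => // s es _; rewrite /Jstar es.
have -> : 6 * s.+1 - 1 = 6 * s + 5 by lia.
have -> : 6 * s.+1 - 2 = 6 * s + 4 by lia.
have -> : (6 * s + 4) %/ 2 = 3 * s + 2 by lia.
pose x := 6 * (s * s) + 9 * s + 2.
have -> : (6 * s + 5) * (6 * s + 4) - 8 = 6 * x by rewrite /x; lia.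
have -> : (6 * s + 5) * (3 * s + 2) = x.+1 * 3 + 1 by rewrite /x; lia.
rewrite divnMDl // addn0 subn1 /= => e.
have -> : u * x = c * 4 by lia.
by rewrite mulnK.
Qed.

Theorem theorem9p14 (p : nat) :
  prime p ->
  (p %% 12 = 7 \/ p \in [:: 37; 61; 73; 109; 157; 181; 229; 277]) ->
  (forall u : nat, (u %% 6 = 2 \/ u %% 6 = 4) ->
     exists C : {set 'M[bool]_(u, p)}, is_perfect_OOC_4_2 C) /\
  (forall u : nat, u %% 6 = 0 ->
     exists C : {set 'M[bool]_(u, p)}, is_OOC_4_2 C /\ #|C| = Jstar u p).
Proof.
move=> pp hp; have [hr [p4 p6]] : has_rosqs p /\ 4 < p /\ p %% 6 = 1.
  case: hp => [h|h]; last exact: listed_primes h.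
  by split; [exact: (has_rosqs7 pp h)|clear -h; lia].
split=> u hu.
  have hs : sqs 'I_u by apply: sqs_exists; rewrite !inE; case: hu => ->.
  have [|||||C [hC e]] := @ooc_exists p u 'I_u (@distinct3 _) ((p * u - 1) * (p * u - 2)) pp p4 hr _ _ _ hs.
  - by lia.
  - by lia.
  - by rewrite card_ord.
  - by [].
  - move=> x; have cT : #|{: 'F_p * 'I_u}| = p * u by rewrite card_prod card_Fp // card_ord.
    rewrite -cT -(distinct3_card x); apply: eq_card => q; rewrite !inE.
    by case: ifP => // /andP [/eqP e1 /eqP e2]; rewrite (distinct3_fst e1 e2).
  by exists C; split => //; rewrite e mulnA ![p * u]mulnC.
(* For u = 0 the formula gives 0, and the empty code has the required size. *)
have [->|u0] := posnP u.
  exists set0; split; last by rewrite cards0.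
  by split=> [A|A B r]; rewrite inE.
have [m em] : exists m, u = 6 * m.+1 by exists (u %/ 6).-1; lia.
have cU : #|{: 'I_m.+1 * ('I_3 * bool)}| = u by rewrite !card_prod card_bool !card_ord; lia.
have [|||C [hC e]] := @ooc_exists p u _ _ ((p * u - 1) * (p * u - 2) - 8) pp p4 hr _ u0 cU (pack_design (ltn0Sn m)).
- by lia.
- by move=> x y z /andP [].
- by move=> x; rewrite pack_count card_prod card_Fp // cU.
have h1 : u * p = 6 * (m.+1 * p) by rewrite em mulnA.
have h2 : 0 < m.+1 * p by rewrite muln_gt0 (prime_gt0 pp).
by exists C; split => //; apply: (Jstar_eq h1 h2); rewrite e (mulnC p u).
Qed.
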